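(* Let $\alpha\in(0,2)$, $\alpha\neq 1$, and suppose $0<\mathbb{E}[W_1^2]<\infty$. For $c>0$ let $R_{(c,\infty)}$, $m_{(c,\infty)}$ and $S_{(c,\infty)}=\sqrt{S^2_{(c,\infty)}}$ be as defined in the context. Then $$Z_{(c,\infty)}:=\frac{R_{(c,\infty)}-m_{(c,\infty)}}{S_{(c,\infty)}}\longrightarrow Z\quad\text{in distribution as } c\to\infty,$$ where $Z\sim\mathcal{N}(0,1)$.
   Context: Let $\{\Gamma_j\}_{j\ge1}$ be the successive arrival times of a unit rate Poisson process on $(0,\infty)$, and let $\{W_j\}_{j\ge 1}$ be i.i.d. real random variables independent of $\{\Gamma_j\}$. Define constants $b_j^{(\alpha)}=\frac{\alpha}{\alpha-1}\left(j^{(\alpha-1)/\alpha}-(j-1)^{(\alpha-1)/\alpha}\right)$ if $\alpha\in(1,2)$ and $b_j^{(\alpha)}=0$ if $\alpha\in(0,1)$. For $c>0$ and an integer $d>c$ let $$R_{(c,d)}:=\sum_{j:\Gamma_j\in(c,d)}W_j\Gamma_j^{-1/\alpha}-\mathbb{E}[W_1]\sum_{j=1}^{d}b_j^{(\alpha)}$$ (an empty sum is $0$), and let $R_{(c,\infty)}$ denote the limit in distribution of $R_{(c,d)}$ as $d\to\infty$ through the integers (this limit exists). Define $$m_{(c,\infty)}:=\mathbb{E}[W_1]\frac{\alpha}{1-\alpha}c^{\frac{\alpha-1}{\alpha}},\qquad S^2_{(c,\infty)}:=\mathbb{E}[W_1^2]\frac{\alpha}{2-\alpha}c^{\frac{\alpha-2}{\alpha}}.$$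 *)

(* Defs.v *)
From HB Require Import structures.
From mathcomp Require Import all_boot all_order all_algebra.
From mathcomp Require Import all_classical all_reals all_analysis.
Set Implicit Arguments.
Unset Strict Implicit.
Unset Printing Implicit Defensive.
Import Order.TTheory GRing.Theory Num.Theory.
Import numFieldNormedType.Exports.
Local Open Scope classical_set_scope.
Local Open Scope card_scope.
Local Open Scope ring_scope.

(* Since [B] may be [setT] at some indices, factorization over initial
   segments covers every finite subfamily. *)
Definition mutually_independent (R : realType) (d d' : measure_display)
    (T : measurableType d) (U : measurableType d') (P : probability T R)
    (X : nat -> T -> U) : Prop :=
  forall (n : nat) (B : nat -> set U), (forall i, measurable (B i)) ->
    P (\bigcap_(i in `I_n) (X i @^-1` B i)) =
    (\prod_(i < n) P (X i @^-1` B i))%E.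

Definition identically_distributed (R : realType) (d d' : measure_display)
    (T : measurableType d) (U : measurableType d') (P : probability T R)
    (X : nat -> {RV P >-> U}) : Prop :=
  forall (i j : nat) (B : set U), measurable B ->
    distribution P (X i) B = distribution P (X j) B.

Definition iid (R : realType) (d d' : measure_display)
    (T : measurableType d) (U : measurableType d') (P : probability T R)
    (X : nat -> {RV P >-> U}) : Prop :=
  mutually_independent P X /\ identically_distributed X.

Definition sigma_generated_by (d d' : measure_display)
    (T : measurableType d) (U : measurableType d') (X : nat -> T -> U) :
    set (set T) :=
  <<s \bigcup_j preimage_set_system setT (X j) measurable >>.

Definition independent_sequences (R : realType) (d d1 d2 : measure_display)
    (T : measurableType d) (U1 : measurableType d1) (U2 : measurableType d2)
    (P : probability T R) (X : nat -> T -> U1) (Y : nat -> T -> U2) : Prop :=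
  forall A B : set T, sigma_generated_by X A -> sigma_generated_by Y B ->
    P (A `&` B) = (P A * P B)%E.

(* Only times [t >= 0] matter. The natural-number subtraction in the increments
   is a genuine difference almost surely, by [upp_path]. *)
Record unit_rate_poisson_process (R : realType) (d : measure_display)
    (T : measurableType d) (P : probability T R)
    (N : R -> {RV P >-> nat}) : Prop := {
  upp_path : {ae P, forall w, N 0 w = 0%N /\
    forall s t : R, 0 <= s -> s <= t -> (N s w <= N t w)%N} ;
  upp_poisson : forall (s t : R) (k : nat), 0 <= s -> s < t ->
    P [set w | (N t w - N s w)%N = k] = (poisson_pmf (t - s) k)%:E ;
  upp_indep : forall t : nat -> R, 0 <= t 0%N ->
    (forall i, t i <= t i.+1) ->
    mutually_independent P (fun i w => (N (t i.+1) w - N (t i) w)%N) }.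

(* [Gam j] is the (j+1)-st arrival time of the counting process [N]. *)
Definition arrival_times (R : realType) (d : measure_display)
    (T : measurableType d) (P : probability T R)
    (N : R -> {RV P >-> nat}) (Gam : nat -> {RV P >-> R}) : Prop :=
  {ae P, forall w, [/\ 0 < Gam 0%N w,
    forall j, Gam j w < Gam j.+1 w &
    forall t : R, 0 <= t -> [set j | Gam j w <= t] #= `I_(N t w)]}.

(* [X i] converges in distribution to [Y] along the filter [F]; [Y] may live on
   another probability space. *)
Definition cvg_in_distribution (R : realType) (d d' : measure_display)
    (T : measurableType d) (T' : measurableType d')
    (P : probability T R) (P' : probability T' R) (I : Type)
    (X : I -> T -> R) (F : set_system I) (Y : T' -> R) : Prop :=
  forall f : R -> R, continuous f -> (exists M, forall x, `|f x| <= M) ->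
    ('E_P[f \o X i])%E @[i --> F] --> ('E_P'[f \o Y])%E.

(* If [1 < alpha] then [0 `^ ((alpha - 1) / alpha)] is [0], as needed for
   [j = 1]. *)
Definition centering (R : realType) (alpha : R) (j : nat) : R :=
  if 1 < alpha then
    alpha / (alpha - 1) * (j%:R `^ ((alpha - 1) / alpha) -
                           (j%:R - 1) `^ ((alpha - 1) / alpha))
  else 0.

Section residual.
Context (R : realType) (d : measure_display) (T : measurableType d).
Context (P : probability T R) (alpha : R).
Context (W Gam : nat -> {RV P >-> R}).

(* [W j] and [Gam j] are the (j+1)-st terms of their sequences. The sum over
   [j] is finite almost surely. *)
Definition residual (c : R) (D : nat) (w : T) : R :=
  \sum_(j \in [set j | c < Gam j w < D%:R]) (W j w * Gam j w `^ (- alpha^-1))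
  - fine ('E_P[W 0%N])%E * \sum_(1 <= j < D.+1) centering alpha j.

Definition residual_mean (c : R) : R :=
  fine ('E_P[W 0%N])%E * (alpha / (1 - alpha)) * c `^ ((alpha - 1) / alpha).

Definition residual_var (c : R) : R :=
  fine ('E_P[fun w => (W 0%N w ^+ 2)%R])%E * (alpha / (2 - alpha)) *
  c `^ ((alpha - 2) / alpha).

End residual.

(* Main.v *)
(* Lindeberg swapping along time. Split (c, D) into cells of length dt and give every
   jump the weight x^(-1/alpha) of the left end x of its cell. As the arrivals are
   Poisson and independent of the W_j, one more cell adds, with probability
   dt + O(dt^2), an independent term a W with a = x^(-1/alpha) / S_c. For a test
   function h this can be replaced with a Gaussian increment of mean a E[W] dt and
   variance a^2 E[W^2] dt, at a cost of order a^2 dt E[W^2 min(1, a |W|)] + o(dt).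
   Refining the cells and then letting D grow gives, for all c,
     |E h(Z_c) - E h(Z)| <= 7 C E[W^2 min(1, A_c |W|)] / E[W^2],
   where C depends on h only and A_c = c^(-1/alpha) / S_c is of order c^(-1/2); the
   bound vanishes as c grows, by dominated convergence. Bounded functions with a third
   order Taylor bound are enough to test convergence in distribution. *)
Require Import Defs.
From HB Require Import structures.
From mathcomp Require Import all_boot all_order all_algebra.
From mathcomp Require Import all_classical all_reals all_analysis measurable_realfun.
From mathcomp Require Import ring lra.
Set Implicit Arguments.
Unset Strict Implicit.
Unset Printing Implicit Defensive.
Import Order.TTheory GRing.Theory Num.Theory.
Import numFieldNormedType.Exports.
Local Open Scope classical_set_scope.
Local Open Scope ring_scope.

(** Only two moments of [W 0] are available, so a cubic Taylor remainder cannot be integrated;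
    capping it by a quadratic beyond |y| = 1 creates both the truncation in the error and the factor
    7. The Gaussian increments are never realised as random variables: they are integrated out of
    the test function. Such averaging has to preserve the constant [C], and it does so because a
    Taylor inequality is linear in [(h, h1, h2)]; no derivative is taken under an integral.
    Independence is given between the [W j] and the arrival times rather than the counting process,
    so events about cell counts must be rewritten, almost surely, as events about [Gam]. Once the
    counts are fixed, only a list of weights remains: the sum is a linear combination of the [W j]
    with constant coefficients, and one more arrival appends one coefficient. Finally, the limit law
    at a given [c] is known only through limits of expectations. Hence an explicit inequality at
    finite [D] is passed to the limit with [c] fixed, and the convergence in [D] may depend on [c]
    in any way. *)

(** * Integrals of bounded functions under a probability *)

Section probability_integral.
Context {R : realType} d {T : measurableType d} (P : probability T R).
Implicit Types f g k : T -> R.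

Lemma bounded_integrable f (M : R) : measurable_fun setT f ->
  (forall x, `|f x| <= M) -> P.-integrable setT (EFin \o f).
Proof.
move=> mf fM; apply: measurable_bounded_integrable => //.
  exact: le_lt_trans (probability_le1 P measurableT) (ltry 1).
by exists M; split; [exact: num_real|move=> y My x _; exact: le_trans (fM x) (ltW My)].
Qed.

Lemma prob_Rintegral_cst (r : R) : \int[P]_x r = r.
Proof. rewrite Rintegral_cst// -[RHS]mulr1; congr (_ * _).
exact: (congr1 fine (probability_setT P)). Qed.

Lemma expectation_Rintegral f : P.-integrable setT (EFin \o f) ->
  'E_P[f]%E = (\int[P]_x f x)%:E.
Proof. by move=> fi; rewrite unlock /Rintegral fineK// integrable_fin_num. Qed.

Lemma le_norm_RintegralB f g k : P.-integrable setT (EFin \o f) ->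
  P.-integrable setT (EFin \o g) -> P.-integrable setT (EFin \o k) ->
  (forall x, `|f x - g x| <= k x) ->
  `|\int[P]_x f x - \int[P]_x g x| <= \int[P]_x k x.
Proof.
move=> fi gi ki fgk; rewrite -RintegralB//.
have fgi : P.-integrable setT (EFin \o (f \- g)).
  by have := integrableB measurableT fi gi; apply: eq_integrable.
apply: le_trans (le_normr_Rintegral _ fgi) _ => //.
apply: le_Rintegral => //; last by move=> x _; exact: fgk.
by have := integrable_abse fgi; apply: eq_integrable.
Qed.

Lemma le_norm_RintegralB_cst f g (M : R) : P.-integrable setT (EFin \o f) ->
  P.-integrable setT (EFin \o g) ->
  (forall x, `|f x - g x| <= M) ->
  `|\int[P]_x f x - \int[P]_x g x| <= M.
Proof.
move=> fi gi fgM; rewrite -[leRHS]prob_Rintegral_cst.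
apply: le_norm_RintegralB => //; apply: (@bounded_integrable _ `|M|) => //.
Qed.

Lemma le_norm_Rintegral_cst f (M : R) : P.-integrable setT (EFin \o f) ->
  (forall x, `|f x| <= M) -> `|\int[P]_x f x| <= M.
Proof.
move=> fi fM; rewrite -[X in `|X|]subr0 -[X in _ - X](prob_Rintegral_cst 0).
apply: le_norm_RintegralB_cst => //.
  by apply: (@bounded_integrable _ 0) => // x; rewrite normr0.
by move=> x; rewrite subr0.
Qed.

Lemma bounded_cvg_Rintegral (f_ : nat -> T -> R) f (M : R) :
  (forall n, measurable_fun setT (f_ n)) -> measurable_fun setT f ->
  (forall n x, `|f_ n x| <= M) ->
  {ae P, forall x, f_ n x @[n --> \oo] --> f x} ->
  (\int[P]_x f_ n x) @[n --> \oo] --> \int[P]_x f x.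
Proof.
move=> mf_ mf f_M aef.
have M0 : 0 <= M by exact: le_trans (normr_ge0 _) (f_M 0%N point).
have iM : P.-integrable setT (EFin \o cst M).
  by apply: (@bounded_integrable _ `|M|) => //; exact: measurable_cst.
have [||||fi _ cv] := @dominated_convergence _ _ _ P setT measurableT
  (fun n => EFin \o f_ n) (EFin \o f) (EFin \o cst M) _ _ _ iM.
- by move=> n; exact/measurable_EFinP.
- exact/measurable_EFinP.
- by apply: filterS aef => x fx _; apply: cvg_EFin => //; near=> n.
- by apply: aeW => x n _ /=; rewrite lee_fin.
rewrite /Rintegral; apply: fine_cvg; rewrite fineK//; exact: integrable_fin_num.
Unshelve. all: by end_near. Qed.

End probability_integral.

(** * Test functions with a third-order Taylor bound *)

Section smooth.
Context {R : realType}.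
Implicit Types (a b x y : R) (h g : R -> R).

(* The Taylor bound is all that the swapping argument uses of a test function:
   [h1] and [h2] need not be its derivatives. *)
Definition taylor3 (C : R) (h h1 h2 : R -> R) : Prop :=
  (forall x, `|h x| <= C) /\
  (forall x y, `|h (x + y) - h x - h1 x * y - h2 x / 2 * y ^+ 2| <=
               C * `|y| ^+ 3).

Section taylor3.
Context {C : R} {h h1 h2 : R -> R}.
Context (Th : taylor3 C h h1 h2).

Lemma taylor3_bound x : `|h x| <= C. Proof. exact: Th.1. Qed.

Lemma taylor3_ge0 : 0 <= C.
Proof. exact: le_trans (taylor3_bound 0). Qed.

(** Subtracting the expansions for the steps 1 and -1 cancels [h x] and [h2 x]. Adding them, as for
    [h2] below, cancels [h1 x]. *)
Lemma taylor3_bound1 x : `|h1 x| <= 2 * C.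
Proof.
have := Th.2 x 1; have := Th.2 x (-1).
have := taylor3_bound (x + 1); have := taylor3_bound (x - 1).
rewrite normrN !normr1 expr1n sqrrN expr1n !mulr1 !ler_norml; lra.
Qed.

Lemma taylor3_bound2 x : `|h2 x| <= 6 * C.
Proof.
have := Th.2 x 1; have := Th.2 x (-1).
have := taylor3_bound (x + 1); have := taylor3_bound (x - 1).
have := taylor3_bound x.
rewrite normrN !normr1 expr1n sqrrN expr1n !mulr1 !ler_norml; lra.
Qed.

(** For |y| <= 1 the [h2] term costs 3C y^2 and the cubic remainder C y^2; for |y| > 1 the values of
    [h] cost 2C and the [h1] term 2C |y|. *)
Lemma taylor3_order1 x y : `|h (x + y) - h x - h1 x * y| <= 4 * C * y ^+ 2.
Proof.
have C0 := taylor3_ge0; have ny := normr_ge0 y.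
have := Th.2 x y; have := taylor3_bound (x + y); have := taylor3_bound x.
have := taylor3_bound1 x; have := taylor3_bound2 x.
rewrite -[y ^+ 2]real_normK ?num_real//.
have hy : `|h1 x * y| = `|h1 x| * `|y| by rewrite normrM.
have [y1|y1] := lerP `|y| 1.
- move=> b2 _ _ _ t.
  have y3 : `|y| ^+ 3 <= `|y| ^+ 2 by rewrite exprS ler_piMl// exprn_ge0.
  have : `|h2 x / 2 * `|y| ^+ 2| <= 3 * C * `|y| ^+ 2.
    rewrite normrM (ger0_norm (exprn_ge0 _ _))// ler_wpM2r ?exprn_ge0//.
    rewrite normrM [`|2^-1|]ger0_norm ?invr_ge0//; lra.
  have : C * `|y| ^+ 3 <= C * `|y| ^+ 2 by rewrite ler_wpM2l.
  move: t; rewrite !ler_norml; lra.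
- move=> _ b1 b0 b0' _.
  have y2 : `|y| <= `|y| ^+ 2 by rewrite expr2 ler_peMl// ltW.
  have : `|h1 x * y| <= 2 * C * `|y| by rewrite hy ler_wpM2r.
  have : C * `|y| <= C * `|y| ^+ 2 by rewrite ler_wpM2l.
  have : C * 1 <= C * `|y| by rewrite ler_wpM2l// ltW.
  move: b0 b0'; rewrite !ler_norml; lra.
Qed.

Lemma taylor3_lip x y : `|h x - h y| <= 6 * C * `|x - y|.
Proof.
have C0 := taylor3_ge0; set z := x - y.
have -> : x = y + z by rewrite /z addrC subrK.
have ny := normr_ge0 z.
have := taylor3_order1 y z; have := taylor3_bound (y + z).
have := taylor3_bound y; have := taylor3_bound1 y.
rewrite -[z ^+ 2]real_normK ?num_real//.
have [y1|y1] := lerP `|z| 1.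
- move=> b1 _ _ t.
  have : `|h1 y * z| <= 2 * C * `|z| by rewrite normrM ler_wpM2r.
  have : C * `|z| ^+ 2 <= C * `|z| by rewrite expr2 ler_wpM2l// ler_piMl.
  move: t; rewrite !ler_norml; lra.
- move=> _ b0 b0' _.
  have : C * 1 <= C * `|z| by rewrite ler_wpM2l// ltW.
  move: b0 b0'; rewrite !ler_norml; lra.
Qed.

(** The form of the remainder that a square integrable variable can absorb: cubic for small [y],
    quadratic for large [y]. The constant 7 = 4 + 3 adds [taylor3_order1] and the [h2] term. *)
Lemma taylor3_min x y :
  `|h (x + y) - h x - h1 x * y - h2 x / 2 * y ^+ 2| <=
  7 * C * (y ^+ 2 * Num.min 1 `|y|).
Proof.
have C0 := taylor3_ge0; have := Th.2 x y; have := taylor3_order1 x y.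
have := taylor3_bound2 x.
rewrite -[y ^+ 2]real_normK ?num_real// => b2 o1 o2.
rewrite minElt; case: ltP => y1.
- have : `|h2 x / 2 * `|y| ^+ 2| <= 3 * C * `|y| ^+ 2.
    rewrite normrM (ger0_norm (exprn_ge0 _ _))// ler_wpM2r ?exprn_ge0//.
    rewrite normrM [`|2^-1|]ger0_norm ?invr_ge0//; lra.
  move: o1; rewrite !ler_norml mulr1; lra.
- rewrite -exprSr; apply: le_trans o2 _.
  by rewrite ler_wpM2r ?exprn_ge0//; lra.
Qed.

Lemma taylor3_continuous : continuous h.
Proof.
move=> x; apply/cvgrPdist_lt => e e0.
have C0 : 0 < 6 * C + 1 by have := taylor3_ge0; lra.
near=> y; apply: le_lt_trans (taylor3_lip _ _) _.
apply: (@le_lt_trans _ _ ((6 * C + 1) * `|x - y|)).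
  by rewrite ler_wpM2r//; lra.
rewrite mulrC -ltr_pdivlMr//.
near: y; apply: cvgr_dist_lt; [exact: cvg_id|exact: divr_gt0].
Unshelve. all: by end_near. Qed.

Lemma taylor3_measurable : measurable_fun setT h.
Proof. exact: continuous_measurable_fun taylor3_continuous. Qed.

End taylor3.

Lemma taylor3D C h h1 h2 C' g g1 g2 : taylor3 C h h1 h2 -> taylor3 C' g g1 g2 ->
  taylor3 (C + C') (h \+ g) (h1 \+ g1) (h2 \+ g2).
Proof.
move=> [hb ht] [gb gt]; split=> [x|x y] /=.
  by apply: le_trans (ler_normD _ _) _; rewrite lerD.
rewrite [leRHS]mulrDl; apply: le_trans _ (lerD (ht x y) (gt x y)).
apply: le_trans _ (ler_normD _ _); rewrite le_eqVlt; apply/orP; left; apply/eqP.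
by congr `|_|; field.
Qed.

Lemma taylor3_affine C h h1 h2 a b r : taylor3 C h h1 h2 ->
  taylor3 (`|r| * C * (1 + `|a| ^+ 3)) (fun x => r * h (a * x + b))
   (fun x => r * a * h1 (a * x + b)) (fun x => r * a ^+ 2 * h2 (a * x + b)).
Proof.
move=> Th; have C0 := taylor3_ge0 Th; case: Th => [hb ht].
have a0 := normr_ge0 a; have a3 : 0 <= `|a| ^+ 3 by rewrite exprn_ge0.
split=> [x|x y].
  by rewrite normrM -mulrA ler_wpM2l// (le_trans (hb _))// ler_peMr// lerDl.
set u := a * x + b.
have -> : a * (x + y) + b = u + a * y by rewrite /u; ring.
have -> : r * h (u + a * y) - r * h u - r * a * h1 u * y
   - r * a ^+ 2 * h2 u / 2 * y ^+ 2 =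
   r * (h (u + a * y) - h u - h1 u * (a * y) - h2 u / 2 * (a * y) ^+ 2) by field.
rewrite normrM -[leRHS]mulrA -[leRHS]mulrA ler_wpM2l//.
apply: le_trans (ht _ _) _.
rewrite ler_wpM2l// normrM exprMn ler_wpM2r ?exprn_ge0//; lra.
Qed.

Lemma taylor3_cst r : taylor3 `|r| (cst r) (cst 0) (cst 0).
Proof.
split=> // x y /=; rewrite !mul0r !subr0 subrr normr0.
by rewrite mulr_ge0// exprn_ge0.
Qed.

(** Measurability of [h1] and [h2] is included because both are integrated in [taylor3_average]. *)
Definition smooth3 h := exists C h1 h2,
  [/\ taylor3 C h h1 h2, measurable_fun setT h1 & measurable_fun setT h2].

Lemma smooth3_cst r : smooth3 (cst r).
Proof.
exists `|r|, (cst 0), (cst 0).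
by split; [exact: taylor3_cst|exact: measurable_cst|exact: measurable_cst].
Qed.

Lemma smooth3D h g : smooth3 h -> smooth3 g -> smooth3 (h \+ g).
Proof.
move=> [C [h1 [h2 [T m1 m2]]]] [C' [g1 [g2 [T' m1' m2']]]].
exists (C + C'), (h1 \+ g1), (h2 \+ g2).
by split; [exact: taylor3D|exact: measurable_funD|exact: measurable_funD].
Qed.

Lemma smooth3_affine h a b r : smooth3 h -> smooth3 (fun x => r * h (a * x + b)).
Proof.
move=> [C [h1 [h2 [T m1 m2]]]].
have maff : measurable_fun setT (fun x => a * x + b).
  by apply: measurable_funD => //; exact: measurable_funM.
eexists _, _, _; split; first exact: (taylor3_affine a b r T).
- by apply: measurable_funM => //; apply: measurableT_comp m1 maff.
- by apply: measurable_funM => //; apply: measurableT_comp m2 maff.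
Qed.

Lemma smooth3_continuous h : smooth3 h -> continuous h.
Proof. by move=> [C [h1 [h2 [T _ _]]]]; exact: taylor3_continuous T. Qed.

Lemma smooth3_measurable h : smooth3 h -> measurable_fun setT h.
Proof. by move=> [C [h1 [h2 [T _ _]]]]; exact: taylor3_measurable T. Qed.

(* [step3] is the primitive of the quadratic B-spline on [0, 3], hence a C^2 step
   from 0 to 1. *)
Definition pos3 x : R := Num.max x 0 ^+ 3 / 6.
Definition step3 x : R :=
  pos3 x - 3 * pos3 (x - 1) + 3 * pos3 (x - 2) - pos3 (x - 3).

Lemma pos3_ge0 x : 0 <= x -> pos3 x = x ^+ 3 / 6.
Proof. by move=> x0; rewrite /pos3 max_l. Qed.

Lemma pos3_le0 x : x <= 0 -> pos3 x = 0.
Proof. by move=> x0; rewrite /pos3 max_r// expr0n mul0r. Qed.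

Lemma step3_le0 x : x <= 0 -> step3 x = 0.
Proof. by move=> x0; rewrite /step3 !pos3_le0 ?mulr0 ?subr0 ?addr0//; lra. Qed.

Lemma step3_ge3 x : 3 <= x -> step3 x = 1.
Proof. by move=> x0; rewrite /step3 !pos3_ge0; [field|lra..]. Qed.

Lemma step3_ge0_le1 x : 0 <= step3 x <= 1.
Proof.
have [x0|x0] := lerP x 0; first by rewrite step3_le0// lexx ler01.
have [x3|x3] := lerP 3 x; first by rewrite step3_ge3// lexx ler01.
have {}x0 := ltW x0; have {}x3 := ltW x3.
rewrite /step3 [pos3 (x - 3)]pos3_le0 ?subr_le0// subr0.
rewrite [pos3 x]pos3_ge0//.
have [x1|x1] := lerP x 1.
  rewrite !pos3_le0; [|lra|lra].
  rewrite !mulr0 subr0 addr0.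
  have x13 : x ^+ 3 <= 1 by rewrite exprn_ile1.
  have x30 : 0 <= x ^+ 3 by rewrite exprn_ge0.
  lra.
have {}x1 := ltW x1; rewrite [pos3 (x - 1)]pos3_ge0 ?subr_ge0//.
have [x2|x2] := lerP x 2.
  rewrite [pos3 (x - 2)]pos3_le0 ?subr_le0// mulr0 addr0.
  pose t := x - 1; have -> : x = t + 1 by rewrite /t subrK.
  have : 0 <= t <= 1 by rewrite /t; lra.
  rewrite addrK; move: t => t /andP[t0 t1].
  have t2 : t ^+ 2 <= t by rewrite expr2 ler_piMl.
  have t3 : t ^+ 3 <= t ^+ 2 by rewrite exprS ler_piMl// exprn_ge0.
  have t30 : 0 <= t ^+ 3 by rewrite exprn_ge0.
  have -> : (t + 1) ^+ 3 / 6 - 3 * (t ^+ 3 / 6) =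
    (1 + 3 * t + 3 * t ^+ 2 - 2 * t ^+ 3) / 6 by field.
  (* The double root at 1 gives 3t - t^3 <= 2; with t^2 <= t the numerator 1 + 3t + 3t^2 - 2t^3 is
     then at most 5. *)
  have : 0 <= (t - 1) ^+ 2 * (t + 2) by rewrite mulr_ge0 ?sqr_ge0//; lra.
  have -> : (t - 1) ^+ 2 * (t + 2) = t ^+ 3 - 3 * t + 2 by ring.
  lra.
have {}x2 := ltW x2; rewrite [pos3 (x - 2)]pos3_ge0 ?subr_ge0//.
(* The step is symmetric about 3/2, so the last piece is 1 minus the first one reflected. *)
pose t := 3 - x; have -> : x = 3 - t by rewrite /t opprB addrC subrK.
have : 0 <= t <= 1 by rewrite /t; lra.
move: t => t /andP[t0 t1].
have t3 : t ^+ 3 <= 1 by rewrite exprn_ile1.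
have t30 : 0 <= t ^+ 3 by rewrite exprn_ge0.
have -> : (3 - t) ^+ 3 / 6 - 3 * ((3 - t - 1) ^+ 3 / 6) +
  3 * ((3 - t - 2) ^+ 3 / 6) = 1 - t ^+ 3 / 6 by field.
lra.
Qed.

(** Without crossing the kink the remainder is 0 or y^3 / 6. Crossing it changes this by the cube of
    the overshoot, which is at most |y|^3. *)
Lemma pos3_taylor x y :
  `|pos3 (x + y) - pos3 x - (Num.max x 0 ^+ 2 / 2) * y - Num.max x 0 / 2 * y ^+ 2|
  <= `|y| ^+ 3.
Proof.
have [x0|x0] := lerP x 0; have [xy0|xy0] := lerP (x + y) 0.
- by rewrite !pos3_le0// expr0n/= !mul0r !subr0 normr0 exprn_ge0.
- have {}xy0 := ltW xy0; rewrite [pos3 x]pos3_le0// pos3_ge0// expr0n/= !mul0r !subr0.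
  rewrite ger0_norm ?divr_ge0 ?exprn_ge0//.
  have y0 : x + y <= y by lra.
  have yy : 0 <= y by lra.
  apply: (@le_trans _ _ ((x + y) ^+ 3)).
    by rewrite ler_pdivrMr// ler_peMr ?exprn_ge0//; lra.
  by rewrite (ger0_norm yy) lerXn2r.
- have {}x0 := ltW x0; rewrite [pos3 (x + y)]pos3_le0// pos3_ge0//.
  pose u := - (x + y); have -> : y = - (u + x) by rewrite /u; ring.
  have u0 : 0 <= u by rewrite /u; lra.
  rewrite normrN [`|u + x|]ger0_norm; [|lra].
  have -> : 0 - x ^+ 3 / 6 - x ^+ 2 / 2 * - (u + x) - x / 2 * (- (u + x)) ^+ 2 =
    - ((u + x) ^+ 3 - u ^+ 3) / 6 by field.
  have h : u ^+ 3 <= (u + x) ^+ 3 by rewrite lerXn2r ?nnegrE//; lra.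
  have h' : 0 <= u ^+ 3 by rewrite exprn_ge0.
  rewrite ler_norml; lra.
- have {}x0 := ltW x0; have {}xy0 := ltW xy0; rewrite !pos3_ge0//.
  have -> : (x + y) ^+ 3 / 6 - x ^+ 3 / 6 - x ^+ 2 / 2 * y - x / 2 * y ^+ 2 =
    y ^+ 3 / 6 by field.
  by rewrite normrM normrX [`|6^-1|]ger0_norm// ler_piMr ?exprn_ge0//; lra.
Qed.

Lemma smooth3_step3 : smooth3 step3.
Proof.
pose p1 x : R := Num.max x 0 ^+ 2 / 2; pose p2 x : R := Num.max x 0.
(* 8 = 1 + 3 + 3 + 1 sums the absolute values of the coefficients of [step3]. *)
exists 8, (fun x => p1 x - 3 * p1 (x - 1) + 3 * p1 (x - 2) - p1 (x - 3)),
  (fun x => p2 x - 3 * p2 (x - 1) + 3 * p2 (x - 2) - p2 (x - 3)).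
have m2 : measurable_fun setT p2.
  by apply: measurable_maxr => //; exact: measurable_cst.
have m1 : measurable_fun setT p1.
  apply: measurable_funM; last exact: measurable_cst.
  exact: measurable_funX.
have ms (q : R -> R) : measurable_fun setT q ->
    measurable_fun setT (fun x => q x - 3 * q (x - 1) + 3 * q (x - 2) - q (x - 3)).
  move=> mq; have mqs b : measurable_fun setT (fun x => q (x - b)).
    by apply: measurableT_comp mq _; exact: measurable_funB.
  apply: measurable_funB => //; apply: measurable_funD.
    by apply: measurable_funB => //; exact: measurable_funM.
  exact: measurable_funM.
split; [split=> [x|x y]|exact: ms|exact: ms].
  by have := step3_ge0_le1 x; rewrite ler_norml; lra.
rewrite /step3.
rewrite ![x + y - _]addrAC.
have t0 := pos3_taylor x y; have t1 := pos3_taylor (x - 1) y.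
have t2 := pos3_taylor (x - 2) y; have t3 := pos3_taylor (x - 3) y.
move: t0 t1 t2 t3; rewrite /p1 /p2 !ler_norml; lra.
Qed.

(** A smooth substitute for linear interpolation: on each mesh interval a rescaled [step3] leads
    from one nodal value of [f] to the next. The argument is kept in the form a x + b required by
    [smooth3_affine]. *)
Fixpoint spline (f : R -> R) (x0 eta : R) (n : nat) (x : R) : R :=
  if n is n'.+1 then
    spline f x0 eta n' x +
    (f (x0 + n%:R * eta) - f (x0 + n'%:R * eta)) *
    step3 (3 / eta * x + (- (3 / eta * (x0 + n'%:R * eta))))
  else f x0.

Lemma smooth3_spline f x0 eta n : smooth3 (spline f x0 eta n).
Proof.
elim: n => [|n IHn]; first exact: smooth3_cst.
by apply: smooth3D IHn _; exact: smooth3_affine smooth3_step3.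
Qed.

(** Between two nodes the spline is a convex combination of the nodal values, so the oscillation of
    [f] over one mesh width bounds the error. The constancy beyond the last node is what carries the
    induction. *)
Lemma spline_approx f (x0 eta : R) n (M e : R) : 0 < eta -> 0 <= e ->
  (forall x, `|f x| <= M) ->
  (forall x y, x0 <= x <= x0 + n%:R * eta -> `|x - y| <= eta ->
               `|f x - f y| <= e) ->
  [/\ forall x, `|spline f x0 eta n x| <= M,
      forall x, x0 + n%:R * eta <= x ->
        spline f x0 eta n x = f (x0 + n%:R * eta) &
      forall x, x0 <= x <= x0 + n%:R * eta -> `|spline f x0 eta n x - f x| <= e].
Proof.
move=> eta0 e0 fM; elim: n => [_|n IHn unif].
  rewrite mul0r addr0; split=> [x|x|x /andP[a b]] //=.
  have -> : x = x0 by apply/eqP; rewrite eq_le a b.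
  by rewrite subrr normr0.
set x1 := x0 + n%:R * eta; set x2 := x0 + n.+1%:R * eta.
have x12 : x2 = x1 + eta by rewrite /x2 /x1 -natr1; ring.
have x01 : x0 <= x1 by rewrite lerDl mulr_ge0// ltW.
have {IHn} [|IM IE IA] := IHn.
  move=> x y xx; apply: unif; rewrite -/x2 x12; move: xx; rewrite -/x1; lra.
have sE x : spline f x0 eta n.+1 x = spline f x0 eta n x +
    (f x2 - f x1) * step3 (3 / eta * x + (- (3 / eta * x1))) by [].
have argE x : 3 / eta * x + (- (3 / eta * x1)) = 3 * ((x - x1) / eta) by field; rewrite gt_eqF.
have sle x : x <= x1 -> spline f x0 eta n.+1 x = spline f x0 eta n x.
  move=> xx; rewrite sE argE step3_le0 ?mulr0 ?addr0//.
  by rewrite pmulr_rle0// pmulr_lle0 ?invr_gt0// subr_le0.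
have sge x : x1 <= x -> exists2 s, 0 <= s <= 1 &
    spline f x0 eta n.+1 x = (1 - s) * f x1 + s * f x2.
  move=> xx; rewrite sE IE//; exists (step3 (3 / eta * x + (- (3 / eta * x1)))).
    exact: step3_ge0_le1.
  by rewrite -/x1; ring.
split=> [x|x xx|x /andP[xa xb]].
- have [xx|xx] := lerP x x1; first by rewrite sle.
  have [s /andP[s0 s1] ->] := sge x (ltW xx).
  apply: le_trans (ler_normD _ _) _.
  rewrite !normrM [`|1 - s|]ger0_norm ?subr_ge0// [`|s|]ger0_norm//.
  have -> : M = (1 - s) * M + s * M by ring.
  by rewrite lerD// ler_wpM2l// subr_ge0.
- rewrite sE argE step3_ge3 ?IE//; first by rewrite -/x1; ring.
    by rewrite -/x1; move: xx; rewrite x12; lra.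
  by rewrite ler_peMr// ler_pdivlMr// mul1r; move: xx; rewrite x12; lra.
- have [xx|xx] := lerP x x1; first by rewrite sle// IA// xa.
  have [s /andP[s0 s1] ->] := sge x (ltW xx).
  have -> : (1 - s) * f x1 + s * f x2 - f x =
    (1 - s) * (f x1 - f x) + s * (f x2 - f x) by ring.
  apply: le_trans (ler_normD _ _) _.
  rewrite !normrM [`|1 - s|]ger0_norm ?subr_ge0// [`|s|]ger0_norm//.
  have -> : e = (1 - s) * e + s * e by ring.
  rewrite lerD// ler_wpM2l// ?subr_ge0//; apply: unif.
  + rewrite -/x2; move: xb; rewrite -/x2 x12; lra.
  + by move: xb; rewrite -/x2 x12 ler_norml; lra.
  + by rewrite -/x2 lexx andbT x12; lra.
  + by move: xb; rewrite -/x2 x12 ler_norml; lra.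
Qed.

(** Compactness in its near-covering form: around each point half the continuity radius serves for
    the moving centre and half for the distance to [y], which may leave the segment. *)
Lemma uniform_continuity_segment (f : R -> R) (a b e : R) : continuous f -> 0 < e ->
  exists2 eta : R, 0 < eta &
    forall x y : R, a <= x <= b -> `|x - y| <= eta -> `|f x - f y| <= e.
Proof.
move=> cf e0.
have /compact_near_coveringP cab := @segment_compact R a b.
have := cab _ (0^'+ : set_system R)
  (fun d x => forall y, `|x - y| <= d -> `|f x - f y| <= e) _.
case.
  move=> x _.
  have /cvgrPdist_le/(_ (e / 2)) cx := cf x.
  have := cx (divr_gt0 e0 (ltr0n _ 2)).
  case/nbhs_ballP => r /= r0 rb.
  exists (ball x (r / 2), [set d | 0 < d < r / 2]) => /=.
    split; first by apply: nbhsx_ballx; rewrite divr_gt0.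
    near=> d; apply/andP; split; near: d; first exact: nbhs_right_gt.
    by apply: nbhs_right_lt; rewrite divr_gt0.
  move=> [x' d] /= [bx /andP[d0 dr]] y xy.
  have h1 : `|f x - f x'| <= e / 2.
    by apply: rb; apply: le_ball bx; rewrite ler_pdivrMr// ler_peMr ?ltW//; lra.
  have h2 : `|f x - f y| <= e / 2.
    apply: rb; rewrite /ball /= in bx *.
    have := ler_normD (x - x') (x' - y); rewrite addrA subrK.
    move: bx; rewrite /ball_ /=; lra.
  have := ler_normD (f x' - f x) (f x - f y).
  rewrite addrA subrK [`|f x' - f x|]distrC; lra.
move=> d d0 Hd; exists (d / 2); first by rewrite divr_gt0.
move=> x y xab; apply: Hd => /=.
- by rewrite sub0r normrN gtr0_norm ?divr_gt0// ltr_pdivrMr// ltr_pMr// ltr1n.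
- by rewrite divr_gt0.
- by rewrite in_itv.
Unshelve. all: by end_near. Qed.

End smooth.

(** No tightness is assumed: a smooth function vanishing on a large interval is itself a test
    function, so the tails of [X i] are controlled by that of [Y]. On the interval a spline replaces
    [f]. *)
Lemma cvg_in_distribution_smooth3 (R : realType) d d' (T : measurableType d)
    (T' : measurableType d') (P : probability T R) (P' : probability T' R)
    (I : Type) (F : set_system I) (FF : Filter F) (X : I -> T -> R) (Y : T' -> R) :
  (forall i, measurable_fun setT (X i)) -> measurable_fun setT Y ->
  (forall h, smooth3 h ->
    (\int[P]_w h (X i w)) @[i --> F] --> \int[P']_w h (Y w)) ->
  cvg_in_distribution P P' X F Y.
Proof.
move=> mX mY XY f cf [M fM].
have M0 : 0 <= M by exact: le_trans (normr_ge0 _) (fM 0).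
have mf : measurable_fun setT f by exact: continuous_measurable_fun.
(* A smooth tail indicator: 0 for |x| <= B and at least 1 for |x| >= B + 3. *)
pose cut (B x : R) := 1 + (-1) * step3 (1 * x + (B + 3)) + 1 * step3 (1 * x + (- B)).
have scut B : smooth3 (cut B).
  apply: smooth3D; first (apply: smooth3D; first exact: smooth3_cst);
    exact: smooth3_affine smooth3_step3.
have cut0 B x : `|x| <= B -> cut B x = 0.
  move=> /[!ler_norml] xB; rewrite /cut step3_ge3; last lra.
  rewrite step3_le0; lra.
have cut_ge0 B x : 0 <= cut B x.
  have := step3_ge0_le1 (1 * x + (B + 3)); have := step3_ge0_le1 (1 * x + (- B)).
  by rewrite /cut; lra.
have cut_le2 B x : `|cut B x| <= 2.
  have := step3_ge0_le1 (1 * x + (B + 3)); have := step3_ge0_le1 (1 * x + (- B)).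
  by rewrite /cut ler_norml; lra.
have cut_ge1 B x : 0 <= B -> B + 3 <= `|x| -> 1 <= cut B x.
  have := step3_ge0_le1 (1 * x + (B + 3)); have := step3_ge0_le1 (1 * x + (- B)).
  move => s1 s2 B0; rewrite /cut.
  have [x0|x0] := lerP 0 x.
    by rewrite ger0_norm// => Bx; rewrite [step3 (1 * x + - B)]step3_ge3; lra.
  by rewrite ltr0_norm// => Bx; rewrite [step3 (1 * x + (B + 3))]step3_le0; lra.
have intX (h : R -> R) (K : R) i : measurable_fun setT h -> (forall x, `|h x| <= K) ->
    P.-integrable setT (EFin \o (h \o X i)).
  move=> mh hK; apply: (@bounded_integrable _ _ _ _ _ K) => [|x]; last exact: hK.
  exact: measurableT_comp.
have intY (h : R -> R) (K : R) : measurable_fun setT h -> (forall x, `|h x| <= K) ->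
    P'.-integrable setT (EFin \o (h \o Y)).
  move=> mh hK; apply: (@bounded_integrable _ _ _ _ _ K) => [|x]; last exact: hK.
  exact: measurableT_comp.
have mcut B : measurable_fun setT (cut B) by exact: smooth3_measurable.
have cutY : (\int[P']_w cut n%:R (Y w)) @[n --> \oo] --> (0 : R).
  rewrite -[X in _ --> X](prob_Rintegral_cst P' 0).
  apply: (@bounded_cvg_Rintegral _ _ _ _ _ _ 2) => [n|||].
  - exact: measurableT_comp.
  - exact: measurable_cst.
  - by move=> n x; exact: cut_le2.
  - apply: aeW => w; apply: cvg_near_cst; near=> n; apply: cut0.
    by near: n; exact: nbhs_infty_ger.
have -> : ('E_P'[f \o Y])%E = (\int[P']_w f (Y w))%:E.
  by rewrite expectation_Rintegral//; exact: intY fM.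
under eq_fun do rewrite (expectation_Rintegral (intX f M _ mf fM)).
apply: cvg_EFin; first exact: nearW.
apply/cvgrPdist_le => e e0 /=.
(* The tail of [X i] is allowed 2e' and that of [Y] e', each weighted by 2M, which makes 6M e'. The
   approximation on either side and the convergence for [s] cost e' each. *)
pose e' := e / (6 * M + 4); have M' : 0 < 6 * M + 4 by lra.
have e'0 : 0 < e' by rewrite divr_gt0.
have [n nB] : exists n : nat, \int[P']_w cut n%:R (Y w) <= e'.
  have /cvgrPdist_le/(_ _ e'0)[n _ /(_ n (leqnn n))] := cutY.
  by rewrite sub0r normrN => /(le_trans (ler_norm _)); exists n.
set B : R := n%:R in nB; have B0 : 0 <= B by [].
have [eta eta0 feta] := uniform_continuity_segment (- (B + 3)) (B + 3) cf e'0.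
pose L := 2 * (B + 3); have L0 : 0 < L by rewrite /L; lra.
pose m := (Num.truncn (L / eta)).+1; pose eta' := L / m%:R.
have m0 : 0 < m%:R :> R by rewrite ltr0n.
have eta'0 : 0 < eta' by rewrite divr_gt0.
have meta : m%:R * eta' = L by rewrite /eta' mulrC divfK// gt_eqF.
have eta'le : eta' <= eta.
  by rewrite ler_pdivrMr// mulrC -ler_pdivrMr// ltW// truncnS_gt.
have BL : - (B + 3) + L = B + 3 by rewrite /L; ring.
have [|sM _ sf] := @spline_approx _ f (- (B + 3)) eta' m M e' eta'0 (ltW e'0) fM.
  move=> x y; rewrite meta BL => xB xy; apply: feta => //.
  exact: le_trans xy eta'le.
set s := spline f (- (B + 3)) eta' m in sM sf.
have ss : smooth3 s by exact: smooth3_spline.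
have ms : measurable_fun setT s by exact: smooth3_measurable.
have fs x : `|f x - s x| <= e' + 2 * M * cut B x.
  have [xB|xB] := lerP `|x| (B + 3).
    rewrite distrC; apply: le_trans (sf _ _) _.
      by rewrite meta BL -ler_norml.
    by rewrite lerDl mulr_ge0// mulr_ge0.
  have c1 := cut_ge1 _ _ B0 (ltW xB).
  apply: le_trans (ler_normB _ _) _; have := fM x; have := sM x.
  have : M * 1 <= M * cut B x by rewrite ler_wpM2l.
  lra.
pose k x := e' + 2 * M * cut B x.
have mk : measurable_fun setT k.
  apply: measurable_funD; first exact: measurable_cst.
  by apply: measurable_funM => //; exact: measurable_cst.
have kb x : `|k x| <= e' + 2 * M * 2.
  apply: le_trans (ler_normD _ _) _; rewrite gtr0_norm// lerD2l.
  rewrite normrM ger0_norm ?mulr_ge0// ler_wpM2l// mulr_ge0//.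
have kint d0 (T0 : measurableType d0) (P0 : probability T0 R) (V : T0 -> R) :
    measurable_fun setT V ->
    \int[P0]_w k (V w) = e' + 2 * M * \int[P0]_w cut B (V w).
  move=> mV; have ci : P0.-integrable setT (EFin \o (cut B \o V)).
    apply: (@bounded_integrable _ _ _ _ _ 2) => [|x]; last exact: cut_le2.
    exact: measurableT_comp.
  rewrite RintegralD//; last 2 first.
    apply: (@bounded_integrable _ _ _ _ _ `|e'|) => //; exact: measurable_cst.
    by have := integrableZl measurableT (2 * M) ci; apply: eq_integrable.
  by rewrite prob_Rintegral_cst RintegralZl.
have fsY : `|\int[P']_w f (Y w) - \int[P']_w s (Y w)| <= e' + 2 * M * e'.
  apply: le_trans (le_norm_RintegralB (intY _ _ mf fM) (intY _ _ ms sM)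
    (intY _ _ mk kb) (fun w => fs (Y w))) _.
  by rewrite kint// lerD2l ler_wpM2l// mulr_ge0.
have /cvgrPdist_le/(_ _ e'0) cvs := XY _ ss.
have /cvgrPdist_le/(_ _ e'0) cvc := XY _ (scut B).
apply: filterS2 cvs cvc => i si ci.
have fsX : `|\int[P]_w f (X i w) - \int[P]_w s (X i w)| <= e' + 2 * M * (2 * e').
  apply: le_trans (le_norm_RintegralB (intX _ _ i mf fM) (intX _ _ i ms sM)
    (intX _ _ i mk kb) (fun w => fs (X i w))) _.
  rewrite kint// lerD2l ler_wpM2l ?mulr_ge0//.
  by move: ci; rewrite ler_norml; lra.
have -> : e = (6 * M + 4) * e' by rewrite /e' mulrC divfK// gt_eqF.
have Me : 0 <= M * e' by rewrite mulr_ge0// ltW.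
move: fsX fsY si; rewrite !ler_norml.
have -> : 2 * M * (2 * e') = 4 * (M * e') by ring.
have -> : 2 * M * e' = 2 * (M * e') by ring.
have -> : (6 * M + 4) * e' = 6 * (M * e') + 4 * e' by ring.
lra.
Unshelve. all: by end_near. Qed.

(** * Integration against a measure with a density *)

Section density.
Local Open Scope ereal_scope.
Context d (T : measurableType d) (R : realType).
Context (mu nu : {measure set T -> \bar R}) (p : T -> R).
Context (p0 : forall x, (0 <= p x)%R) (mp : measurable_fun setT p).
Context (nuE : forall A, measurable A -> nu A = \int[mu]_(x in A) (p x)%:E).

Import HBNNSimple.

Let integral_density_nnsfun (g : {nnsfun T >-> R}) :
  \int[nu]_x (g x)%:E = \int[mu]_x ((g x)%:E * (p x)%:E).
Proof.
transitivity (\int[mu]_x (\sum_(r \in range g) (r%:E *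
    (\1_(g @^-1` [set r]) x * p x)%:E))); last first.
  apply: eq_integral => x _.
  rewrite [in RHS](fimfunE g) -fsumEFin// ge0_mule_fsuml.
    by apply: eq_fsbigr => r _; rewrite !EFinM muleA.
  by move=> r; exact: nnfun_muleindic_ge0.
transitivity (\int[nu]_x (\sum_(r \in range g) (r * \1_(g @^-1` [set r]) x)%:E)).
  by apply: eq_integral => x _; rewrite [in LHS](fimfunE g) fsumEFin.
rewrite !ge0_integral_fsum//; last 4 first.
- move=> r; apply: emeasurable_funM; first exact: measurable_cst.
  by apply/measurable_EFinP/measurable_funM => //; exact: measurable_indic.
- move=> r x _; rewrite EFinM muleA mule_ge0// ?lee_fin//.
  exact: nnfun_muleindic_ge0.
- move=> r; apply/measurable_EFinP/measurable_funM => //; exact: measurable_indic.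
- by move=> r x _; exact: nnfun_muleindic_ge0.
apply: eq_fsbigr => r; rewrite inE => -[x _ gx].
have r0 : (0 <= r)%R by rewrite -gx.
have mg : measurable (g @^-1` [set r]) by exact: measurable_sfunP.
under eq_integral do rewrite EFinM.
rewrite ge0_integralZl//; last first.
  by apply/measurable_EFinP; exact: measurable_indic.
rewrite integral_indic// setIT nuE//.
rewrite ge0_integralZl//; last 2 first.
- by apply/measurable_EFinP/measurable_funM => //; exact: measurable_indic.
- by move=> y _; rewrite lee_fin mulr_ge0.
congr (_ * _); rewrite integral_mkcond; apply: eq_integral => y _.
by rewrite /patch indicE; case: ifP; rewrite ?mul1r ?mul0r.
Qed.

Lemma ge0_integral_density (f : T -> \bar R) : measurable_fun setT f ->
  (forall x, 0 <= f x) -> \int[nu]_x f x = \int[mu]_x (f x * (p x)%:E).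
Proof.
move=> mf f0; pose h := nnsfun_approx measurableT mf.
have hf x : (EFin \o h n) x @[n --> \oo] --> f x.
  by apply: cvg_nnsfun_approx => //.
have -> : \int[nu]_x f x = limn (fun n => \int[nu]_x (h n x)%:E).
  rewrite -monotone_convergence//.
  - by apply: eq_integral => x _; apply/esym/cvg_lim => //; exact: hf.
  - by move=> n; exact/measurable_EFinP.
  - by move=> n x _; rewrite lee_fin.
  - by move=> x _ a b ab; rewrite lee_fin; exact/lefP/nd_nnsfun_approx.
have -> : \int[mu]_x (f x * (p x)%:E) =
    limn (fun n => \int[mu]_x ((h n x)%:E * (p x)%:E)).
  rewrite -monotone_convergence//.
  - apply: eq_integral => x _; apply/esym/cvg_lim => //.
    by apply: cvgeZr => //; exact: hf.
  - by move=> n; apply: emeasurable_funM; exact/measurable_EFinP.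
  - by move=> n x _; rewrite mule_ge0 ?lee_fin.
  - move=> x _ a b ab; rewrite lee_wpmul2r ?lee_fin//.
    exact/lefP/nd_nnsfun_approx.
by under eq_fun do rewrite integral_density_nnsfun.
Qed.

End density.

(** Adding [M] makes the integrand nonnegative, so the measurability part of Tonelli's theorem
    applies. *)
Lemma measurable_fun_Rintegral_prod (R : realType) d d' (T : measurableType d)
    (U : measurableType d') (P : probability T R) (f : U * T -> R) (M : R) :
  measurable_fun setT f -> (forall p, `|f p| <= M) ->
  measurable_fun setT (fun u => \int[P]_t f (u, t)).
Proof.
move=> mf fM; have M0 : 0 <= M by exact: le_trans (normr_ge0 _) (fM point).
have g0 p : (0 <= (f p + M)%:E)%E.
  by rewrite lee_fin; have := fM p; rewrite ler_norml; lra.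
have mg : measurable_fun setT (fun p => (f p + M)%:E).
  by apply/measurable_EFinP; exact: measurable_funD.
have mfu u : measurable_fun setT (fun t => f (u, t)) by exact: measurableT_comp.
have -> : (fun u => \int[P]_t f (u, t)) =
    (fun u => fine (\int[P]_t (f (u, t) + M)%:E)%E - M).
  apply/funext => u; have -> : fine (\int[P]_t (f (u, t) + M)%:E)%E =
      \int[P]_t (f (u, t) + M) by [].
  rewrite RintegralD//; first by rewrite prob_Rintegral_cst addrK.
    exact: (@bounded_integrable _ _ _ _ _ M).
  exact: (@bounded_integrable _ _ _ _ _ `|M|).
apply: measurable_funB => //.
have := @measurable_fun_fubini_tonelli_F _ _ _ _ _ P _ mg g0.
by move=> mF; apply: measurableT_comp mF.
Qed.

(** * The standard normal law: moments and stability *)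

Section gaussian.
Context {R : realType}.
Local Notation mu := (@lebesgue_measure R).
Local Notation gauss := (normal_prob (0 : R) 1).
Local Notation phi := (normal_pdf (0 : R) 1).

Lemma normal_pdf01E (x : R) : phi x = normal_peak 1 * expR (- x ^+ 2 / 2).
Proof. by rewrite normal_pdfE ?oner_neq0// /normal_fun subr0 expr1n. Qed.

Lemma ge0_integral_gauss (f : R -> \bar R) : measurable_fun setT f ->
  (forall x, 0 <= f x)%E ->
  (\int[gauss]_x f x = \int[mu]_x (f x * (phi x)%:E))%E.
Proof.
by move=> mf f0; apply: ge0_integral_density => //;
  [exact: normal_pdf_ge0|exact: measurable_normal_pdf].
Qed.

(** The normal density of standard deviation 2 exceeds [phi] by a factor of order exp(3 x^2 / 8),
    which absorbs 1 + x^4. *)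
Lemma gauss_integrable_powD (n : nat) : (n <= 4)%N ->
  gauss.-integrable setT (EFin \o (fun x => x ^+ n)).
Proof.
move=> n4; apply/integrableP; split.
  by apply/measurable_EFinP; exact: measurable_funX.
rewrite ge0_integral_gauss//; last first.
  by apply: measurableT_comp => //; apply/measurable_EFinP; exact: measurable_funX.
(* 257 is generous: exp(y) >= 1 + y^2 / 2 at y = 3 x^2 / 8 asks for 128 / 9 only. *)
pose K : R := 257 * (normal_peak 1 / normal_peak 2).
have pk1 : 0 < normal_peak 1 :> R by rewrite normal_peak_gt0// oner_neq0.
have pk2 : 0 < normal_peak 2 :> R by rewrite normal_peak_gt0.
have K0 : 0 <= K by apply: mulr_ge0; [exact: ler0n|apply: divr_ge0; exact: ltW].
apply: (@le_lt_trans _ _ (\int[mu]_x (K%:E * (normal_pdf 0 2 x)%:E))%E).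
  apply: ge0_le_integral => //.
  - by move=> x _; rewrite mule_ge0// lee_fin normal_pdf_ge0.
  - apply: emeasurable_funM; last by apply/measurable_EFinP; exact: measurable_normal_pdf.
    by apply: measurableT_comp => //; apply/measurable_EFinP; exact: measurable_funX.
  - by apply: emeasurable_funM => //; apply/measurable_EFinP; exact: measurable_normal_pdf.
  move=> x _; rewrite abse_EFin -!EFinM lee_fin normal_pdf01E normal_pdfE//.
  have -> : K * (normal_peak 2 * normal_fun 0 2 x) =
      normal_peak 1 * (257 * normal_fun 0 2 x).
    by rewrite /K; field; rewrite gt_eqF.
  rewrite mulrCA ler_wpM2l ?(ltW pk1)//.
  rewrite /normal_fun subr0.
  have -> : - x ^+ 2 / 2 = - x ^+ 2 / (2 ^+ 2 *+ 2) - 3 / 8 * x ^+ 2.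
    by rewrite -mulr_natr; field.
  rewrite expRD mulrCA mulrC ler_wpM2r ?expR_ge0//.
  have x2 : 0 <= x ^+ 2 by rewrite sqr_ge0.
  rewrite expRN ler_pdivrMr ?expR_gt0//.
  have x20 : 0 <= 3 / 8 * x ^+ 2 by apply: mulr_ge0; [exact: divr_ge0|].
  have := expR_ge1Dxn 1 x20.
  have -> : (2`!)%:R = 2 :> R by [].
  have xn : `|x ^+ n| <= 1 + x ^+ 2 ^+ 2.
    rewrite normrX -exprM -[x ^+ (2 * 2)]ger0_norm ?exprn_even_ge0// normrX.
    have [x1|x1] := lerP `|x| 1.
      apply: (@le_trans _ _ 1); first by rewrite exprn_ile1.
      by rewrite lerDl exprn_ge0.
    apply: (@le_trans _ _ (`|x| ^+ 4)); first by rewrite ler_weXn2l// ltW.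
    by rewrite lerDr.
  nra.
rewrite integralZl//; last exact: integrable_normal_pdf.
by rewrite integral_normal_pdf mule1 ltry.
Qed.

Lemma normal_peakE (s : R) : 0 < s -> normal_peak s = normal_peak 1 / s.
Proof.
move=> s0; rewrite /normal_peak expr1n mul1r -mulrnAr sqrtrM ?sqr_ge0//.
by rewrite sqrtr_sqr gtr0_norm// invfM mulrC.
Qed.

(** [r] is the likelihood ratio of another normal law to the standard one. Its mean 1, compared with
    exp(y) >= 1 + y, yields the first two moments without integration by parts. *)
Lemma Rintegral_gauss_ratio (r : R -> R) (m s : R) : measurable_fun setT r ->
  (forall x, 0 <= r x) -> (forall x, r x * phi x = normal_pdf m s x) ->
  gauss.-integrable setT (EFin \o r) /\ \int[gauss]_x r x = 1.
Proof.
move=> mr r0 rE.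
have I1 : (\int[gauss]_x (r x)%:E = 1)%E.
  rewrite ge0_integral_gauss//; last by apply/measurable_EFinP.
  by under eq_integral do rewrite -EFinM rE; rewrite integral_normal_pdf.
split; last by rewrite /Rintegral I1.
apply/integrableP; split; first exact/measurable_EFinP.
under eq_integral do rewrite /= ger0_norm//.
by rewrite I1 ltry.
Qed.

(** Shifting by [m] gives m E[x] <= m^2 / 2; dividing by m = e and by m = -e squeezes the mean to
    0. *)
Lemma gauss_mean : \int[gauss]_x x = 0.
Proof.
have i1 : gauss.-integrable setT (EFin \o (fun x : R => x)).
  by have := @gauss_integrable_powD 1 isT; apply: eq_integrable.
have key (m : R) : m * \int[gauss]_x x <= m ^+ 2 / 2.
  pose r x := expR (m * x - m ^+ 2 / 2).
  have [||x|ri r1] := @Rintegral_gauss_ratio r m 1.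
  - by apply: measurableT_comp => //; exact: measurable_funB.
  - by move=> x; exact: expR_ge0.
  - rewrite normal_pdf01E normal_pdfE ?oner_neq0// /r /normal_fun expr1n.
    by rewrite mulrCA -expRD; congr (_ * expR _); rewrite -mulr_natr; field.
  have li : gauss.-integrable setT (EFin \o (fun x => m * x)).
    by have := integrableZl measurableT m i1; apply: eq_integrable.
  have ci : gauss.-integrable setT (EFin \o cst (1 - m ^+ 2 / 2)).
    by apply: (@bounded_integrable _ _ _ _ _ `|1 - m ^+ 2 / 2|).
  have : \int[gauss]_x (m * x + (1 - m ^+ 2 / 2)) <= \int[gauss]_x r x.
    apply: le_Rintegral => //.
      by have := integrableD measurableT li ci; apply: eq_integrable.
    by move=> x _; apply: le_trans (expR_ge1Dx _); lra.
  rewrite RintegralD// prob_Rintegral_cst RintegralZl// r1; lra.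
apply/eqP; rewrite eq_le; apply/andP; split; apply/ler_addgt0Pr => e e0.
- have := key e; rewrite expr2 -mulrA ler_pM2l//; lra.
- have := key (- e); rewrite sqrrN expr2 mulNr -mulrN -mulrA ler_pM2l//; lra.
Qed.

(** Rescaling by [s] gives v (s^2 - 1) <= 2 s^2 (s - 1). Dividing by s - 1 on either side of s = 1
    bounds [v] from above and below. *)
Lemma gauss_var : \int[gauss]_x (x ^+ 2) = 1.
Proof.
have i2 := @gauss_integrable_powD 2 isT.
set v := \int[gauss]_x (x ^+ 2).
have v0 : 0 <= v by apply: Rintegral_ge0 => x _; rewrite sqr_ge0.
have key (s : R) : 0 < s -> v * (s ^+ 2 - 1) <= 2 * s ^+ 2 * (s - 1).
  move=> s0; pose q := (1 - s ^- 2) / 2; pose r x := s^-1 * expR (q * x ^+ 2).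
  have [||x|ri r1] := @Rintegral_gauss_ratio r 0 s.
  - apply: measurable_funM => //; apply: measurableT_comp => //.
    by apply: measurable_funM => //; exact: measurable_funX.
  - by move=> x; rewrite mulr_ge0 ?expR_ge0// invr_ge0 ltW.
  - rewrite normal_pdf01E normal_pdfE ?gt_eqF// (normal_peakE s0) /r /normal_fun subr0.
    rewrite mulrCA -!mulrA; congr (_ * (_ * _)).
    rewrite -expRD; congr expR.
    by rewrite /q -mulr_natr; field; rewrite gt_eqF.
  have li : gauss.-integrable setT (EFin \o (fun x => s^-1 * q * x ^+ 2)).
    by have := integrableZl measurableT (s^-1 * q) i2; apply: eq_integrable.
  have ci : gauss.-integrable setT (EFin \o cst s^-1).
    by apply: (@bounded_integrable _ _ _ _ _ `|s^-1|).
  have : \int[gauss]_x (s^-1 * q * x ^+ 2 + s^-1) <= \int[gauss]_x r x.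
    apply: le_Rintegral => //.
      by have := integrableD measurableT li ci; apply: eq_integrable.
    move=> x _; rewrite -mulrA -{2}[s^-1]mulr1 -mulrDr ler_wpM2l ?invr_ge0 ?(ltW s0)//.
    by rewrite addrC expR_ge1Dx.
  rewrite RintegralD// prob_Rintegral_cst RintegralZl// r1 -/v => h.
  have s3 : 0 < 2 * s ^+ 3 by rewrite mulr_gt0// exprn_gt0.
  have := ler_wpM2l (ltW s3) h.
  have -> : 2 * s ^+ 3 * (s^-1 * q * v + s^-1) = v * (s ^+ 2 - 1) + 2 * s ^+ 2.
    by rewrite /q; field; rewrite gt_eqF.
  have -> : 2 * s ^+ 2 * (s - 1) = 2 * s ^+ 3 - 2 * s ^+ 2 by ring.
  lra.
apply/eqP; rewrite eq_le; apply/andP; split; apply/ler_addgt0Pr => e e0.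
(* With f^2 <= f, the bound 2v <= 2 (1 + f)^2 gives v <= 1 + 3f. *)
- pose f := Num.min (e / 3) 1; have f0 : 0 < f by rewrite lt_min divr_gt0/=.
  have [fe f1] : f <= e / 3 /\ f <= 1 by rewrite /f !ge_min !lexx !orbT.
  have /key : 0 < 1 + f by lra.
  have -> : v * ((1 + f) ^+ 2 - 1) = f * (v * (2 + f)) by ring.
  have -> : 2 * (1 + f) ^+ 2 * (1 + f - 1) = f * (2 * (1 + f) ^+ 2) by ring.
  rewrite ler_pM2l// => h; have : f ^+ 2 <= f by rewrite expr2 ler_piMl// ltW.
  nra.
- pose f := Num.min (e / 3) (1 / 2); have f0 : 0 < f by rewrite lt_min divr_gt0/=.
  have [fe f1] : f <= e / 3 /\ f <= 1 / 2 by rewrite /f !ge_min !lexx !orbT.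
  have /key : 0 < 1 - f by lra.
  have -> : v * ((1 - f) ^+ 2 - 1) = - f * (v * (2 - f)) by ring.
  have -> : 2 * (1 - f) ^+ 2 * (1 - f - 1) = - f * (2 * (1 - f) ^+ 2) by ring.
  rewrite !mulNr lerN2 ler_pM2l// => h; have := sqr_ge0 f.
  nra.
Qed.

(* Substituting [a t + b z = r t'], with [r ^+ 2 = a ^+ 2 + b ^+ 2], and completing
   the square in [z] leaves a Gaussian density in [z], which integrates to 1. *)
Lemma ge0_gauss_stable (h : R -> R) (x a b : R) : continuous h ->
  (forall y, 0 <= h y) -> 0 < a -> 0 < b ->
  (\int[gauss]_z \int[gauss]_t (h (x + a * t + b * z)%R)%:E =
   \int[gauss]_t (h (x + Num.sqrt (a ^+ 2 + b ^+ 2) * t)%R)%:E)%E.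
Proof.
move=> ch h0 a0 b0; have mh : measurable_fun setT h by exact: continuous_measurable_fun.
set r := Num.sqrt _.
have r0 : 0 < r by rewrite sqrtr_gt0 addr_gt0// exprn_gt0.
have r2 : r ^+ 2 = a ^+ 2 + b ^+ 2 by rewrite sqr_sqrtr// addr_ge0// sqr_ge0.
have mphi : measurable_fun setT phi by exact: measurable_normal_pdf.
pose J (z t : R) := h (x + r * t) * phi (r / a * t - b / a * z) * (r / a).
have mJ : measurable_fun setT (fun p : R * R => (J p.1 p.2 * phi p.1)%:E).
  apply/measurable_EFinP; apply: measurable_funM; last exact: measurableT_comp.
  apply: measurable_funM => //; apply: measurable_funM.
    apply: measurableT_comp => //; apply: measurable_funD => //.
    exact: measurable_funM.
  apply: measurableT_comp => //.
  by apply: measurable_funB; exact: measurable_funM.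
have J0 z t : 0 <= J z t.
  apply: mulr_ge0; last by apply: divr_ge0; exact: ltW.
  by apply: mulr_ge0 => //; exact: normal_pdf_ge0.
have mJ1 z : measurable_fun setT (fun t => (J z t)%:E).
  apply/measurable_EFinP; apply: measurable_funM => //; apply: measurable_funM.
    by apply: measurableT_comp => //; exact: measurable_funD.
  by apply: measurableT_comp => //; exact: measurable_funB.
have inner z : (\int[gauss]_t (h (x + a * t + b * z)%R)%:E =
    \int[mu]_t (J z t)%:E)%E.
  rewrite ge0_integral_gauss; last 2 first.
  - apply/measurable_EFinP; apply: measurableT_comp => //.
    by apply: measurable_funD => //; exact: measurable_funD.
  - by move=> t; rewrite lee_fin.
  under eq_integral do rewrite -EFinM.
  pose F (t : R^o) : R^o := r / a * t - b / a * z.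
  have FE : (F^`())%classic = cst (r / a).
    apply/funext => t; rewrite derive1E /F deriveB// deriveM// derive_id !derive_cst.
    by rewrite scaler0 addr0 subr0 /GRing.scale/= mulr1.
  have ra : 0 < r / a by rewrite divr_gt0.
  rewrite (@increasing_ge0_integration_by_substitutionT _ F
    (fun t => h (x + a * t + b * z) * phi t)).
  - apply: eq_integral => t _; rewrite FE /J /F /=; congr ((h _ * _ * _)%:E).
    by field; rewrite gt_eqF.
  - by move=> s t st; rewrite ltrD2r ltr_pM2l.
  - by rewrite FE => t; exact: cvg_cst.
  - by rewrite FE; exact: is_cvg_cst.
  - by rewrite FE; exact: is_cvg_cst.
  - by move=> t; apply: derivableB => //; exact: derivableM.
  - apply: cvg_comp (cvg_addrr_Ny _); exact: gt0_cvgMrNy.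
  - apply: cvg_comp (cvg_addrr _); exact: gt0_cvgMry.
  - move=> t; apply: cvgM; last by apply: continuous_normal_pdf; exact: oner_neq0.
    apply: (cvg_comp (fun t => x + a * t + b * z) h); last exact: ch.
    apply: cvgD; last exact: cvg_cst.
    apply: cvgD; first exact: cvg_cst.
    apply: cvgM; [exact: cvg_cst|exact: cvg_id].
  - by move=> t; rewrite mulr_ge0 ?normal_pdf_ge0.
have mJ2 : measurable_fun setT (fun p : R * R => (J p.1 p.2)%:E).
  apply/measurable_EFinP; apply: measurable_funM => //; apply: measurable_funM.
    apply: measurableT_comp => //; apply: measurable_funD => //.
    exact: measurable_funM.
  apply: measurableT_comp => //.
  by apply: measurable_funB; exact: measurable_funM.
under eq_integral do rewrite inner.
rewrite [LHS]ge0_integral_gauss; last 2 first.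
- have J20 (p : R * R) : (0 <= (J p.1 p.2)%:E)%E by rewrite lee_fin.
  exact: (@measurable_fun_fubini_tonelli_F _ _ _ _ _ mu _ mJ2 J20).
- by move=> z; apply: integral_ge0 => t _; rewrite lee_fin.
transitivity (\int[mu]_z \int[mu]_t (J z t * phi z)%:E)%E.
  apply: eq_integral => z _; rewrite muleC -ge0_integralZl ?lee_fin ?normal_pdf_ge0//.
    by apply: eq_integral => t _; rewrite -EFinM mulrC.
    exact: mJ1.
  by move=> t _; rewrite lee_fin.
transitivity (\int[mu]_t \int[mu]_z (J z t * phi z)%:E)%E.
  have Jphi0 (p : R * R) : (0 <= (J p.1 p.2 * phi p.1)%:E)%E.
    by rewrite lee_fin mulr_ge0// normal_pdf_ge0.
  exact: (@fubini_tonelli _ _ _ _ _ mu mu _ mJ Jphi0).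
rewrite ge0_integral_gauss; last 2 first.
- by apply/measurable_EFinP; apply: measurableT_comp => //; exact: measurable_funD.
- by move=> t; rewrite lee_fin.
apply: eq_integral => t _ /=.
(* The second factor is the conditional density of the second Gaussian given the normalised sum [t]:
   mean b t / r, standard deviation a / r. *)
transitivity (\int[mu]_z ((h (x + r * t)%R * phi t)%:E *
    (normal_pdf (b * t / r) (a / r) z)%:E))%E.
  apply: eq_integral => z _; rewrite -EFinM /J; congr EFin.
  rewrite -[LHS]mulrA -[LHS]mulrA -[RHS]mulrA; congr (_ * _).
  have ar : 0 < a / r by rewrite divr_gt0.
  rewrite !normal_pdf01E normal_pdfE ?gt_eqF// (normal_peakE ar) /normal_fun.
  have -> : expR (- (z - b * t / r) ^+ 2 / ((a / r) ^+ 2 *+ 2)) =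
     expR (- (r / a * t - b / a * z) ^+ 2 / 2) * expR (- z ^+ 2 / 2) * expR (t ^+ 2 / 2).
    rewrite -!expRD; congr expR.
    (* This builds the constraint on [r] into the exponents, so that what remains is an identity of
       rational functions in free variables. *)
    have -> : t ^+ 2 = (r ^+ 2 - b ^+ 2) / a ^+ 2 * t ^+ 2.
      by rewrite r2 addrK divff ?mul1r// expf_neq0// gt_eqF.
    have -> : z ^+ 2 = (r ^+ 2 - b ^+ 2) / a ^+ 2 * z ^+ 2.
      by rewrite r2 addrK divff ?mul1r// expf_neq0// gt_eqF.
    by rewrite -mulr_natr; field; rewrite !gt_eqF.
  have et : expR (- t ^+ 2 / 2) * expR (t ^+ 2 / 2) = 1.
    by rewrite -expRD mulNr addNr expR0.
  set e1 := expR (- (_ - _) ^+ 2 / 2); set e2 := expR (- z ^+ 2 / 2).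
  set e3 := expR (- t ^+ 2 / 2) in et *; set e4 := expR (t ^+ 2 / 2) in et *.
  transitivity (normal_peak 1 * e1 * (r / a) * (normal_peak 1 * e2) * (e3 * e4)).
    by rewrite et mulr1; ring.
  by field; rewrite !gt_eqF.
rewrite ge0_integralZl//; last 3 first.
- by apply/measurable_EFinP; exact: measurable_normal_pdf.
- by move=> z _; rewrite lee_fin normal_pdf_ge0.
- by rewrite lee_fin mulr_ge0// normal_pdf_ge0.
by rewrite integral_normal_pdf mule1 EFinM.
Qed.

Lemma gauss_shift_integrable (h : R -> R) (C x a : R) : continuous h ->
  (forall y, `|h y| <= C) ->
  gauss.-integrable setT (EFin \o (fun t => h (x + a * t))).
Proof.
move=> ch hC; apply: (@bounded_integrable _ _ _ _ _ C) => //.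
apply: measurableT_comp; first exact: continuous_measurable_fun.
exact: measurable_funD.
Qed.

(** Adding [C] reduces to a nonnegative function. Zero coefficients are treated apart because the
    change of variables divides by [a]. *)
Lemma gauss_stable (h : R -> R) (C x a b : R) : continuous h ->
  (forall y, `|h y| <= C) -> 0 <= a -> 0 <= b ->
  \int[gauss]_z \int[gauss]_t h (x + b * z + a * t) =
  \int[gauss]_t h (x + Num.sqrt (a ^+ 2 + b ^+ 2) * t).
Proof.
move=> ch hC; rewrite !le_eqVlt => /predU1P[<- b0|a0].
  rewrite expr0n/= add0r sqrtr_sqr ger0_norm; last first.
    by case/predU1P: b0 => [<-//|/ltW].
  apply: eq_Rintegral => z _; rewrite -[RHS](prob_Rintegral_cst gauss).
  by apply: eq_Rintegral => t _; rewrite mul0r addr0.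
case/predU1P => [<-|b0].
  rewrite expr0n/= addr0 sqrtr_sqr gtr0_norm//.
  rewrite -[RHS](prob_Rintegral_cst gauss); apply: eq_Rintegral => z _.
  by apply: eq_Rintegral => t _; rewrite mul0r addr0.
pose k y := h y + C.
have ck : continuous k by move=> y; apply: cvgD; [exact: ch|exact: cvg_cst].
have k0 y : 0 <= k y by have := hC y; rewrite /k ler_norml; lra.
have kC y : `|k y| <= C + C.
  by rewrite ger0_norm// /k lerD2r (le_trans (ler_norm _)).
have shift y c : \int[gauss]_t k (y + c * t) = \int[gauss]_t h (y + c * t) + C.
  rewrite RintegralD//; first by rewrite prob_Rintegral_cst.
    exact: gauss_shift_integrable hC.
  by apply: (@bounded_integrable _ _ _ _ _ `|C|).
have E (z : R) : (\int[gauss]_t (k (x + a * t + b * z)%R)%:E)%E =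
    (\int[gauss]_t k (x + b * z + a * t))%:E.
  rewrite /Rintegral fineK; last first.
    by apply: integrable_fin_num => //; exact: gauss_shift_integrable kC.
  by apply: eq_integral => t _; rewrite addrAC.
have := ge0_gauss_stable x ck k0 a0 b0.
under eq_integral do rewrite E.
move=> /(congr1 fine); rewrite -!/(Rintegral _ _ _) shift.
under eq_Rintegral do rewrite shift.
set G := fun z : R => \int[gauss]_t h (x + b * z + a * t).
have hi z := @gauss_shift_integrable _ _ (x + b * z) a ch hC.
have Gi : gauss.-integrable setT (EFin \o G).
  apply: (@bounded_integrable _ _ _ _ _ C).
    apply: (@measurable_fun_Rintegral_prod _ _ _ _ _ gauss
      (fun p : R * R => h (x + b * p.1 + a * p.2)) C) => [|p]; last exact: hC.
    apply: measurableT_comp; first exact: continuous_measurable_fun.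
    apply: measurable_funD; last exact: measurable_funM.
    by apply: measurable_funD => //; exact: measurable_funM.
  by move=> z; apply: le_norm_Rintegral_cst => // t; exact: hC.
rewrite RintegralD//; last exact: (@bounded_integrable _ _ _ _ _ `|C|).
by rewrite prob_Rintegral_cst => /addIr.
Qed.

End gaussian.

(** * Replacing a jump with a Gaussian increment in a single cell *)

Section average.
Context {R : realType} d {T : measurableType d} (P : probability T R).

(** The Taylor inequality holds at every shifted point with the same [C]; integrating it over the
    shift leaves [C] unchanged. *)
Lemma taylor3_average (psi : T -> R) (C : R) (h h1 h2 : R -> R) :
  measurable_fun setT psi -> taylor3 C h h1 h2 ->
  measurable_fun setT h1 -> measurable_fun setT h2 ->
  taylor3 C (fun x => \int[P]_z h (x + psi z)) (fun x => \int[P]_z h1 (x + psi z))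
    (fun x => \int[P]_z h2 (x + psi z)).
Proof.
move=> mpsi Th m1 m2; have C0 := taylor3_ge0 Th.
have mx x : measurable_fun setT (fun z => x + psi z) by exact: measurable_funD.
have i0 x : P.-integrable setT (EFin \o (fun z => h (x + psi z))).
  apply: (bounded_integrable _ (M := C)) => [|z]; last exact: taylor3_bound Th _.
  exact: measurableT_comp (taylor3_measurable Th) _.
have i1 x : P.-integrable setT (EFin \o (fun z => h1 (x + psi z))).
  apply: (bounded_integrable _ (M := 2 * C)) => [|z]; last exact: taylor3_bound1 Th _.
  exact: measurableT_comp m1 _.
have i2 x : P.-integrable setT (EFin \o (fun z => h2 (x + psi z))).
  apply: (bounded_integrable _ (M := 6 * C)) => [|z]; last exact: taylor3_bound2 Th _.
  exact: measurableT_comp m2 _.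
split=> [x|x y].
  by apply: le_norm_Rintegral_cst => // z; exact: taylor3_bound Th _.
have i1y : P.-integrable setT (EFin \o (fun z => y * h1 (x + psi z))).
  by have := integrableZl measurableT y (i1 x); apply: eq_integrable.
have i2y : P.-integrable setT (EFin \o (fun z => (y ^+ 2 / 2) * h2 (x + psi z))).
  by have := integrableZl measurableT (y ^+ 2 / 2) (i2 x); apply: eq_integrable.
have i01 : P.-integrable setT (EFin \o (fun z => h (x + psi z) + y * h1 (x + psi z))).
  by have := integrableD measurableT (i0 x) i1y; apply: eq_integrable.
have i012 : P.-integrable setT (EFin \o (fun z => h (x + psi z) +
    y * h1 (x + psi z) + y ^+ 2 / 2 * h2 (x + psi z))).
  by have := integrableD measurableT i01 i2y; apply: eq_integrable.
have -> : forall u v w t : R, u - v - w * y - t / 2 * y ^+ 2 =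
    u - (v + y * w + y ^+ 2 / 2 * t) by move=> *; field.
rewrite -(RintegralZl _ measurableT (i1 x))// -(RintegralZl _ measurableT (i2 x))//.
rewrite -(RintegralD measurableT (i0 x))// -(RintegralD measurableT i01)//.
apply: le_norm_RintegralB_cst => // z.
have := Th.2 (x + psi z) y; rewrite [x + _ + y]addrAC.
by congr (`|_| <= _); field.
Qed.

End average.

Section one_step.
Context {R : realType} d {T : measurableType d} (P : probability T R).
Context (W : T -> R) (mW : measurable_fun setT W).
Context (W2 : P.-integrable setT (EFin \o (fun w => W w ^+ 2))).

(* The Lindeberg error of a jump [a * W]: it tends to 0 with [a] although [W] has
   only two moments. *)
Definition tail2 (a : R) : R := \int[P]_w (W w ^+ 2 * Num.min 1 (`|a * W w|)).

Lemma square_integrable_integrable : P.-integrable setT (EFin \o W).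
Proof.
have i1 : P.-integrable setT (EFin \o (fun w => 1 + W w ^+ 2)).
  have ic : P.-integrable setT (EFin \o cst (1 : R)).
    by apply: (bounded_integrable _ (M := `|1|)).
  by have := integrableD measurableT ic W2; apply: eq_integrable.
apply: le_integrable i1 => //; first exact/measurable_EFinP.
move=> w _ /=; rewrite lee_fin [leRHS]ger0_norm ?addr_ge0 ?sqr_ge0//.
have := sqr_ge0 (1 - `|W w|); rewrite -[W w ^+ 2]real_normK ?num_real//.
by have -> : (1 - `|W w|) ^+ 2 = 1 - 2 * `|W w| + `|W w| ^+ 2 by [ring]; have := normr_ge0 (W w); lra.
Qed.

Let mtail a : measurable_fun setT (fun w => W w ^+ 2 * Num.min 1 (`|a * W w|)).
Proof.
apply: measurable_funM; first exact: measurable_funX.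
apply: measurable_minr; first exact: measurable_cst.
by apply: measurableT_comp => //; exact: measurable_funM.
Qed.

Let min_ge0 (x : R) : 0 <= Num.min 1 `|x|.
Proof. by rewrite le_min ler01/=. Qed.

Lemma tail2_integrable a :
  P.-integrable setT (EFin \o (fun w => W w ^+ 2 * Num.min 1 (`|a * W w|))).
Proof.
apply: le_integrable W2 => //; first exact/measurable_EFinP.
move=> w _ /=; rewrite lee_fin normrM ler_piMr//.
by rewrite ger0_norm// ge_min lexx.
Qed.

Lemma tail2_ge0 a : 0 <= tail2 a.
Proof. by apply: Rintegral_ge0 => w _; rewrite mulr_ge0// sqr_ge0. Qed.

Lemma le_tail2 a b : 0 <= a -> a <= b -> tail2 a <= tail2 b.
Proof.
move=> a0 ab; apply: le_Rintegral => //; [exact: tail2_integrable..|].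
move=> w _; rewrite ler_wpM2l ?sqr_ge0// le_min ge_min lexx/= ge_min.
apply/orP; right; rewrite !normrM ler_wpM2r//.
by rewrite !ger0_norm// (le_trans a0).
Qed.

Lemma tail2_small (e : R) : 0 < e -> exists2 a, 0 < a & tail2 a <= e.
Proof.
move=> e0.
have cv : tail2 n.+1%:R^-1 @[n --> \oo] --> (0 : R).
  have [||||fi _ cv] := @dominated_convergence _ _ _ P setT measurableT
    (fun n => EFin \o (fun w => W w ^+ 2 * Num.min 1 (`|n.+1%:R^-1 * W w|)))
    (cst 0%E) (EFin \o (fun w => W w ^+ 2)) _ _ _ W2.
  - by move=> n; exact/measurable_EFinP.
  - exact: measurable_cst.
  - apply: aeW => w _; apply: cvg_EFin; first exact: nearW.
    rewrite [X in _ --> X](_ : _ = W w ^+ 2 * 0); last by rewrite mulr0.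
    apply: cvgM; first exact: cvg_cst.
    apply: (@squeeze_cvgr _ _ _ _ (cst 0) (fun n => n.+1%:R^-1 * `|W w|)).
    + near=> n; rewrite min_ge0/= ge_min; apply/orP; right.
      by rewrite normrM ger0_norm ?invr_ge0.
    + exact: cvg_cst.
    + rewrite [X in _ --> X](_ : _ = 0 * `|W w|); last by rewrite mul0r.
      by apply: cvgM; [exact: cvg_harmonic|exact: cvg_cst].
  - apply: aeW => w n _ /=; rewrite lee_fin normrM ger0_norm ?sqr_ge0// ler_piMr ?sqr_ge0//.
    by rewrite ger0_norm// ge_min lexx.
  move: cv; rewrite integral0 => /fine_cvg; exact.
have /cvgrPdist_le/(_ e e0)[n _ /(_ n (leqnn n))] := cv.
rewrite sub0r normrN => /(le_trans (ler_norm _)) h.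
by exists n.+1%:R^-1 => //; rewrite invr_gt0.
Unshelve. all: by end_near. Qed.

Lemma jump_expansion (C : R) (g g1 g2 : R -> R) (x a : R) : taylor3 C g g1 g2 ->
  `|\int[P]_w g (x + a * W w) -
    (g x + a * g1 x * \int[P]_w W w + a ^+ 2 / 2 * g2 x * \int[P]_w (W w ^+ 2))|
  <= 7 * C * a ^+ 2 * tail2 a.
Proof.
move=> Tg; have i1 := square_integrable_integrable.
have ig : P.-integrable setT (EFin \o (fun w => g (x + a * W w))).
  apply: (bounded_integrable _ (M := C)) => [|w]; last exact: taylor3_bound Tg _.
  apply: measurableT_comp; first exact: taylor3_measurable Tg.
  by apply: measurable_funD => //; exact: measurable_funM.
have i0 : P.-integrable setT (EFin \o cst (g x)).
  by apply: (bounded_integrable _ (M := `|g x|)).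
have i1' : P.-integrable setT (EFin \o (fun w => a * g1 x * W w)).
  by have := integrableZl measurableT (a * g1 x) i1; apply: eq_integrable.
have i2' : P.-integrable setT (EFin \o (fun w => a ^+ 2 / 2 * g2 x * W w ^+ 2)).
  by have := integrableZl measurableT (a ^+ 2 / 2 * g2 x) W2; apply: eq_integrable.
have i01 : P.-integrable setT (EFin \o (fun w => g x + a * g1 x * W w)).
  by have := integrableD measurableT i0 i1'; apply: eq_integrable.
have i012 : P.-integrable setT (EFin \o (fun w => g x + a * g1 x * W w +
    a ^+ 2 / 2 * g2 x * W w ^+ 2)).
  by have := integrableD measurableT i01 i2'; apply: eq_integrable.
have it : P.-integrable setT
    (EFin \o (fun w => 7 * C * a ^+ 2 * (W w ^+ 2 * Num.min 1 (`|a * W w|)))).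
  by have := integrableZl measurableT (7 * C * a ^+ 2) (tail2_integrable a);
    apply: eq_integrable.
have <- : \int[P]_w (cst (g x) w) = g x by rewrite prob_Rintegral_cst.
rewrite -(RintegralZl _ measurableT i1)// -(RintegralZl _ measurableT W2)//.
rewrite -(RintegralD measurableT i0)// -(RintegralD measurableT i01)// /tail2.
rewrite -(RintegralZl _ measurableT (tail2_integrable a))//.
apply: le_norm_RintegralB => // w.
have := taylor3_min Tg x (a * W w); rewrite exprMn -!mulrA.
by congr (`|_| <= _); rewrite /=; field.
Qed.

Local Notation gauss := (normal_prob (0 : R) 1).

(** A bound for the mean of (1 + |z|)^3 by an even polynomial: the cube is at most 8 when |z| <= 1
    and at most 8 z^4 otherwise. *)
Definition gauss_cubic : R := \int[gauss]_z (8 * (1 + z ^+ 4)).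

Let gauss_cubic_integrable :
  gauss.-integrable setT (EFin \o (fun z => 8 * (1 + z ^+ 4))).
Proof.
have i4 := @gauss_integrable_powD R 4 isT.
have ic : gauss.-integrable setT (EFin \o cst (1 : R)).
  by apply: (bounded_integrable _ (M := `|1|)).
have i5 := integrableD measurableT ic i4.
by have := integrableZl measurableT 8 i5; apply: eq_integrable.
Qed.

Lemma gauss_cubic_ge0 : 0 <= gauss_cubic.
Proof.
by apply: Rintegral_ge0 => z _; rewrite mulr_ge0// addr_ge0// exprn_even_ge0.
Qed.

(** As b + s z has first two moments b and b^2 + s^2, the quadratic part integrates exactly; what is
    left is at most ((|b| + s)(1 + |z|))^3. *)
Lemma gauss_expansion (C : R) (g g1 g2 : R -> R) (x b s : R) : 0 <= s ->
  taylor3 C g g1 g2 ->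
  `|\int[gauss]_z g (x + (b + s * z)) -
    (g x + b * g1 x + (b ^+ 2 + s ^+ 2) / 2 * g2 x)|
  <= C * (`|b| + s) ^+ 3 * gauss_cubic.
Proof.
move=> s0 Tg; have C0 := taylor3_ge0 Tg.
have i1 : gauss.-integrable setT (EFin \o (fun x : R => x)).
  by have := @gauss_integrable_powD R 1 isT; apply: eq_integrable.
have i2 := @gauss_integrable_powD R 2 isT.
have ig : gauss.-integrable setT (EFin \o (fun z => g (x + (b + s * z)))).
  apply: (bounded_integrable _ (M := C)) => [|w]; last exact: taylor3_bound Tg _.
  apply: measurableT_comp; first exact: taylor3_measurable Tg.
  by apply: measurable_funD => //; apply: measurable_funD => //; exact: measurable_funM.
pose c0 := g x + b * g1 x + b ^+ 2 / 2 * g2 x.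
have i0 : gauss.-integrable setT (EFin \o cst c0).
  by apply: (bounded_integrable _ (M := `|c0|)).
pose c1 := s * g1 x + s * b * g2 x; pose c2 := s ^+ 2 / 2 * g2 x.
have i1' : gauss.-integrable setT (EFin \o (fun z => c1 * z)).
  by have := integrableZl measurableT c1 i1; apply: eq_integrable.
have i2' : gauss.-integrable setT (EFin \o (fun z => c2 * z ^+ 2)).
  by have := integrableZl measurableT c2 i2; apply: eq_integrable.
have i01 : gauss.-integrable setT (EFin \o (fun z => cst c0 z + c1 * z)).
  by have := integrableD measurableT i0 i1'; apply: eq_integrable.
have i012 : gauss.-integrable setT (EFin \o (fun z => cst c0 z + c1 * z + c2 * z ^+ 2)).
  by have := integrableD measurableT i01 i2'; apply: eq_integrable.
have it : gauss.-integrable setT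
    (EFin \o (fun z => C * (`|b| + s) ^+ 3 * (8 * (1 + z ^+ 4)))).
  by have := integrableZl measurableT (C * (`|b| + s) ^+ 3) gauss_cubic_integrable;
    apply: eq_integrable.
have -> : g x + b * g1 x + (b ^+ 2 + s ^+ 2) / 2 * g2 x =
    \int[gauss]_z (cst c0 z + c1 * z + c2 * z ^+ 2).
  rewrite (RintegralD measurableT i01)// (RintegralD measurableT i0)//.
  rewrite (RintegralZl _ measurableT i1)// (RintegralZl _ measurableT i2)//.
  by rewrite gauss_mean gauss_var prob_Rintegral_cst /c0 /c2; field.
rewrite /gauss_cubic -(RintegralZl _ measurableT gauss_cubic_integrable)//.
apply: le_norm_RintegralB => // z; set y : R := b + s * z.
apply: le_trans (_ : _ <= C * `|y| ^+ 3) _.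
  have := Tg.2 x y; congr (`|_| <= _).
  by rewrite /cst /c0 /c1 /c2 /y; field.
rewrite -mulrA ler_wpM2l//.
have bs0 : 0 <= `|b| + s by rewrite addr_ge0.
have z0 := normr_ge0 (z : R); have b0 := normr_ge0 b.
have yb : `|y| <= (`|b| + s) * (1 + `|z : R|).
  apply: le_trans (ler_normD _ _) _; rewrite normrM (ger0_norm s0); nra.
apply: le_trans (_ : _ <= ((`|b| + s) * (1 + `|z : R|)) ^+ 3) _.
  by rewrite lerXn2r// nnegrE// mulr_ge0// addr_ge0.
rewrite exprMn ler_wpM2l ?exprn_ge0//.
have -> : (z : R) ^+ 4 = `|z : R| ^+ 4.
  by rewrite -normrX ger0_norm// exprn_even_ge0.
set u := `|z : R| in z0 *.
have [u1|u1] := lerP u 1.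
  have : (1 + u) ^+ 3 <= 2 ^+ 3 by rewrite lerXn2r// ?nnegrE ?addr_ge0//; lra.
  have : 0 <= u ^+ 4 by rewrite exprn_ge0.
  lra.
have : (1 + u) ^+ 3 <= (2 * u) ^+ 3 by rewrite lerXn2r// ?nnegrE ?addr_ge0// ?mulr_ge0//; lra.
have : u ^+ 3 <= u ^+ 4 by rewrite ler_weXn2l// ltW.
rewrite exprMn; lra.
Qed.

Let mu := \int[P]_w W w.
Let kappa := \int[P]_w (W w ^+ 2).

Lemma kappa_ge0 : 0 <= kappa.
Proof. by apply: Rintegral_ge0 => w _; rewrite sqr_ge0. Qed.

(** The two errors of order dt^(3/2): the squared drift, whose 3 is half of the 6 in
    [taylor3_bound2], and the cubic Gaussian remainder. *)
Definition step_cst (A : R) : R :=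
  3 * (A * mu) ^+ 2 + (A * (`|mu| + Num.sqrt kappa)) ^+ 3 * gauss_cubic.

(** Both sides share the terms a mu dt [g1 x] and a^2 kappa dt [g2 x] / 2. The jump remainder keeps
    its factor dt; the Gaussian second moment contains in addition the squared drift, of order dt^2.
    Errors of order dt^(3/2) disappear when summed over about 1 / dt cells. *)
Lemma one_step (C : R) (g g1 g2 : R -> R) (x a A dt : R) : taylor3 C g g1 g2 ->
  0 <= a -> a <= A -> 0 <= dt -> dt <= 1 ->
  `|g x + dt * (\int[P]_w g (x + a * W w) - g x) -
    \int[gauss]_z g (x + (a * mu * dt + Num.sqrt kappa * a * Num.sqrt dt * z))|
  <= 7 * C * tail2 A * (a ^+ 2 * dt) + C * step_cst A * (dt * Num.sqrt dt).
Proof.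
move=> Tg a0 aA d0 d1; have C0 := taylor3_ge0 Tg; have A0 := le_trans a0 aA.
have k0 := kappa_ge0; set rk := Num.sqrt kappa; set rd := Num.sqrt dt.
have rk0 : 0 <= rk by rewrite sqrtr_ge0.
have rd0 : 0 <= rd by rewrite sqrtr_ge0.
have rk2 : rk ^+ 2 = kappa by rewrite sqr_sqrtr.
have rd2 : rd ^+ 2 = dt by rewrite sqr_sqrtr.
have rd1 : rd <= 1 by rewrite -(ler_pXn2r (ltn0Sn 1)) ?nnegrE// rd2 expr1n.
pose b := a * mu * dt; pose s := rk * a * rd.
have s0 : 0 <= s by rewrite !mulr_ge0.
have J := jump_expansion x a Tg; have G := gauss_expansion x b s0 Tg.
rewrite -/mu -/kappa in J; rewrite -/b -/s.
set IJ := \int[P]_w g (x + a * W w) in J *.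
set IG := \int[gauss]_z g (x + (b + s * z)) in G *.
have -> : g x + dt * (IJ - g x) - IG =
    dt * (IJ - (g x + a * g1 x * mu + a ^+ 2 / 2 * g2 x * kappa)) -
    (IG - (g x + b * g1 x + (b ^+ 2 + s ^+ 2) / 2 * g2 x)) -
    b ^+ 2 / 2 * g2 x.
  by rewrite /b /s !exprMn rk2 rd2; field.
have t1 : `|dt * (IJ - (g x + a * g1 x * mu + a ^+ 2 / 2 * g2 x * kappa))| <=
    7 * C * tail2 A * (a ^+ 2 * dt).
  rewrite normrM (ger0_norm d0).
  have -> : 7 * C * tail2 A * (a ^+ 2 * dt) = dt * (7 * C * a ^+ 2 * tail2 A) by ring.
  rewrite ler_wpM2l//; apply: le_trans J _.
  by rewrite ler_wpM2l ?le_tail2// !mulr_ge0// sqr_ge0.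
have bs : `|b| + s <= rd * (A * (`|mu| + rk)).
  rewrite /b /s !normrM (ger0_norm a0) (ger0_norm d0) -rd2 expr2.
  have -> : a * `|mu| * (rd * rd) + rk * a * rd = a * rd * (`|mu| * rd + rk) by ring.
  have -> : rd * (A * (`|mu| + rk)) = A * rd * (`|mu| + rk) by ring.
  apply: ler_pM; rewrite ?mulr_ge0 ?addr_ge0 ?mulr_ge0//.
    by rewrite ler_wpM2r.
  by rewrite lerD2r ler_piMr.
have rd3 : rd ^+ 3 = dt * rd by rewrite exprSr rd2.
have t2 : `|IG - (g x + b * g1 x + (b ^+ 2 + s ^+ 2) / 2 * g2 x)| <=
    C * ((A * (`|mu| + rk)) ^+ 3 * gauss_cubic) * (dt * rd).
  have -> : C * ((A * (`|mu| + rk)) ^+ 3 * gauss_cubic) * (dt * rd) =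
      C * (rd * (A * (`|mu| + rk))) ^+ 3 * gauss_cubic by rewrite -rd3; ring.
  apply: le_trans G _; rewrite ler_wpM2r ?gauss_cubic_ge0// ler_wpM2l//.
  by rewrite lerXn2r// nnegrE ?addr_ge0// !mulr_ge0// addr_ge0.
have t3 : `|b ^+ 2 / 2 * g2 x| <= C * (3 * (A * mu) ^+ 2) * (dt * rd).
  have := taylor3_bound2 Tg x => h2.
  have b2 : 0 <= b ^+ 2 / 2 by rewrite divr_ge0 ?sqr_ge0.
  rewrite normrM (ger0_norm b2); apply: le_trans (ler_wpM2l b2 h2) _.
  have -> : b ^+ 2 / 2 * (6 * C) = C * (3 * (a * mu) ^+ 2) * (dt * (rd * rd)).
    by rewrite -expr2 rd2 /b; field.
  have am : (a * mu) ^+ 2 <= (A * mu) ^+ 2.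
    by rewrite !exprMn ler_wpM2r ?sqr_ge0// lerXn2r.
  apply: ler_pM.
  - by apply: mulr_ge0 => //; apply: mulr_ge0 => //; exact: sqr_ge0.
  - by rewrite !mulr_ge0.
  - by rewrite ler_wpM2l// ler_wpM2l.
  - by rewrite ler_wpM2l// ler_piMr.
have -> : C * step_cst A * (dt * rd) = C * (3 * (A * mu) ^+ 2) * (dt * rd) +
    C * ((A * (`|mu| + rk)) ^+ 3 * gauss_cubic) * (dt * rd).
  by rewrite /step_cst -/rk; ring.
apply: le_trans (ler_normB _ _) _; apply: le_trans (lerD (ler_normB _ _) (lexx _)) _.
lra.
Qed.

End one_step.

(** * Integration over pairs of independent variables *)

Definition mfun_of d d' (T : measurableType d) (U : measurableType d')
  (f : T -> U) (mf : measurable_fun setT f) : {mfun T >-> U} :=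
  HB.pack f (isMeasurableFun.Build _ _ _ _ f mf).

Section independent_pair.
Context {R : realType} d {T : measurableType d} (P : probability T R).
Context d1 d2 {U : measurableType d1} {V : measurableType d2}.
Local Open Scope ereal_scope.

(** The event [E] is carried along so that a variable can be merged into a linear combination while
    the result stays independent of a whole block of later variables. *)
Lemma independent_pair_law (X : {mfun T >-> U}) (Y : {mfun T >-> V}) (E : set T) :
  measurable E ->
  (forall A B, measurable A -> measurable B ->
    P (X @^-1` A `&` Y @^-1` B `&` E) = P (X @^-1` A) * P (Y @^-1` B) * P E) ->
  forall C, measurable C ->
    P ((fun w => (X w, Y w)) @^-1` C `&` E) =
    P E * (distribution P X \x distribution P Y) C.
Proof.
move=> mE indep C mC.
have mXY : measurable_fun setT (fun w => (X w, Y w)) by exact: measurable_fun_pair.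
pose XY : {mfun T >-> (U * V)%type} := mfun_of mXY.
have PE0 : (0 <= fine (P E))%R by rewrite fine_ge0.
pose p : {nonneg R} := NngNum PE0.
have PEE : P E = (p%:num)%:E by rewrite /= fineK// fin_num_measure.
pose pm : {measure set (U * V) -> \bar R} := pushforward (mrestr P mE) XY.
pose m' := pm mXY.
have -> : P ((fun w => (X w, Y w)) @^-1` C `&` E) = m' C by [].
(* The mass of [E] is moved into the first marginal, so that uniqueness of product measures
   applies. *)
rewrite -(@product_measure_unique _ _ _ _ _ (mscale p (distribution P X)) (distribution P Y))//; last first.
  move=> A B mA mB; rewrite /m' /= /pushforward /mrestr /=.
  rewrite (_ : _ @^-1` _ = X @^-1` A `&` Y @^-1` B)// indep//.
  transitivity (P E * P (X @^-1` A) * P (Y @^-1` B)); first by rewrite muleC muleA.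
  by rewrite {1}PEE.
rewrite /product_measure1 ge0_integral_mscale//; last first.
  by have := measurable_fun_xsection (distribution P Y) mC.
by rewrite PEE.
Qed.

Lemma independent_Rintegral (X : {mfun T >-> U}) (Y : {mfun T >-> V})
    (f : U * V -> R) (M : R) :
  (forall A B, measurable A -> measurable B ->
    P (X @^-1` A `&` Y @^-1` B) = P (X @^-1` A) * P (Y @^-1` B)) ->
  measurable_fun setT f -> (forall p, `|f p| <= M)%R ->
  (\int[P]_w f (X w, Y w) = \int[P]_w \int[P]_v f (X w, Y v))%R.
Proof.
move=> indep mf fM.
have mXY : measurable_fun setT (fun w => (X w, Y w)) by exact: measurable_fun_pair.
pose XY : {mfun T >-> (U * V)%type} := mfun_of mXY.
have law C : measurable C ->
    distribution P XY C = (distribution P X \x distribution P Y) C.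
  move=> mC; rewrite /distribution /pushforward /= -[X in P X]setIT.
  rewrite independent_pair_law//; first by rewrite probability_setT mul1e.
  by move=> A B mA mB; rewrite setIT probability_setT mule1 indep.
have fi d0 (S : measurableType d0) (Q : probability S R) (g : S -> U * V) :
    measurable_fun setT g -> Q.-integrable setT (EFin \o (f \o g)).
  move=> mg; apply: (bounded_integrable _ (M := M)) => [|w]; last exact: fM.
  exact: measurableT_comp.
have mEf : measurable_fun setT (EFin \o f) by exact/measurable_EFinP.
have -> : (\int[P]_w f (X w, Y w) = \int[distribution P XY]_p f p)%R.
  by rewrite /Rintegral integral_distribution//; exact: fi.
have -> : (\int[distribution P XY]_p f p)%R =
    fine (\int[distribution P X \x distribution P Y]_p (f p)%:E).
  by congr fine; apply: eq_measure_integral => A mA _; exact: law.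
have fprod : (distribution P X \x distribution P Y).-integrable setT (EFin \o f).
  apply/integrableP; split => //; have := fi _ _ (distribution P XY) id.
  move=> /(_ (@measurable_id _ _ _))/integrableP[_].
  by congr (_ < _); apply: eq_measure_integral => A mA _; exact: law.
rewrite -integral12_prod_meas1// /fubini_F.
have inner u : \int[distribution P Y]_y (f (u, y))%:E =
    (\int[P]_v f (u, Y v))%:E.
  have ifu : P.-integrable setT (EFin \o (fun v => f (u, Y v))).
    by apply: (fi _ _ _ (fun v => (u, Y v))); exact: measurable_fun_pair.
  rewrite /Rintegral fineK ?integrable_fin_num//.
  by rewrite integral_distribution//; exact: measurableT_comp mEf _.
under eq_integral do rewrite /= inner.
rewrite integral_distribution//.
  apply/measurable_EFinP.
  apply: (@measurable_fun_Rintegral_prod _ _ _ _ _ P (fun p => f (p.1, Y p.2)) M) => //.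
  apply: measurableT_comp mf _.
  by apply: measurable_fun_pair => //; exact: measurableT_comp.
apply: (bounded_integrable _ (M := M)) => [|w].
  apply: (@measurable_fun_Rintegral_prod _ _ _ _ _ P (fun p => f (X p.1, Y p.2)) M) => //.
  apply: measurableT_comp mf _.
  by apply: measurable_fun_pair; exact: measurableT_comp.
apply: le_norm_Rintegral_cst => //.
by apply: (fi _ _ _ (fun v => (X w, Y v))); exact: measurable_fun_pair.
Qed.

End independent_pair.

(** * Linear combinations of the jumps with fixed weights *)

Section iid_sums.
Context {R : realType} d {T : measurableType d} (P : probability T R).
Context (W : nat -> {RV P >-> R}) (iidW : iid W).

(** The first [k] sets are filled with [setT]. *)
Lemma independent_block (k n : nat) (B : nat -> set R) :
  (forall i, measurable (B i)) ->
  (P (\bigcap_(i in `I_n) (W (k + i)%N @^-1` B i)) =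
   \prod_(i < n) P (W (k + i)%N @^-1` B i))%E.
Proof.
move=> mB; pose B' j := if (j < k)%N then setT else B (j - k)%N.
have mB' j : measurable (B' j) by rewrite /B'; case: ifP.
have B'k i : B' (k + i)%N = B i by rewrite /B' ltnNge leq_addr/= addKn.
have := iidW.1 (k + n)%N B' mB'.
rewrite big_split_ord/= big1 ?mul1e => [|i _]; last first.
  by rewrite /B' ltn_ord preimage_setT probability_setT.
under eq_bigr do rewrite B'k.
move=> <-; congr (P _); apply/seteqP; split=> w /= h i /= ik.
  have [ilk|kli] := ltnP i k; first by rewrite /B' ilk.
  by rewrite -(subnKC kli) B'k; apply: h; rewrite /= ltn_subLR.
by have := h (k + i)%N; rewrite /= ltn_add2l B'k; apply.
Qed.

Definition lincomb (s : seq R) (w : T) : R := \sum_(j < size s) s`_j * W j w.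

Lemma measurable_lincomb s : measurable_fun setT (lincomb s).
Proof.
by apply: measurable_sum => j; apply: measurable_funM.
Qed.

Lemma lincomb_rcons s x w : lincomb (rcons s x) w = lincomb s w + x * W (size s) w.
Proof.
rewrite /lincomb size_rcons big_ord_recr/= nth_rcons ltnn eqxx; congr (_ + _).
by apply: eq_bigr => j _; rewrite nth_rcons ltn_ord.
Qed.

(** Induction from the right end: the last variable is split off the combination and put in front of
    the block, to which the hypothesis for the shorter list applies. *)
Lemma lincomb_independent s n (A : set R) (B : nat -> set R) : measurable A ->
  (forall i, measurable (B i)) ->
  (P (lincomb s @^-1` A `&` \bigcap_(i in `I_n) (W (size s + i)%N @^-1` B i)) =
   P (lincomb s @^-1` A) * P (\bigcap_(i in `I_n) (W (size s + i)%N @^-1` B i)))%E.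
Proof.
elim/last_ind: s n A B => [|s x IHs] n A B mA mB.
  have [A0|A0] := pselect (A 0).
    rewrite (_ : lincomb [::] @^-1` A = setT).
      by rewrite setTI probability_setT mul1e.
    by apply/seteqP; split=> w //= _; rewrite /lincomb big_ord0.
  rewrite (_ : lincomb [::] @^-1` A = set0) ?set0I ?measure0 ?mul0e//.
  by apply/seteqP; split=> w //=; rewrite /lincomb big_ord0.
set E := \bigcap_(i in _) _.
have mE : measurable E by apply: bigcap_measurableType => i _; exact: measurable_funPTI.
pose X := mfun_of (measurable_lincomb s).
have pairI (A' B' : set R) : measurable A' -> measurable B' ->
    (P (X @^-1` A' `&` W (size s) @^-1` B' `&` E) =
     P (X @^-1` A') * P (W (size s) @^-1` B') * P E)%E.
  move=> mA' mB'; pose B1 i := if i is i'.+1 then B i' else B'.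
  have mB1 i : measurable (B1 i) by case: i.
  have EB : \bigcap_(i in `I_n.+1) (W (size s + i)%N @^-1` B1 i) =
      W (size s) @^-1` B' `&` E.
    apply/seteqP; split=> w /= h.
      split; first by have := h 0%N; rewrite /= addn0; apply.
      by move=> i /= ni; have := h i.+1; rewrite /= ltnS size_rcons addSnnS; apply.
    case=> [|i] /= ni; first by rewrite addn0; exact: h.1.
    by have := h.2 i; rewrite /= size_rcons addSnnS; apply; rewrite -ltnS.
  have PEB : P (W (size s) @^-1` B' `&` E) = (P (W (size s) @^-1` B') * P E)%E.
    rewrite -EB independent_block// big_ord_recl/= addn0 /E independent_block//.
    by congr (_ * _)%E; apply: eq_bigr => i _; rewrite size_rcons addSnnS.
  by rewrite -setIA -EB IHs// EB PEB muleA.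
pose C := [set p : R * R | A (p.1 + x * p.2)].
have mf : measurable_fun setT (fun p : R * R => p.1 + x * p.2).
  by apply: measurable_funD => //; exact: measurable_funM.
have mC : measurable C by rewrite -[C]setTI; exact: mf.
have CE : lincomb (rcons s x) @^-1` A = (fun w => (X w, W (size s) w)) @^-1` C.
  by apply/seteqP; split=> w /=; rewrite /C /= lincomb_rcons.
rewrite CE (independent_pair_law mE pairI mC).
rewrite -[X in (_ = P X * _)%E]setIT independent_pair_law//.
  by rewrite probability_setT mul1e muleC.
move=> A' B' mA' mB'; rewrite setIT probability_setT mule1.
have := IHs 1%N A' (fun=> B') mA' (fun=> mB').
rewrite (_ : \bigcap_(i in _) _ = W (size s) @^-1` B')//.
apply/seteqP; split=> w /= h; first by have := h 0%N; rewrite /= addn0; apply.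
by case=> //= _; rewrite addn0.
Qed.

Lemma identical_Rintegral (g : R -> R) (M : R) i j : measurable_fun setT g ->
  (forall x, `|g x| <= M) -> \int[P]_w g (W i w) = \int[P]_w g (W j w).
Proof.
move=> mg gM; have gi k : P.-integrable setT (EFin \o (g \o W k)).
  apply: (bounded_integrable _ (M := M)) => [|w]; last exact: gM.
  exact: measurableT_comp.
have mEg : measurable_fun setT (EFin \o g) by exact/measurable_EFinP.
rewrite /Rintegral; congr fine.
rewrite -[LHS](integral_distribution mEg (gi i)).
rewrite -[RHS](integral_distribution mEg (gi j)).
by apply: eq_measure_integral => A mA _; exact: iidW.2.
Qed.

Definition lin_mean (g : R -> R) (s : seq R) : R := \int[P]_w g (lincomb s w).

Lemma lin_mean_integrable (g : R -> R) (M : R) s : measurable_fun setT g ->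
  (forall x, `|g x| <= M) -> P.-integrable setT (EFin \o (g \o lincomb s)).
Proof.
move=> mg gM; apply: (bounded_integrable _ (M := M)) => [|w]; last exact: gM.
by apply: measurableT_comp => //; exact: measurable_lincomb.
Qed.

(** One more jump acts on the test function: [g] is averaged over a W. This turns arrivals into
    operators applied to [g]. *)
Lemma lin_mean_rcons (g : R -> R) (M : R) s a : measurable_fun setT g ->
  (forall x, `|g x| <= M) ->
  lin_mean g (rcons s a) = lin_mean (fun x => \int[P]_w g (x + a * W 0%N w)) s.
Proof.
move=> mg gM; rewrite /lin_mean.
under eq_Rintegral do rewrite lincomb_rcons.
pose f (p : R * R) := g (p.1 + a * p.2).
have mf : measurable_fun setT f.
  apply: measurableT_comp => //; apply: measurable_funD => //.
  exact: measurable_funM.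
have fM p : `|f p| <= M by exact: gM.
have indep (A B : set R) : measurable A -> measurable B ->
    (P (mfun_of (measurable_lincomb s) @^-1` A `&` W (size s) @^-1` B) =
     P (mfun_of (measurable_lincomb s) @^-1` A) * P (W (size s) @^-1` B))%E.
  move=> mA mB; have := lincomb_independent s 1 mA (fun=> mB).
  rewrite (_ : \bigcap_(i in _) _ = W (size s) @^-1` B)//.
  apply/seteqP; split=> w /= h; first by have := h 0%N; rewrite /= addn0; apply.
  by case=> //= _; rewrite addn0.
rewrite (independent_Rintegral indep mf fM); apply: eq_Rintegral => w _ /=.
apply: (@identical_Rintegral (fun y => g (lincomb s w + a * y)) M) => //.
by apply: measurableT_comp => //; apply: measurable_funD => //; exact: measurable_funM.
Qed.

Lemma lin_mean_cat0 (g : R -> R) (M : R) n : measurable_fun setT g ->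
  (forall x, `|g x| <= M) -> lin_mean g (nseq n 0) = g 0.
Proof.
move=> mg gM; rewrite /lin_mean -[RHS](prob_Rintegral_cst P).
apply: eq_Rintegral => w _; congr (g _); apply: big1 => j _.
by rewrite nth_nseq if_same mul0r.
Qed.

End iid_sums.

(** * Conditioning on an event and on a countably valued variable *)

Section event.
Context {R : realType} d {T : measurableType d} (P : probability T R).

(** The event is encoded as a Boolean variable, so that [independent_Rintegral] applies;
    independence is checked on the four sets of Booleans. *)
Lemma Rintegral_event (X : {mfun T >-> R}) (E : set T) (g : R -> R) (M : R) :
  measurable E ->
  (forall A, measurable A -> P (E `&` X @^-1` A) = (P E * P (X @^-1` A))%E) ->
  measurable_fun setT g -> (forall x, `|g x| <= M) ->
  \int[P]_(w in E) g (X w) = fine (P E) * \int[P]_w g (X w).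
Proof.
move=> mE indep mg gM.
have mY : measurable_fun setT (fun w => `[< E w >]).
  apply: (measurable_fun_bool true); rewrite setTI (_ : _ @^-1` _ = E)//.
  by apply/seteqP; split=> w /= /asboolP.
pose Y := mfun_of mY.
have EY w : (w \in E) = `[< E w >] :> bool.
  by apply/idP/idP => [|/asboolP Ew]; rewrite inE// => Ew; exact/asboolP.
have YE (b : bool) : Y @^-1` [set b] = if b then E else ~` E.
  case: b; apply/seteqP; split=> w /=; rewrite /Y /=.
  - by move/asboolP.
  - by move/asboolP.
  - by move/asboolP.
  - by move=> nE; apply/asboolP.
have indepC A : measurable A -> P (~` E `&` X @^-1` A) = (P (~` E) * P (X @^-1` A))%E.
  move=> mA; have mXA : measurable (X @^-1` A) by exact: measurable_funPTI.
  rewrite setIC -setDE measureD//; last by rewrite -ge0_fin_numE// fin_num_measure.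
  rewrite [X in (_ - P X)%E]setIC indep// probability_setC//.
  rewrite muleBl ?fin_num_measure// ?mul1e//.
have indepY A B : measurable A -> measurable B ->
    P (X @^-1` A `&` Y @^-1` B) = (P (X @^-1` A) * P (Y @^-1` B))%E.
  move=> mA _; have [Bt|Bt] := pselect (B true); have [Bf|Bf] := pselect (B false).
  - have -> : B = setT by apply/seteqP; split=> // -[].
    by rewrite preimage_setT setIT probability_setT mule1.
  - have -> : B = [set true] by apply/seteqP; split=> -[]//= _; exact: Bt.
    by rewrite YE setIC indep// muleC.
  - have -> : B = [set false] by apply/seteqP; split=> -[]//= _; exact: Bf.
    by rewrite YE setIC indepC// muleC.
  - have -> : B = set0 by apply/seteqP; split=> -[].
    by rewrite preimage_set0 setI0 measure0 mule0.
pose f (p : R * bool) := g p.1 * p.2%:R.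
have M0 : 0 <= M by exact: le_trans (normr_ge0 _) (gM 0).
have mb : measurable_fun setT (fun b : bool => b%:R : R) by [].
have mf : measurable_fun setT f.
  apply: measurable_funM; first exact: measurableT_comp.
  exact: measurableT_comp mb _.
have fM p : `|f p| <= M.
  rewrite /f normrM; case: p.2 => /=; first by rewrite normr1 mulr1.
  by rewrite normr0 mulr0.
have gX : P.-integrable setT (EFin \o (fun w => g (X w))).
  by apply: (bounded_integrable _ (M := M)) => //; exact: measurableT_comp.
have Yi : P.-integrable setT (EFin \o (fun w => (Y w)%:R)).
  apply: (bounded_integrable _ (M := 1)) => [|w]; first exact: measurableT_comp mb _.
  by case: (Y w); rewrite /= ?normr1// normr0.
have IY : \int[P]_w (Y w)%:R = fine (P E).
  have <- : (\int[P]_w (\1_E w)%:E)%E = P E by rewrite integral_indic// setIT.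
  rewrite /Rintegral; congr fine; apply: eq_integral => w _; by rewrite indicE EY.
transitivity (\int[P]_w f (X w, Y w)).
  rewrite Rintegral_mkcond; apply: eq_Rintegral => w _; rewrite /patch /f /=.
  by rewrite EY; case: ifP; rewrite ?mulr1 ?mulr0.
rewrite (independent_Rintegral indepY mf fM) /f /=.
under eq_Rintegral do rewrite (RintegralZl _ measurableT Yi) IY.
by rewrite RintegralZr// mulrC.
Qed.

End event.

Section discrete.
Context {R : realType} d {T : measurableType d} (P : probability T R).
Context (I : countType) (L : T -> I).
Context (mL : forall l, measurable (L @^-1` [set l])).

Lemma measurable_fun_discrete d' (U : measurableType d') (F : I -> T -> U) :
  (forall l, measurable_fun setT (F l)) -> measurable_fun setT (fun w => F (L w) w).
Proof.
move=> mF _ Y mY; rewrite setTI.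
rewrite (_ : _ @^-1` _ = \bigcup_l (L @^-1` [set l] `&` F l @^-1` Y)).
  apply: countable_bigcupT_measurable => [|l]; first exact: countableP.
  by apply: measurableI => //; rewrite -[X in measurable X]setTI; exact: mF.
by apply/seteqP; split=> [w /= h|w [l _ [/= <-]]//]; exists (L w).
Qed.

(** The integrals are compared level by level; [pickle] numbers the levels, and codes without a
    preimage give empty sets. *)
Lemma Rintegral_discrete (F G : I -> T -> R) (M : R) :
  (forall l, measurable_fun setT (F l)) -> (forall l, measurable_fun setT (G l)) ->
  (forall l w, `|F l w| <= M) -> (forall l w, `|G l w| <= M) ->
  (forall l, \int[P]_(w in L @^-1` [set l]) F l w = \int[P]_(w in L @^-1` [set l]) G l w) ->
  \int[P]_w F (L w) w = \int[P]_w G (L w) w.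
Proof.
move=> mF mG FM GM FG.
pose A n := [set w | pickle (L w) = n].
have AE n : A n = if @pickle_inv I n is Some l then L @^-1` [set l] else set0.
  apply/seteqP; split=> w; rewrite /A /=.
    by move=> <-; rewrite pickleK_inv.
  case E : (@pickle_inv I n) => [l|]//= Lw.
  by have := @pickle_invK I n; rewrite /ocancel E /= Lw.
have mA n : measurable (A n).
  by rewrite AE; case: (@pickle_inv I n) => [l|]; [exact: mL|exact: measurable0].
have tA : trivIset setT A by move=> i j _ _ [w []] /= <- <-.
have UA : \bigcup_n A n = setT.
  by apply/seteqP; split=> w //= _; exists (pickle (L w)).
have iF (H : I -> T -> R) : (forall l, measurable_fun setT (H l)) ->
    (forall l w, `|H l w| <= M) -> P.-integrable setT (EFin \o (fun w => H (L w) w)).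
  move=> mH HM; apply: (bounded_integrable _ (M := M)) => [|w]; last exact: HM.
  exact: measurable_fun_discrete.
have SE (H : I -> T -> R) : (forall l, measurable_fun setT (H l)) ->
    (forall l w, `|H l w| <= M) -> (\int[P]_w (H (L w) w)%:E =
      \sum_(0 <= n <oo) \int[P]_(w in A n) (H (L w) w)%:E)%E.
  move=> mH HM; have := @integral_bigcup _ _ _ P A (fun w => (H (L w) w)%:E) tA mA.
  by rewrite UA; apply; exact: iF.
rewrite /Rintegral; congr fine; rewrite !SE//.
apply: eq_eseriesr => n _; rewrite AE.
case: (@pickle_inv I n) => [l|]; last by rewrite !integral_set0.
have il (H : I -> T -> R) : (forall l, measurable_fun setT (H l)) ->
    (forall l w, `|H l w| <= M) ->
    (\int[P]_(w in L @^-1` [set l]) (H (L w) w)%:E)%E =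
    (\int[P]_(w in L @^-1` [set l]) H l w)%:E.
  move=> mH HM; rewrite /Rintegral fineK.
    by apply: eq_integral => w; rewrite inE /= => ->.
  apply: integrable_fin_num => //; apply: integrableS (_ : P.-integrable setT _) => //.
  by apply: (bounded_integrable _ (M := M)).
by rewrite !il// FG.
Qed.

End discrete.

(** * Random cell counts and the effect of one more cell *)

Section poisson_step.
Context {R : realType} d {T : measurableType d} (P : probability T R).
Context (W : nat -> {RV P >-> R}) (iidW : iid W).
Context (K : nat -> T -> nat) (mK : forall i, measurable_fun setT (K i)).
Context (a : nat -> R).

Definition counts n w : seq nat := mkseq (fun j => K j w) n.

(* [l] lists the numbers of arrivals in the successive cells: each arrival in cell
   [j] receives the weight [a j]. *)
Definition coefs (l : seq nat) : seq R :=
  flatten (mkseq (fun j => nseq (nth 0%N l j) (a j)) (size l)).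

Lemma coefs_counts n w :
  coefs (counts n w) = flatten (mkseq (fun j => nseq (K j w) (a j)) n).
Proof.
rewrite /coefs /counts size_mkseq; congr flatten; apply/eq_in_map => j.
by rewrite mem_iota add0n => /andP[_ jn]; rewrite nth_mkseq.
Qed.

Lemma coefs_countsS n w :
  coefs (counts n.+1 w) = coefs (counts n w) ++ nseq (K n w) (a n).
Proof. by rewrite !coefs_counts mkseqS flatten_rcons. Qed.

Lemma counts_preimage n (l : seq nat) : counts n @^-1` [set l] =
  if size l == n then \bigcap_(i in `I_n) (K i @^-1` [set nth 0%N l i]) else set0.
Proof.
case: ifPn => [/eqP ln|ln]; apply/seteqP; split=> w //=.
- by move=> <- i /= ni; rewrite nth_mkseq.
- move=> h; apply: (@eq_from_nth _ 0%N); first by rewrite size_mkseq ln.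
  by move=> i; rewrite size_mkseq => ni; rewrite nth_mkseq//; exact: h.
- by move=> lE; move: ln; rewrite -lE size_mkseq eqxx.
Qed.

Lemma measurable_count i k : measurable (K i @^-1` [set k]).
Proof. by rewrite -[X in measurable X]setTI; exact: mK. Qed.

Lemma measurable_counts n (l : seq nat) : measurable (counts n @^-1` [set l]).
Proof.
rewrite counts_preimage; case: ifP => // _.
by apply: bigcap_measurableType => i _; exact: measurable_count.
Qed.

Lemma counts_independent (indK : mutually_independent P K) n l k :
  P (counts n @^-1` [set l] `&` K n @^-1` [set k]) =
  (P (counts n @^-1` [set l]) * P (K n @^-1` [set k]))%E.
Proof.
rewrite counts_preimage; case: ifPn => [/eqP ln|ln]; last first.
  by rewrite set0I measure0 mul0e.
pose B i := if (i < n)%N then [set nth 0%N l i] else [set k].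
have mB i : measurable (B i) by [].
have Bn : B n = [set k] by rewrite /B ltnn.
have := indK n.+1 B mB; rewrite big_ord_recr/= Bn.
have -> : (\prod_(i < n) P (K i @^-1` B i) =
    P (\bigcap_(i in `I_n) (K i @^-1` [set nth 0%N l i])))%E.
  rewrite (indK n (fun i => [set nth 0%N l i]))//.
  by apply: eq_bigr => i _; rewrite /B ltn_ord.
move=> <-; congr (P _); apply/seteqP; split=> w /=.
  move=> [h1 h2] i /=; rewrite ltnS /B leq_eqVlt => /predU1P[->|ni].
    by rewrite ltnn.
  by rewrite ni; exact: h1.
move=> h; split=> [i /= ni|].
  by have := h i; rewrite /= /B ni; apply; exact: ltnW.
by have := h n; rewrite /= /B ltnn; apply.
Qed.

(** On each level of the counts the weights are constants and the [W j] keep their law. *)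
Lemma lin_mean_decouple (g : R -> R) (M : R) n :
  (forall l s A, measurable A ->
    P (counts n @^-1` [set l] `&` lincomb W s @^-1` A) =
    (P (counts n @^-1` [set l]) * P (lincomb W s @^-1` A))%E) ->
  measurable_fun setT g -> (forall x, `|g x| <= M) ->
  \int[P]_w g (lincomb W (coefs (counts n w)) w) =
  \int[P]_w lin_mean W g (coefs (counts n w)).
Proof.
move=> indep mg gM.
apply: (@Rintegral_discrete _ _ _ P _ (counts n) (measurable_counts n)
  (fun l w => g (lincomb W (coefs l) w)) (fun l _ => lin_mean W g (coefs l)) M) => //.
- by move=> l; apply: measurableT_comp => //; exact: measurable_lincomb.
- move=> l w; apply: le_norm_Rintegral_cst => //; exact: lin_mean_integrable gM.
move=> l; have := @Rintegral_event _ _ _ P (mfun_of (measurable_lincomb W (coefs l)))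
  _ g M (measurable_counts n l) (fun A => indep l (coefs l) A) mg gM.
move=> /= ->.
rewrite Rintegral_cst; [exact: mulrC|exact: measurable_counts].
Qed.

Lemma poisson_pmf01 (dt : R) : 0 < dt -> dt <= 1 ->
  [/\ poisson_pmf dt 0 = expR (- dt), poisson_pmf dt 1 = dt * expR (- dt) &
      1 - dt <= expR (- dt) <= 1 - dt + dt ^+ 2].
Proof.
move=> d0 d1; rewrite /poisson_pmf d0; split.
- by rewrite expr0 fact0 divr1 mul1r.
- by rewrite expr1 divr1.
rewrite expR_ge1Dx/= expRN.
have e1 := expR_ge1Dx dt.
apply: le_trans (_ : _ <= (1 + dt)^-1) _.
  by rewrite lef_pV2 ?posrE ?expR_gt0//; lra.
have -> : (1 + dt)^-1 = 1 - dt + dt ^+ 2 / (1 + dt) by field; rewrite gt_eqF//; lra.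
by rewrite lerD2l ler_pdivrMr ?ler_peMr ?sqr_ge0//; lra.
Qed.

(** No arrival leaves [g] as it is, one arrival averages it over a jump, and more arrivals are only
    bounded. Their probability, and the replacements of exp(-dt) by 1 - dt and of dt exp(-dt) by dt,
    cost at most M dt^2 each, hence the 3. *)
Lemma poisson_step (indK : mutually_independent P K) (n : nat) (dt M : R) (g : R -> R) :
  0 < dt -> dt <= 1 ->
  (forall k, P (K n @^-1` [set k]) = (poisson_pmf dt k)%:E) ->
  measurable_fun setT g -> (forall x, `|g x| <= M) ->
  `|\int[P]_w lin_mean W g (coefs (counts n.+1 w)) -
    \int[P]_w lin_mean W (fun x => g x + dt * (\int[P]_v g (x + a n * W 0%N v) - g x))
      (coefs (counts n w))| <= 3 * M * dt ^+ 2.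
Proof.
move=> d0 d1 KP mg gM; have M0 : 0 <= M by exact: le_trans (normr_ge0 _) (gM 0).
pose Ag x := \int[P]_v g (x + a n * W 0%N v).
have mAg : measurable_fun setT Ag.
  apply: (@measurable_fun_Rintegral_prod _ _ _ _ _ P
    (fun p : R * T => g (p.1 + a n * W 0%N p.2)) M) => //.
  apply: measurableT_comp => //; apply: measurable_funD => //.
  by apply: measurable_funM => //; exact: measurableT_comp.
have AgM x : `|Ag x| <= M.
  apply: le_norm_Rintegral_cst => //.
  apply: (bounded_integrable _ (M := M)) => //.
  by apply: measurableT_comp => //; apply: measurable_funD => //; exact: measurable_funM.
have lM (f : R -> R) s : measurable_fun setT f -> (forall x, `|f x| <= M) ->
    `|lin_mean W f s| <= M.
  by move=> mf fM; apply: le_norm_Rintegral_cst => //; exact: lin_mean_integrable fM.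
pose G (l : seq nat) := lin_mean W g (coefs l).
pose F0 (w : T) := lin_mean W g (coefs (counts n w)).
pose F1 (w : T) := lin_mean W Ag (coefs (counts n w)).
have mdisc (F : seq nat -> R) m : measurable_fun setT (fun w => F (counts m w)).
  apply: (@measurable_fun_discrete _ _ _ _ (measurable_counts m) _ _
    (fun l _ => F l)) => l; exact: measurable_cst.
have iF m (F : seq nat -> R) : (forall l, `|F l| <= M) ->
    P.-integrable setT (EFin \o (fun w => F (counts m w))).
  by move=> FM; apply: (bounded_integrable _ (M := M)) => //; exact: mdisc.
have mind k : measurable_fun setT (\1_(K n @^-1` [set k]) : T -> R).
  exact: measurable_indic (measurable_count n k).
have ind1 k w : `|\1_(K n @^-1` [set k]) w : R| <= 1.
  by rewrite indicE; case: (_ \in _); rewrite ?normr1// normr0.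
have split_ind k (F : seq nat -> R) : (forall l, `|F l| <= M) ->
    \int[P]_w (F (counts n w) * \1_(K n @^-1` [set k]) w) =
    poisson_pmf dt k * \int[P]_w F (counts n w).
  move=> FM; rewrite -RintegralZl//; last exact: iF.
  have pk1 : 0 <= poisson_pmf dt k <= 1.
    by rewrite -!lee_fin -KP measure_ge0 probability_le1//; exact: measurable_count.
  apply: (@Rintegral_discrete _ _ _ P _ (counts n) (measurable_counts n)
    (fun l w => F l * \1_(K n @^-1` [set k]) w) (fun l w => poisson_pmf dt k * F l) M) => //.
  - by move=> l; apply: measurable_funM.
  - by move=> l w; rewrite normrM -[M]mulr1; apply: ler_pM.
  - move=> l w; rewrite normrM -[M]mul1r; apply: ler_pM => //.
    by case/andP: pk1 => p0 p1; rewrite ger0_norm.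
  move=> l; have mE := measurable_counts n l; have mk := measurable_count n k.
  rewrite RintegralZl//; last first.
    apply: integrableS (_ : P.-integrable setT _) => //.
    by apply: (bounded_integrable _ (M := 1)) => // w; exact: ind1.
  rewrite Rintegral_cst// /Rintegral integral_indic// setIC.
  rewrite [X in _ * fine X = _](counts_independent indK n l k) KP.
  by rewrite fineM ?fin_num_measure//=; ring.
pose f (w : T) := G (counts n.+1 w).
pose ind k := \1_(K n @^-1` [set k]) : T -> R.
have indE k w : ind k w = (K n w == k)%:R.
  rewrite /ind indicE; case: eqP => h; first by rewrite mem_set.
  by rewrite memNset.
have fE w : `|f w - (F0 w * ind 0%N w + F1 w * ind 1%N w)| <=
    M * (1 - ind 0%N w - ind 1%N w).
  rewrite /f /G coefs_countsS !indE; case: (K n w) => [|[|k]] /=.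
  - by rewrite cats0 mulr1 mulr0 addr0 /F0 subrr normr0 subr0 subrr mulr0.
  - rewrite cats1 mulr0 mulr1 add0r /F1 (lin_mean_rcons iidW _ _ mg gM).
    by rewrite subrr normr0 subr0 subrr mulr0.
  - by rewrite !mulr0 addr0 !subr0 mulr1; exact: lM.
have iind k : P.-integrable setT (EFin \o ind k).
  by apply: (bounded_integrable _ (M := 1)) => [|w]; [exact: mind|exact: ind1].
have iFi k (F : seq nat -> R) : (forall l, `|F l| <= M) ->
    P.-integrable setT (EFin \o (fun w => F (counts n w) * ind k w)).
  move=> FM; apply: (bounded_integrable _ (M := M)) => [|w].
    by apply: measurable_funM; [exact: mdisc|exact: mind].
  by rewrite normrM -[M]mulr1; apply: ler_pM => //; exact: ind1.
have Iind k : \int[P]_w ind k w = poisson_pmf dt k.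
  transitivity (fine (\int[P]_w (\1_(K n @^-1` [set k]) w)%:E)%E); first by [].
  rewrite integral_indic//; last exact: measurable_count.
  by rewrite setIT [X in fine X](KP k).
have [p0 p1 /andP[e1 e2]] := poisson_pmf01 d0 d1.
have Gl (l : seq nat) : `|lin_mean W g (coefs l)| <= M by exact: lM.
have Al (l : seq nat) : `|lin_mean W Ag (coefs l)| <= M by exact: lM.
have i1 := iFi 0%N _ Gl; have i2 := iFi 1%N _ Al.
have i3 : P.-integrable setT (EFin \o (fun w => F0 w * ind 0%N w + F1 w * ind 1%N w)).
  by have := integrableD measurableT i1 i2; apply: eq_integrable.
have ic : P.-integrable setT (EFin \o cst (1 : R)).
  by apply: (bounded_integrable _ (M := `|1|)).
have i4 : P.-integrable setT (EFin \o (fun w => 1 - ind 0%N w)).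
  by have := integrableB measurableT ic (iind 0%N); apply: eq_integrable.
have i5 : P.-integrable setT (EFin \o (fun w => 1 - ind 0%N w - ind 1%N w)).
  by have := integrableB measurableT i4 (iind 1%N); apply: eq_integrable.
have i6 : P.-integrable setT (EFin \o (fun w => M * (1 - ind 0%N w - ind 1%N w))).
  by have := integrableZl measurableT M i5; apply: eq_integrable.
have := le_norm_RintegralB (iF n.+1 G Gl) i3 i6 fE.
rewrite RintegralZl// RintegralB// RintegralB// RintegralD// !Iind prob_Rintegral_cst.
rewrite (split_ind 0%N _ Gl) (split_ind 1%N _ Al) p0 p1.
have -> : \int[P]_w lin_mean W (fun x => g x + dt * (\int[P]_v g (x + a n * W 0%N v) - g x))
      (coefs (counts n w)) = (1 - dt) * \int[P]_w F0 w + dt * \int[P]_w F1 w.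
  have j0 : P.-integrable setT (EFin \o F0) by exact: (iF n _ Gl).
  have j1 : P.-integrable setT (EFin \o F1) by exact: (iF n _ Al).
  have j0' : P.-integrable setT (EFin \o (fun w => (1 - dt) * F0 w)).
    by have := integrableZl measurableT (1 - dt) j0; apply: eq_integrable.
  have j1' : P.-integrable setT (EFin \o (fun w => dt * F1 w)).
    by have := integrableZl measurableT dt j1; apply: eq_integrable.
  rewrite -(RintegralZl _ measurableT j0) -(RintegralZl _ measurableT j1).
  rewrite -RintegralD//; apply: eq_Rintegral => w _; rewrite /F0 /F1 /lin_mean.
  set s := coefs _.
  have k0 := lin_mean_integrable W s mg gM; have k1 := lin_mean_integrable W s mAg AgM.
  have k0' : P.-integrable setT (EFin \o (fun w => (1 - dt) * g (lincomb W s w))).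
    by have := integrableZl measurableT (1 - dt) k0; apply: eq_integrable.
  have k1' : P.-integrable setT (EFin \o (fun w => dt * Ag (lincomb W s w))).
    by have := integrableZl measurableT dt k1; apply: eq_integrable.
  rewrite -(RintegralZl _ measurableT k0) -(RintegralZl _ measurableT k1).
  rewrite -RintegralD//; apply: eq_Rintegral => v _.
  have AgE x : \int[P]_v g (x + a n * W 0%N v) = Ag x by [].
  by rewrite /= AgE; ring.
have b0 : `|\int[P]_w F0 w| <= M by apply: le_norm_Rintegral_cst => [|w]; [exact: (iF n _ Gl)|exact: Gl].
have b1 : `|\int[P]_w F1 w| <= M by apply: le_norm_Rintegral_cst => [|w]; [exact: (iF n _ Al)|exact: Al].
change (`|\int[P]_w G (counts n.+1 w) - (expR (- dt) * \int[P]_w F0 w +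
    dt * expR (- dt) * \int[P]_w F1 w)| <= M * (1 - expR (- dt) - dt * expR (- dt)) ->
  `|\int[P]_w G (counts n.+1 w) - ((1 - dt) * \int[P]_w F0 w + dt * \int[P]_w F1 w)|
    <= 3 * M * dt ^+ 2).
move: (\int[P]_w G _) (\int[P]_w F0 w) (\int[P]_w F1 w) b0 b1 => If I0 I1 b0 b1.
set e := expR (- dt) in e1 e2 * => h.
have t0 : `|(e - (1 - dt)) * I0| <= dt ^+ 2 * M.
  rewrite normrM; apply: ler_pM => //; rewrite ger0_norm; lra.
have t1 : `|(dt * e - dt) * I1| <= dt ^+ 2 * M.
  rewrite normrM; apply: ler_pM => //.
  rewrite -[X in _ - X]mulr1 -mulrBr normrM gtr0_norm// expr2 ler_pM2l//.
  rewrite ler_norml; have := sqr_ge0 dt; nra.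
have t2 : M * (1 - e - dt * e) <= M * dt ^+ 2.
  rewrite ler_wpM2l//; nra.
have -> : 3 * M * dt ^+ 2 = M * dt ^+ 2 + dt ^+ 2 * M + dt ^+ 2 * M by ring.
move: t0 t1 t2 h; rewrite !ler_norml; lra.
Qed.

End poisson_step.

(** * Telescoping the replacements over all cells *)

Section lindeberg.
Context {R : realType} d {T : measurableType d} (P : probability T R).
Context (W : nat -> {RV P >-> R}) (iidW : iid W).
Context (W2 : P.-integrable setT (EFin \o (fun w => W 0%N w ^+ 2))).
Context (K : nat -> T -> nat) (mK : forall i, measurable_fun setT (K i)).
Context (indK : mutually_independent P K).
Context (a : nat -> R) (A dt : R) (n : nat).
Context (a0 : a 0%N = 0) (a_ge0 : forall j, 0 <= a j) (aA : forall j, a j <= A).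
Context (dt0 : 0 < dt) (dt1 : dt <= 1).
Context (KP : forall j k, (j < n)%N -> P (K j.+1 @^-1` [set k]) = (poisson_pmf dt k)%:E).
Local Notation gauss := (normal_prob (0 : R) 1).

Let mu := \int[P]_w W 0%N w.
Let kappa := \int[P]_w (W 0%N w ^+ 2).
Let drift i := \sum_(0 <= j < i) a j.+1 * mu * dt.
Let var i := \sum_(i <= j < n) kappa * a j.+1 ^+ 2 * dt.

Let kappa0 : 0 <= kappa.
Proof. exact: kappa_ge0. Qed.

Let var0 i : 0 <= var i.
Proof.
by apply: sumr_ge0 => j _; rewrite !mulr_ge0// ?sqr_ge0// ltW.
Qed.

Section test_function.
Context (C : R) (h h1 h2 : R -> R) (Th : taylor3 C h h1 h2).
Context (mh1 : measurable_fun setT h1) (mh2 : measurable_fun setT h2).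

(* [G i] averages [h] over the compensated Gaussian increments of the cells after
   the first [i] ones, so that swapping cell [i] amounts to comparing [G i.+1] with
   [G i]. *)
Let G i (x : R) := \int[gauss]_z h (x + (- drift i + Num.sqrt (var i) * z)).

Let G_taylor i : exists g1 g2, taylor3 C (G i) g1 g2.
Proof.
eexists _, _; apply: (@taylor3_average _ _ _ gauss
  (fun z => - drift i + Num.sqrt (var i) * z) C h h1 h2) => //.
by apply: measurable_funD => //; exact: measurable_funM.
Qed.

(** The mean of the increment cancels the new part of [drift i.+1], and its variance completes
    [var i.+1] to [var i] by [gauss_stable]. *)
Let GS i (x : R) : (i < n)%N -> \int[gauss]_z G i.+1 (x + (a i.+1 * mu * dt +
  Num.sqrt kappa * a i.+1 * Num.sqrt dt * z)) = G i x.
Proof.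
move=> ni; rewrite /G.
have -> : var i = Num.sqrt (var i.+1) ^+ 2 + (Num.sqrt kappa * a i.+1 * Num.sqrt dt) ^+ 2.
  rewrite sqr_sqrtr// !exprMn !sqr_sqrtr// ?ltW// addrC.
  by rewrite /var big_ltn.
transitivity (\int[gauss]_z h (x - drift i + Num.sqrt (Num.sqrt (var i.+1) ^+ 2 +
    (Num.sqrt kappa * a i.+1 * Num.sqrt dt) ^+ 2) * z)); last first.
  by apply: eq_Rintegral => z _; rewrite addrA.
have s0 : 0 <= Num.sqrt kappa * a i.+1 * Num.sqrt dt.
  by apply: mulr_ge0; [apply: mulr_ge0|]; rewrite ?sqrtr_ge0.
rewrite -(gauss_stable (x - drift i) (taylor3_continuous Th) (taylor3_bound Th)
  (sqrtr_ge0 _) s0).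
apply: eq_Rintegral => z _; apply: eq_Rintegral => t _; congr h.
by rewrite /drift big_nat_recr//=; ring.
Qed.

(** The Poisson error comes first; then [one_step] is applied pointwise to [G i.+1], whose Taylor
    constant is still [C]. *)
Let G_step i : (i < n)%N ->
  `|\int[P]_w lin_mean W (G i.+1) (coefs a (counts K i.+2 w)) -
    \int[P]_w lin_mean W (G i) (coefs a (counts K i.+1 w))| <=
  3 * C * dt ^+ 2 + (7 * C * tail2 P (W 0%N) A * (a i.+1 ^+ 2 * dt) +
    C * step_cst P (W 0%N) A * (dt * Num.sqrt dt)).
Proof.
move=> ni; have [g1 [g2 Tg]] := G_taylor i.+1; have [g1' [g2' Tg']] := G_taylor i.
have C0 := taylor3_ge0 Th.
have mG := taylor3_measurable Tg; have GC := taylor3_bound Tg.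
pose f x := G i.+1 x + dt * (\int[P]_v G i.+1 (x + a i.+1 * W 0%N v) - G i.+1 x).
have step1 : `|\int[P]_w lin_mean W (G i.+1) (coefs a (counts K i.+2 w)) -
    \int[P]_w lin_mean W f (coefs a (counts K i.+1 w))| <= 3 * C * dt ^+ 2.
  exact: (poisson_step iidW mK a indK dt0 dt1 (fun k => KP k ni) mG GC).
set IA := \int[P]_w lin_mean W f _ in step1.
set eps := 7 * C * _ * _ + _.
suff step2 : `|IA - \int[P]_w lin_mean W (G i) (coefs a (counts K i.+1 w))| <= eps.
  by apply: le_trans (ler_distD IA _ _) _; exact: lerD.
have fb x : `|f x - G i x| <= eps.
  rewrite -(GS x ni).
  by apply: (one_step _ W2 x Tg (a_ge0 _) (aA _) (ltW dt0) dt1).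
have fM x : `|f x| <= eps + C.
  have := fb x; have := taylor3_bound Tg' x; rewrite !ler_norml; lra.
have mf : measurable_fun setT f.
  apply: measurable_funD => //; apply: measurable_funM => //; apply: measurable_funB => //.
  apply: (@measurable_fun_Rintegral_prod _ _ _ _ _ P
    (fun p : R * T => G i.+1 (p.1 + a i.+1 * W 0%N p.2)) C) => //.
  apply: measurableT_comp => //; apply: measurable_funD => //.
  by apply: measurable_funM => //; exact: measurableT_comp.
have mdisc (F : seq nat -> R) m : measurable_fun setT (fun w => F (counts K m w)).
  apply: (@measurable_fun_discrete _ _ _ _ (measurable_counts mK m) _ _
    (fun l _ => F l)) => l; exact: measurable_cst.
have mG' := taylor3_measurable Tg'; have GC' := taylor3_bound Tg'.
apply: le_norm_RintegralB_cst.
- apply: (bounded_integrable _ (M := eps + C)) => [|w].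
    exact: (mdisc (fun l => lin_mean W f (coefs a l))).
  by apply: le_norm_Rintegral_cst => [|v]; [exact: lin_mean_integrable fM|exact: fM].
- apply: (bounded_integrable _ (M := C)) => [|w].
    exact: (mdisc (fun l => lin_mean W (G i) (coefs a l))).
  by apply: le_norm_Rintegral_cst => [|v]; [exact: lin_mean_integrable GC'|exact: GC'].
move=> w; apply: le_norm_RintegralB_cst => [||v].
- exact: lin_mean_integrable fM.
- exact: lin_mean_integrable GC'.
- exact: fb.
Qed.

(** At the end [n] no Gaussian is left in [G n], only the shift by the total drift; at the end 0 no
    weighted arrival is left and the value at 0 is the pure Gaussian integral. *)
Lemma lindeberg_bound :
  (forall l s B, measurable B ->
    P (counts K n.+1 @^-1` [set l] `&` lincomb W s @^-1` B) =
    (P (counts K n.+1 @^-1` [set l]) * P (lincomb W s @^-1` B))%E) ->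
  `|\int[P]_w h (lincomb W (coefs a (counts K n.+1 w)) w -
       \sum_(0 <= j < n) a j.+1 * mu * dt) -
    \int[gauss]_z h (Num.sqrt (\sum_(0 <= j < n) kappa * a j.+1 ^+ 2 * dt) * z)| <=
  7 * C * tail2 P (W 0%N) A * (\sum_(0 <= j < n) a j.+1 ^+ 2 * dt) +
  n%:R * (3 * C * dt ^+ 2 + C * step_cst P (W 0%N) A * (dt * Num.sqrt dt)).
Proof.
move=> indep; rewrite -/(drift n) -/(var 0).
have [g1 [g2 Tg]] := G_taylor n.
have Gn x : G n x = h (x - drift n).
  rewrite /G -[RHS](prob_Rintegral_cst gauss); apply: eq_Rintegral => z _.
  by rewrite /var big_geq// sqrtr0 mul0r addr0.
have -> : \int[P]_w h (lincomb W (coefs a (counts K n.+1 w)) w - drift n) =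
    \int[P]_w lin_mean W (G n) (coefs a (counts K n.+1 w)).
  rewrite -(lin_mean_decouple mK a indep (taylor3_measurable Tg) (taylor3_bound Tg)).
  by apply: eq_Rintegral => w _; rewrite Gn.
have -> : \int[gauss]_z h (Num.sqrt (var 0) * z) =
    \int[P]_w lin_mean W (G 0%N) (coefs a (counts K 1 w)).
  have [k1 [k2 Tk]] := G_taylor 0.
  rewrite -[LHS](prob_Rintegral_cst P); apply: eq_Rintegral => w _.
  (* Cell 0 may hold any number of arrivals; all have weight [a 0 = 0]. *)
  rewrite coefs_counts /= a0 cats0.
  rewrite (lin_mean_cat0 _ _ (taylor3_measurable Tk) (taylor3_bound Tk)).
  by apply: eq_Rintegral => z _; rewrite /drift big_nil oppr0 !add0r.
have : forall m, (m <= n)%N ->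
  `|\int[P]_w lin_mean W (G m) (coefs a (counts K m.+1 w)) -
    \int[P]_w lin_mean W (G 0%N) (coefs a (counts K 1 w))| <=
  7 * C * tail2 P (W 0%N) A * (\sum_(0 <= j < m) a j.+1 ^+ 2 * dt) +
  m%:R * (3 * C * dt ^+ 2 + C * step_cst P (W 0%N) A * (dt * Num.sqrt dt)).
  elim=> [_|m IHm mn].
    by rewrite subrr normr0 big_nil mulr0 mul0r addr0.
  apply: le_trans (ler_distD (\int[P]_w lin_mean W (G m) (coefs a (counts K m.+1 w))) _ _) _.
  apply: le_trans (lerD (G_step mn) (IHm (ltnW mn))) _.
  rewrite big_nat_recr//= -natr1.
  move: (\sum_(0 <= i < m) _) (tail2 _ _ _) (step_cst _ _ _) (Num.sqrt dt) => S t c r.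
  by rewrite le_eqVlt; apply/orP; left; apply/eqP; ring.
exact.
Qed.

End test_function.
End lindeberg.

(** * Riemann sums of negative powers *)

Section power_sums.
Context {R : realType}.
Implicit Types (p c x y dt : R).

(** Of the primitives of x^(-p), the one that vanishes at 0 if p < 1 and at infinity if p > 1. This
    normalisation treats alpha > 1 and alpha < 1 by the same formulas. *)
Definition power_primitive p x : R := x `^ (1 - p) / (1 - p).

Lemma powR_continuous_at p x : 0 < x -> {for x, continuous (fun y : R => y `^ p)}.
Proof.
move=> x0; apply/differentiable_continuous/derivable1_diffP.
by have [] := is_derive1_powR p x0.
Qed.

Lemma power_primitive_continuous_at p x : 0 < x ->
  {for x, continuous (power_primitive p)}.
Proof.
by move=> x0; apply: cvgM; [exact: powR_continuous_at|exact: cvg_cst].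
Qed.

Lemma le_powRN p x y : 0 <= p -> 0 < x -> x <= y -> y `^ (- p) <= x `^ (- p).
Proof.
move=> p0 x0 xy; rewrite !powRN lef_pV2 ?posrE ?powR_gt0//.
  by rewrite ge0_ler_powR// nnegrE ?(ltW x0)// (le_trans (ltW x0)).
exact: lt_le_trans xy.
Qed.

Lemma power_primitive_bounds p x y : 0 <= p -> p != 1 -> 0 < x -> x <= y ->
  y `^ (- p) * (y - x) <= power_primitive p y - power_primitive p x <=
  x `^ (- p) * (y - x).
Proof.
move=> p0 p1 x0 xy; have p1' : 1 - p != 0 by rewrite subr_eq0 eq_sym.
have [|||z + ->] := @MVT_segment R (power_primitive p) (fun z => z `^ (- p)) x y.
- exact: xy.
- move=> z; rewrite in_itv/= => /andP[xz _]; have z0 := lt_trans x0 xz.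
  have -> : power_primitive p = (1 - p)^-1 \*: ((@powR R)^~ (1 - p)).
    by apply/funext => t; rewrite /power_primitive mulrC.
  have dp := is_derive1_powR (1 - p) z0.
  have := is_deriveZ (1 - p)^-1 dp; rewrite /GRing.scale/= mulrA mulVf// mul1r.
  by have -> : 1 - p - 1 = - p by ring.
- apply: continuous_in_subspaceT => z; rewrite inE/= in_itv/= => /andP[xz _].
  exact: power_primitive_continuous_at (lt_le_trans x0 xz).
rewrite in_itv/= => /andP[xz zy]; have z0 := lt_le_trans x0 xz.
by rewrite !ler_wpM2r ?subr_ge0//; exact: le_powRN.
Qed.

Lemma power_sum_bounds p c dt n : 0 <= p -> p != 1 -> 0 < c -> 0 <= dt ->
  power_primitive p (c + n%:R * dt) - power_primitive p c <=
  \sum_(0 <= j < n) (c + j%:R * dt) `^ (- p) * dt <=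
  power_primitive p (c + n%:R * dt) - power_primitive p c + c `^ (- p) * dt.
Proof.
move=> p0 p1 c0 d0.
have pos j : 0 < c + j%:R * dt by rewrite ltr_wpDr// mulr_ge0.
have bnd j := @power_primitive_bounds p (c + j%:R * dt) (c + j.+1%:R * dt) p0 p1 (pos j).
have stp j : (c + j.+1%:R * dt) - (c + j%:R * dt) = dt by rewrite -natr1; ring.
have le j : c + j%:R * dt <= c + j.+1%:R * dt by rewrite -subr_ge0 stp.
have {}bnd j := bnd j (le j).
apply/andP; split.
  elim: n => [|n IHn]; first by rewrite mul0r addr0 subrr big_nil.
  by rewrite big_nat_recr//=; have := bnd n; rewrite stp; lra.
(* Subtracting the height at the right end makes the induction close: the excesses of the cells
   telescope. *)
suff : \sum_(0 <= j < n) (c + j%:R * dt) `^ (- p) * dt <=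
    power_primitive p (c + n%:R * dt) - power_primitive p c + c `^ (- p) * dt -
    (c + n%:R * dt) `^ (- p) * dt.
  by have := mulr_ge0 (powR_ge0 (c + n%:R * dt) (- p)) d0; lra.
elim: n => [|n IHn]; first by rewrite mul0r addr0 !subrr big_nil add0r subrr.
by rewrite big_nat_recr//=; have := bnd n; rewrite stp; lra.
Qed.

Lemma powRN_small p (e : R) : 0 < p -> 0 < e ->
  exists2 X : R, 0 < X & forall x, X <= x -> x `^ (- p) <= e.
Proof.
move=> p0 e0; exists (e `^ (- p^-1)); first exact: powR_gt0.
move=> x; move/(le_powRN (ltW p0) (powR_gt0 _ e0)) => /le_trans; apply.
by rewrite -powRrM mulrNN mulVf ?gt_eqF// powRr1// ltW.
Qed.

Lemma cvg_powRN p : 0 < p -> (n%:R : R) `^ (- p) @[n --> \oo] --> (0 : R).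
Proof.
move=> p0; apply/cvgrPdist_le => e e0.
have [X X0 HX] := powRN_small p0 e0.
near=> n; rewrite sub0r normrN ger0_norm ?powR_ge0//; apply: HX.
by near: n; exact: nbhs_infty_ger.
Unshelve. all: by end_near. Qed.

End power_sums.

(** * Locating an arrival in the list of weights *)

Section nth_coefs.
Context {R : realType} (a : nat -> R) (S : nat -> nat).
Context (S0 : S 0%N = 0%N) (Sle : forall i, (S i <= S i.+1)%N).

Lemma size_coefs n :
  size (flatten (mkseq (fun j => nseq (S j.+1 - S j) (a j)) n)) = S n.
Proof.
elim: n => [|n IHn]; first by rewrite S0.
by rewrite mkseqS flatten_rcons size_cat IHn size_nseq subnKC.
Qed.

(** [S i] counts the arrivals before cell [i], so the condition on [p] says that arrival [p] falls
    in cell [i]. *)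
Lemma nth_coefs n i p : (i < n)%N -> (S i <= p < S i.+1)%N ->
  (flatten (mkseq (fun j => nseq (S j.+1 - S j) (a j)) n))`_p = a i.
Proof.
elim: n => // n IHn; rewrite ltnS leq_eqVlt mkseqS flatten_rcons nth_cat size_coefs.
move=> /predU1P[->|ni] /andP[Sp pS].
  by rewrite ltnNge Sp/= nth_nseq ltn_sub2r// (leq_ltn_trans Sp).
suff -> : (p < S n)%N by apply: IHn; rewrite ?ni ?Sp.
apply: leq_trans pS _; move: ni => /subnKC <-.
by elim: (n - i.+1)%N => [|k IHk]; rewrite ?addn0// addnS (leq_trans IHk).
Qed.

End nth_coefs.

Lemma ae_eq_measure (R : realType) d (T : measurableType d) (P : probability T R)
    (A B : set T) : measurable A -> measurable B ->
  {ae P, forall w, A w <-> B w} -> P A = P B.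
Proof.
move=> mA mB AB; rewrite -[A]setIT -[B]setIT -!integral_indic//.
apply: ae_eq_integral => //.
- by apply/measurable_EFinP; exact: measurable_indic.
- by apply/measurable_EFinP; exact: measurable_indic.
apply: filterS AB => w ABw _; rewrite !indicE; congr (_%:R%:E).
have [Aw|nAw] := pselect (A w); first by rewrite !mem_set//; exact/ABw.
by rewrite !memNset// => /ABw.
Qed.

Section generated.
Context d d' (T : measurableType d) (U : measurableType d') (X : nat -> T -> U).
Let G := \bigcup_j preimage_set_system setT (X j) measurable.

Lemma sigma_generated_measurable j :
  measurable_fun (setT : set (g_sigma_algebraType G)) (X j).
Proof.
by move=> _ Y mY; apply: sub_sigma_algebra; exists j => //; exists Y.
Qed.

End generated.

(** * Cell counts expressed through the arrival times *)

Section arrivals.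
Local Open Scope card_scope.
Context {R : realType} d {T : measurableType d} (P : probability T R).
Context (N : R -> {RV P >-> nat}) (Gam W : nat -> {RV P >-> R}).
Context (hN : unit_rate_poisson_process N) (hGam : arrival_times N Gam).
Context (hWGam : independent_sequences P W Gam).

(** [arrival_times] provides only a cardinality. As the arrivals increase, the set in question is
    closed downwards, and comparing cardinals on either side of [j] identifies it. *)
Lemma initial_segment_card (S : set nat) n :
  (forall i j, (i <= j)%N -> S j -> S i) -> S #= `I_n -> forall j, S j <-> (j < n)%N.
Proof.
move=> down Sn j; split=> [Sj|jn].
  have : `I_j.+1 #<= `I_n.
    rewrite -(card_le_eqr Sn); apply: subset_card_le => i /=.
    by rewrite ltnS => ij; exact: down ij Sj.
  by rewrite card_le_II.
apply: contrapT => nSj.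
have : `I_n #<= `I_j.
  rewrite -(card_le_eql Sn); apply: subset_card_le => i /= Si.
  by rewrite ltnNge; apply/negP => /down /(_ Si).
by rewrite card_le_II leqNgt jn.
Qed.

Definition arrival_count (w : T) := [/\ forall j, 0 < Gam j w,
  {mono (fun j => Gam j w) : i j / (i <= j)%N >-> i <= j} &
  forall t j, 0 <= t -> (Gam j w <= t) = (j < N t w)%N].

Lemma ae_arrival_count : {ae P, forall w, arrival_count w}.
Proof.
apply: filterS hGam => w [G0 Ginc Gcard].
have mono : {mono (fun j => Gam j w) : i j / (i <= j)%N >-> i <= j}.
  exact/increasing_seqP.
have G0j j : 0 < Gam j w by rewrite (lt_le_trans G0)// mono.
split=> // t j t0.
have down i k : (i <= k)%N -> Gam k w <= t -> Gam i w <= t.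
  by move=> ik; apply: le_trans; rewrite mono.
have [h1 h2] := initial_segment_card down (Gcard t t0) j.
by apply/idP/idP.
Qed.

(** A copy of the event that [N t] equals [k] which involves [Gam] alone, as the independence
    hypothesis concerns [Gam]. *)
Definition count_event (t : R) (k : nat) : set T :=
  \bigcap_(j in `I_k) (Gam j @^-1` [set x | x <= t]) `&` (Gam k @^-1` [set x | t < x]).

Lemma count_eventP w t k : arrival_count w -> 0 <= t ->
  count_event t k w <-> N t w = k.
Proof.
move=> [_ _ GN] t0; split=> [[/= h1 h2]|<-].
  apply/eqP; rewrite eqn_leq; apply/andP; split.
    by rewrite leqNgt -GN// -ltNge.
  by case: k h1 h2 => // k h1 _; rewrite -GN//; exact: (h1 k (ltnSn k)).
split=> [j /= jN|/=]; first by rewrite GN.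
by rewrite ltNge GN// ltnn.
Qed.

Let GGam := \bigcup_j preimage_set_system setT (Gam j : T -> R) measurable.

Lemma count_event_generated t k :
  measurable (count_event t k : set (g_sigma_algebraType GGam)).
Proof.
have mGam j (Y : set R) : measurable Y ->
    measurable (Gam j @^-1` Y : set (g_sigma_algebraType GGam)).
  by move=> mY; rewrite -[X in measurable X]setTI; exact: sigma_generated_measurable.
apply: measurableI.
  apply: bigcap_measurableType => j _; apply: mGam.
  by rewrite (_ : [set x | x <= t] = `]-oo, t]%classic)// set_itvE.
by apply: mGam; rewrite (_ : [set x | t < x] = `]t, +oo[%classic)// set_itvE.
Qed.

Lemma generated_measurable (A : set T) :
  sigma_generated_by (fun j => Gam j : T -> R) A -> measurable A.
Proof.
apply: smallest_sub => //; first exact: sigma_algebra_measurable.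
by move=> _ [j _ [Y mY <-]]; rewrite setTI; exact: measurable_funPTI.
Qed.

Context (tt : nat -> R) (tt0 : tt 0%N = 0) (tt_le : forall i, tt i <= tt i.+1).

Let tt_ge0 i : 0 <= tt i.
Proof. by elim: i => [|i IHi]; rewrite ?tt0// (le_trans IHi). Qed.

Definition grid_count (j : nat) (w : T) : nat := (N (tt j.+1) w - N (tt j) w)%N.

Lemma measurable_grid_count i : measurable_fun setT (grid_count i).
Proof. exact: measurable_fun_subn. Qed.

Lemma grid_count_independent : mutually_independent P grid_count.
Proof. by apply: (upp_indep hN) => //; rewrite tt0. Qed.

Lemma N_tt0 w : arrival_count w -> N (tt 0%N) w = 0%N.
Proof.
move=> [G0 _ GN]; apply/eqP; rewrite -leqn0 leqNgt -GN tt0//.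
by rewrite -ltNge.
Qed.

Lemma N_tt_le w i : arrival_count w -> (N (tt i) w <= N (tt i.+1) w)%N.
Proof.
move=> [_ _ GN]; case E : (N (tt i) w) => [//|k].
by rewrite -GN// (le_trans _ (tt_le i))// GN// E.
Qed.

(** The counts in the first [m] cells equal [l] when [N] takes the partial sums of [l] at the grid
    points. *)
Definition counts_event m (l : seq nat) : set T :=
  if size l == m then \bigcap_(i in `I_m.+1) count_event (tt i) (sumn (take i l))
  else set0.

Lemma counts_eventP w m l : arrival_count w ->
  counts_event m l w <-> counts grid_count m w = l.
Proof.
move=> aw; rewrite /counts_event; case: ifPn => [/eqP lm|lm]; last first.
  by split=> // lE; move: lm; rewrite -lE size_mkseq eqxx.
split=> [h|<- i /= im].
  have S i : (i <= m)%N -> N (tt i) w = sumn (take i l).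
    by move=> im; apply/(count_eventP _ aw) => //; exact: h.
  apply: (@eq_from_nth _ 0%N); first by rewrite size_mkseq.
  move=> i; rewrite size_mkseq => im; rewrite nth_mkseq// /grid_count !S// 1?ltnW//.
  by rewrite (take_nth 0%N) ?lm// sumn_rcons addKn.
apply/(count_eventP _ aw) => //.
have -> : take i (counts grid_count m w) = mkseq (fun j => grid_count j w) i.
  apply: (@eq_from_nth _ 0%N); first by rewrite size_takel ?size_mkseq.
  move=> j; rewrite size_takel ?size_mkseq// => ji.
  by rewrite nth_take// !nth_mkseq// (leq_trans ji).
elim: i im => [|i IHi] im; first by rewrite N_tt0.
by rewrite mkseqS sumn_rcons -IHi ?(ltnW im)// /grid_count subnKC// N_tt_le.
Qed.

(** The counts differ from an event generated by [Gam] on a null set only, and null sets do not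
    affect probabilities. *)
Lemma counts_lincomb_independent m l s (B : set R) : measurable B ->
  P (counts grid_count m @^-1` [set l] `&` lincomb W s @^-1` B) =
  (P (counts grid_count m @^-1` [set l]) * P (lincomb W s @^-1` B))%E.
Proof.
move=> mB.
have mC : measurable (counts grid_count m @^-1` [set l]).
  exact: measurable_counts measurable_grid_count _ _.
have gE : sigma_generated_by (fun j => Gam j : T -> R) (counts_event m l).
  rewrite /counts_event; case: ifP => _.
    apply: (@bigcap_measurableType _ (g_sigma_algebraType GGam)) => i _.
    exact: count_event_generated.
  exact: (@measurable0 _ (g_sigma_algebraType GGam)).
have mE := generated_measurable gE.
have mL : measurable (lincomb W s @^-1` B).
  by rewrite -[X in measurable X]setTI; exact: measurable_lincomb.
have gL : sigma_generated_by (fun j => W j : T -> R) (lincomb W s @^-1` B).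
  pose GW := \bigcup_j preimage_set_system setT (W j : T -> R) measurable.
  have mW : measurable_fun (setT : set (g_sigma_algebraType GW)) (lincomb W s).
    apply: measurable_sum => j; apply: measurable_funM => //.
    exact: sigma_generated_measurable.
  by have := mW measurableT _ mB; rewrite setTI.
have -> : P (counts grid_count m @^-1` [set l]) = P (counts_event m l).
  apply: ae_eq_measure => //; apply: filterS ae_arrival_count => w aw /=.
  by apply: iff_sym; exact: counts_eventP.
have -> : P (counts grid_count m @^-1` [set l] `&` lincomb W s @^-1` B) =
    P (lincomb W s @^-1` B `&` counts_event m l).
  apply: ae_eq_measure; [exact: measurableI|exact: measurableI|].
  apply: filterS ae_arrival_count => w aw /=; split=> -[h1 h2]; split=> //.
    exact/counts_eventP.
  exact/(counts_eventP m l aw).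
by rewrite hWGam// muleC.
Qed.

End arrivals.

(** * Measurability of the sum over arrivals between c and D *)

Section jump_sum.
Context {R : realType} d {T : measurableType d} (P : probability T R).
Context (Gam W : nat -> {RV P >-> R}) (alpha c : R) (D : nat).

Definition jump_sum (w : T) : R :=
  \sum_(j \in [set j | c < Gam j w < D%:R]) (W j w * Gam j w `^ (- alpha^-1)).

Let term j w := W j w * (if c < Gam j w < D%:R then Gam j w `^ (- alpha^-1) else 0).

Let measurable_term j : measurable_fun setT (term j).
Proof.
apply: measurable_funM => //; apply: measurable_fun_ifT => //.
  by apply: measurable_and; exact: measurable_fun_ltr.
exact: measurableT_comp (measurable_powR _) _.
Qed.

Let jump_sum_term w : jump_sum w = \sum_(j \in setT) term j w.
Proof.
rewrite /jump_sum fsbig_mkcond; apply: eq_fsbigr => j _.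
rewrite /term; case: ifPn => h; first by rewrite patchT ?inE.
by rewrite patchN ?mulr0// notin_setE/=; exact/negP.
Qed.

Let finite_support n : set T := \bigcap_(j in [set j | (n <= j)%N]) (term j @^-1` [set 0]).

Let jump_sum_big w n : finite_support n w -> jump_sum w = \sum_(j < n) term j w.
Proof.
move=> h; rewrite jump_sum_term -(@fsbig_widen _ _ _ _ `I_n).
- by rewrite -fsbig_ord.
- by [].
- by move=> j [_ /= /negP]; rewrite -leqNgt => /h.
Qed.

Let jump_sum_dflt w : ~ (\bigcup_n finite_support n) w -> jump_sum w = 0.
Proof.
move=> nF; rewrite jump_sum_term fsbig_dflt// => /finite_seqP[s sE]; apply: nF.
exists (\max_(i <- s) i).+1 => // j /= js; apply/eqP/negPn/negP => jn.
have : [set` s] j by rewrite -sE; split=> //=; apply/eqP.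
by rewrite /= => /(@leq_bigmax_seq _ _ xpredT id) /(_ isT); rewrite leqNgt js.
Qed.

Lemma jump_sum_widen w n : (forall j, (n <= j)%N -> ~~ (c < Gam j w < D%:R)) ->
  jump_sum w = \sum_(j < n) W j w * (if c < Gam j w < D%:R then Gam j w `^ (- alpha^-1) else 0).
Proof.
move=> h; rewrite (@jump_sum_big _ n)// => j /= /h /negbTE.
by rewrite /term => ->; rewrite mulr0.
Qed.

(** A sum over a set is 0 by convention when infinitely many terms are nonzero. The indicator of
    finite support reproduces this value, so partial sums converge at every point. *)
Lemma measurable_jump_sum : measurable_fun setT jump_sum.
Proof.
have mF n : measurable (finite_support n).
  apply: bigcap_measurableType => j _.
  by rewrite -[X in measurable X]setTI; exact: measurable_term.
have mFin : measurable (\bigcup_n finite_support n) by exact: bigcupT_measurable.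
apply: (@measurable_fun_cvg _ _ _ setT (fun n w => \1_(\bigcup_n finite_support n) w * \sum_(j < n) term j w)).
- move=> n; apply: measurable_funM; first exact: measurable_indic.
  exact: measurable_sum.
move=> w _; rewrite indicE; have [Fw|Fw] := pselect ((\bigcup_n finite_support n) w).
  have [n _ Fnw] := Fw; rewrite mem_set//.
  apply: cvg_near_cst; near=> m; rewrite mul1r -jump_sum_big//.
  move=> j /= mj; apply: Fnw => /=; apply: leq_trans mj.
  by near: m; exact: nbhs_infty_ge.
rewrite memNset// (jump_sum_dflt Fw); under eq_fun do rewrite mul0r.
exact: cvg_cst.
Unshelve. all: by end_near. Qed.

End jump_sum.

(** * Refining the cells of (c, D) *)

Section grid.
Context {R : realType}.
Context (alpha c D sigma : R) (c0 : 0 < c) (cD : c < D).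

Definition cell n : R := (D - c) / n.+1%:R.

(* The cell [0, c] comes first, followed by [n] of the [n.+1] cells of [c, D]; the
   last cell is dropped because jumps at [D] do not count. *)
Definition grid n i : R := if i is j.+1 then c + j%:R * cell n else 0.

Definition grid_coef n i : R := if i is j.+1 then (c + j%:R * cell n) `^ (- alpha^-1) / sigma else 0.

Lemma cell_gt0 n : 0 < cell n.
Proof. by rewrite divr_gt0// subr_gt0. Qed.

Lemma grid_le n i : grid n i <= grid n i.+1.
Proof.
have d0 := ltW (cell_gt0 n); case: i => [|i] /=; first by rewrite mul0r addr0 ltW.
by rewrite lerD2l ler_wpM2r// ler_nat.
Qed.

Lemma grid_last n : grid n n.+1 = D - cell n.
Proof.
rewrite /= /cell -natr1; field.
by rewrite natr1 pnatr_eq0.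
Qed.

Lemma cvg_cell : cell n @[n --> \oo] --> 0.
Proof.
by rewrite -[X in _ --> X](mulr0 (D - c)); apply: cvgZr; exact: cvg_harmonic.
Qed.

End grid.

Section jump_sum_limit.
Context {R : realType} d {T : measurableType d} (P : probability T R).
Context (N : R -> {RV P >-> nat}) (Gam W : nat -> {RV P >-> R}).
Context (alpha c sigma : R) (D : nat) (c0 : 0 < c) (cD : c < D%:R).

Let K n := grid_count N (grid c D%:R n).
Let a := grid_coef alpha c D%:R sigma.
Let phi (x : R) := if c < x < D%:R then x `^ (- alpha^-1) / sigma else 0.

Let coefs_at n w p := (coefs (a n) (counts (K n) n.+1 w))`_p.

Let coefsE n w : coefs (a n) (counts (K n) n.+1 w) =
  flatten (mkseq (fun j => nseq (N (grid c D%:R n j.+1) w - N (grid c D%:R n j) w) (a n j)) n.+1).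
Proof. by rewrite coefs_counts. Qed.

(** An interior arrival has the weight of the left end of its cell, which approaches the arrival;
    the power is continuous there. *)
Lemma cvg_coefs w p : arrival_count N Gam w -> coefs_at n w p @[n --> \oo] --> phi (Gam p w).
Proof.
move=> aw; have [G0 _ GN] := aw.
have g_le n i : grid c D%:R n i <= grid c D%:R n i.+1 by exact: grid_le.
have S0 n : N (grid c D%:R n 0) w = 0%N by apply: (N_tt0 (tt := grid c D%:R n)) aw.
have Sle n i : (N (grid c D%:R n i) w <= N (grid c D%:R n i.+1) w)%N.
  by have := @N_tt_le _ _ _ _ N Gam (grid c D%:R n) erefl (g_le n) w i aw.
have g_ge0 n i : 0 <= grid c D%:R n i.
  by elim: i => // i IHi; exact: le_trans (g_le n i).
rewrite /phi; have [Gc|cG] := leP (Gam p w) c.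
  apply: cvg_near_cst; near=> n; rewrite /coefs_at coefsE.
  have -> := @nth_coefs _ (a n) (fun i => N (grid c D%:R n i) w) (S0 n) (Sle n) n.+1 0 p.
  - by [].
  - by [].
  - by rewrite S0 -GN/= ?mul0r ?addr0// ltW.
have [DG|GD] := leP D%:R (Gam p w).
  (* The grid stops before [D], so such an arrival has no entry in the list and [nth] returns 0. *)
  rewrite andbF; apply: cvg_near_cst; near=> n; rewrite /coefs_at coefsE nth_default//.
  rewrite (@size_coefs _ (a n) (fun i => N (grid c D%:R n i) w) (S0 n) (Sle n)).
  rewrite leqNgt -GN// -ltNge grid_last; apply: lt_le_trans DG.
  by rewrite ltrBlDr ltrDl cell_gt0.
apply/cvgrPdist_le => e e0 /=.
have /cvgrPdist_le/(_ _ e0) : {for Gam p w, continuous (fun x => x `^ (- alpha^-1) / sigma)}.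
  by apply: cvgM; [exact: powR_continuous_at|exact: cvg_cst].
move=> /nbhs_ballP[r /= r0 Hr].
near=> n; rewrite /coefs_at coefsE.
have cr : cell c D%:R n < r.
  near: n; have /cvgrPdist_lt/(_ _ r0) := @cvg_cell R c D%:R.
  apply: filterS => n; rewrite sub0r normrN; exact: le_lt_trans (ler_norm _).
have GDn : Gam p w <= grid c D%:R n n.+1.
  rewrite grid_last lerBrDr -lerBrDl; near: n.
  have GD0 : 0 < D%:R - Gam p w by rewrite subr_gt0.
  have /cvgrPdist_le/(_ _ GD0) := @cvg_cell R c D%:R.
  apply: filterS => n; rewrite sub0r normrN; exact: le_trans (ler_norm _).
(* The least such [i] is the cell of the arrival: by minimality its left end lies strictly before
   it. *)
have ex : exists i, Gam p w <= grid c D%:R n i.+1 by exists n.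
have [i Gi imin] := ex_minnP ex.
have i_le : (i <= n)%N by exact: imin.
have iG : grid c D%:R n i < Gam p w.
  case: i Gi imin {i_le} => [|i] Gi imin; first exact: G0.
  by rewrite ltNge; apply/negP => /imin; rewrite ltnn.
have -> := @nth_coefs _ (a n) (fun i => N (grid c D%:R n i) w) (S0 n) (Sle n) n.+1 i p.
- case: i Gi iG {imin i_le} => [|i] /= Gi iG.
    by move: Gi; rewrite mul0r addr0 leNgt cG.
  apply: Hr; rewrite /ball/= gtr0_norm ?subr_gt0//.
  apply: le_lt_trans cr; move: Gi; rewrite -natr1; lra.
- by [].
- by rewrite -GN// Gi andbT leqNgt -GN// -ltNge.
Unshelve. all: by end_near. Qed.

(** For every mesh the list is no longer than the number of arrivals up to [D], so the limit is
    taken in a sum of fixed length. *)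
Lemma cvg_lincomb w : arrival_count N Gam w ->
  lincomb W (coefs (a n) (counts (K n) n.+1 w)) w @[n --> \oo] -->
  jump_sum Gam W alpha c D w / sigma.
Proof.
move=> aw; have [G0 _ GN] := aw.
pose J := N D%:R w.
have -> : jump_sum Gam W alpha c D w / sigma = \sum_(p < J) phi (Gam p w) * W p w.
  rewrite (@jump_sum_widen _ _ _ _ _ _ _ _ _ _ J).
    rewrite mulr_suml; apply: eq_bigr => p _.
    by rewrite /phi; case: ifP; rewrite ?mulr0 ?mul0r//; lra.
  move=> j Jj; rewrite negb_and -[X in _ || X]leNgt orbC ltW// ltNge GN//.
  by rewrite -leqNgt.
rewrite (_ : (fun n => _) = (fun n => \sum_(p < J) coefs_at n w p * W p w)).
  by apply: cvg_big => [|p _]; [exact: add_continuous|apply: cvgM; [exact: cvg_coefs|exact: cvg_cst]].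
apply/funext => n; rewrite /lincomb /coefs_at.
set s := coefs _ _; have sJ : (size s <= J)%N.
  rewrite /s coefsE (@size_coefs _ (a n) (fun i => N (grid c D%:R n i) w)).
  - case E : (N (grid c D%:R n n.+1) w) => [//|k]; rewrite /J -GN//.
    have gle : grid c D%:R n n.+1 <= D%:R.
      by rewrite grid_last gerBl ltW// cell_gt0.
    apply: le_trans gle; rewrite GN ?E//.
    by apply: addr_ge0; [exact: ltW|apply: mulr_ge0 => //; exact: ltW (cell_gt0 cD n)].
  - by apply: (N_tt0 (tt := grid c D%:R n)) aw.
  - move=> i; have := @N_tt_le _ _ _ _ N Gam (grid c D%:R n) erefl _ w i aw.
    by apply => j; exact: grid_le.
rewrite -(big_mkord xpredT (fun j => s`_j * W j w)).
rewrite -(big_mkord xpredT (fun j => s`_j * W j w)).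
rewrite (@big_cat_nat _ _ _ (size s) 0 J)//= [X in _ = _ + X]big_nat_cond.
rewrite [X in _ = _ + X]big1 ?addr0// => j /andP[/andP[sj _] _].
by rewrite nth_default// mul0r.
Qed.

End jump_sum_limit.

Section riemann.
Context {R : realType} (c D : R) (c0 : 0 < c) (cD : c < D).

Lemma cvg_riemann_powRN (p : R) : 0 <= p -> p != 1 ->
  \sum_(0 <= j < n) (c + j%:R * cell c D n) `^ (- p) * cell c D n @[n --> \oo] -->
  power_primitive p D - power_primitive p c.
Proof.
move=> p0 p1.
have cD' : D - cell c D n @[n --> \oo] --> D.
  by rewrite -[X in _ --> X]subr0; apply: cvgB; [exact: cvg_cst|exact: cvg_cell].
have cF : power_primitive p (D - cell c D n) - power_primitive p c @[n --> \oo] -->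
    power_primitive p D - power_primitive p c.
  apply: cvgB; last exact: cvg_cst.
  by apply: continuous_cvg => //; apply: power_primitive_continuous_at; exact: lt_trans cD.
apply: (squeeze_cvgr _ cF (h := fun n => power_primitive p (D - cell c D n) -
  power_primitive p c + c `^ (- p) * cell c D n)); last first.
  rewrite -[X in _ --> X]addr0; apply: cvgD => //.
  by rewrite -[X in _ --> X](mulr0 (c `^ (- p))); apply: cvgZr; exact: cvg_cell.
near=> n; have := power_sum_bounds n p0 p1 c0 (ltW (cell_gt0 cD n)).
by have := grid_last c D n; rewrite /= => ->.
Unshelve. all: by end_near. Qed.

End riemann.

(** * Gaussian comparison at fixed c and D *)

Section residual_bound.
Context {R : realType} d {T : measurableType d} (P : probability T R).
Context (N : R -> {RV P >-> nat}) (Gam W : nat -> {RV P >-> R}).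
Context (hN : unit_rate_poisson_process N) (hGam : arrival_times N Gam).
Context (iidW : iid W) (hWGam : independent_sequences P W Gam).
Context (W2 : P.-integrable setT (EFin \o (fun w => W 0%N w ^+ 2))).
Context (alpha c sigma : R) (D : nat).
Context (alpha02 : 0 < alpha < 2) (alpha1 : alpha != 1).
Context (c0 : 0 < c) (cD : c < D%:R) (sigma0 : 0 < sigma).
Context (C : R) (h h1 h2 : R -> R) (Th : taylor3 C h h1 h2).
Context (mh1 : measurable_fun setT h1) (mh2 : measurable_fun setT h2).
Local Notation gauss := (normal_prob (0 : R) 1).

Let mu := \int[P]_w W 0%N w.
Let kappa := \int[P]_w (W 0%N w ^+ 2).
Let a := grid_coef alpha c D%:R sigma.
Let dt := cell c D%:R.
Let K n := grid_count N (grid c D%:R n).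
Let A := c `^ (- alpha^-1) / sigma.

Let alpha0 : 0 < alpha. Proof. by case/andP: alpha02. Qed.

Let a_ge0 n j : 0 <= a n j.
Proof. by case: j => //= j; rewrite divr_ge0 ?powR_ge0// ltW. Qed.

Let aA n j : a n j <= A.
Proof.
case: j => [|j] /=; first by rewrite divr_ge0 ?powR_ge0// ltW.
rewrite ler_pM2r ?invr_gt0//; apply: le_powRN => //; first by rewrite invr_ge0 ltW.
by rewrite lerDl mulr_ge0// ltW// cell_gt0.
Qed.

Let KP n j k : P (K n j.+1 @^-1` [set k]) = (poisson_pmf (dt n) k)%:E.
Proof.
have d0 : 0 < dt n by exact: cell_gt0.
have dE : dt n = grid c D%:R n j.+2 - grid c D%:R n j.+1.
  by rewrite /= -natr1 /dt; ring.
rewrite dE -(upp_poisson hN)//.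
  by rewrite /= addr_ge0 ?(ltW c0)// mulr_ge0// ltW.
by rewrite -subr_gt0 -dE.
Qed.

Let drift n := \sum_(0 <= j < n) a n j.+1 * mu * dt n.
Let sqsum n := \sum_(0 <= j < n) a n j.+1 ^+ 2 * dt n.
Let u := (power_primitive (2 / alpha) D%:R - power_primitive (2 / alpha) c) / sigma ^+ 2.
Let b := mu / sigma * (power_primitive alpha^-1 D%:R - power_primitive alpha^-1 c).

Let cvg_drift : drift n @[n --> \oo] --> b.
Proof.
have p0 : 0 <= alpha^-1 by rewrite invr_ge0 ltW.
have p1 : alpha^-1 != 1 by rewrite invr_eq1.
rewrite (_ : drift = fun n => mu / sigma *
  \sum_(0 <= j < n) (c + j%:R * dt n) `^ (- alpha^-1) * dt n).
  by apply: cvgZr; exact: cvg_riemann_powRN.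
by apply/funext => n; rewrite mulr_sumr; apply: eq_bigr => j _ /=; rewrite -/(dt n); ring.
Qed.

Let cvg_sqsum : sqsum n @[n --> \oo] --> u.
Proof.
have p0 : 0 <= 2 / alpha by rewrite divr_ge0// ltW.
have p1 : 2 / alpha != 1.
  case/andP: alpha02 => _ a2; rewrite gt_eqF// ltr_pdivlMr// mul1r//.
rewrite (_ : sqsum = fun n => (sigma ^+ 2)^-1 *
  \sum_(0 <= j < n) (c + j%:R * dt n) `^ (- (2 / alpha)) * dt n).
  have -> : u = (sigma ^+ 2)^-1 * (power_primitive (2 / alpha) D%:R -
    power_primitive (2 / alpha) c) by exact: mulrC.
  by apply: cvgZr; exact: cvg_riemann_powRN.
apply/funext => n; rewrite mulr_sumr; apply: eq_bigr => j _ /=; rewrite -/(dt n).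
have -> : (c + j%:R * dt n) `^ (- (2 / alpha)) = ((c + j%:R * dt n) `^ (- alpha^-1)) ^+ 2.
  rewrite -powR_mulrn ?powR_ge0// -powRrM; congr (_ `^ _); ring.
by rewrite expr_div_n; ring.
Qed.

(** [b] and [kappa * u] are the limits of the drift and of the variance as the mesh is refined.
    Bounded convergence handles both expectations, and the inequality survives in the limit. *)
Lemma residual_bound :
  `|\int[P]_w h (jump_sum Gam W alpha c D w / sigma - b) -
    \int[gauss]_z h (Num.sqrt (kappa * u) * z)| <= 7 * C * tail2 P (W 0%N) A * u.
Proof.
have mh := taylor3_measurable Th.
have [hC _] := Th.
pose X n w := lincomb W (coefs (a n) (counts (K n) n.+1 w)) w.
have mX n : measurable_fun setT (X n).
  apply: (@measurable_fun_discrete _ _ _ _ (measurable_counts (measurable_grid_count N _) n.+1) _ _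
    (fun l w => lincomb W (coefs (a n) l) w)) => l; exact: measurable_lincomb.
have c1 : \int[P]_w h (X n w - drift n) @[n --> \oo] -->
    \int[P]_w h (jump_sum Gam W alpha c D w / sigma - b).
  apply: (@bounded_cvg_Rintegral _ _ _ P _ _ C).
  - by move=> n; apply: measurableT_comp => //; exact: measurable_funB.
  - apply: measurableT_comp => //; apply: measurable_funB => //.
    by apply: measurable_funM => //; exact: measurable_jump_sum.
  - by move=> n w; exact: hC.
  apply: filterS (ae_arrival_count hGam) => w aw.
  apply: continuous_cvg; first exact: (taylor3_continuous Th).
  by apply: cvgB; [exact: cvg_lincomb|exact: cvg_drift].
pose V n := \sum_(0 <= j < n) kappa * a n j.+1 ^+ 2 * dt n.
have cV : V n @[n --> \oo] --> kappa * u.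
  rewrite (_ : V = fun n => kappa * sqsum n); first by apply: cvgZr; exact: cvg_sqsum.
  by apply/funext => n; rewrite /V /sqsum mulr_sumr; apply: eq_bigr => j _; ring.
have c2 : \int[gauss]_z h (Num.sqrt (V n) * z) @[n --> \oo] -->
    \int[gauss]_z h (Num.sqrt (kappa * u) * z).
  apply: (@bounded_cvg_Rintegral _ _ _ gauss _ _ C).
  - by move=> n; apply: measurableT_comp => //; exact: measurable_funM.
  - by apply: measurableT_comp => //; exact: measurable_funM.
  - by move=> n w; exact: hC.
  apply: aeW => z; apply: continuous_cvg; first exact: (taylor3_continuous Th).
  by apply: cvgM; [apply: continuous_cvg => //; exact: sqrt_continuous|exact: cvg_cst].
pose st := step_cst P (W 0%N) A.
pose E n := n%:R * (3 * C * dt n ^+ 2 + C * st * (dt n * Num.sqrt (dt n))).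
have ndt n : n%:R * dt n = D%:R - c - dt n.
  by have := grid_last c D%:R n; rewrite /= -/(dt n); lra.
have cdt : dt n @[n --> \oo] --> 0 by exact: cvg_cell.
have c3 : E n @[n --> \oo] --> 0.
  (* One factor dt pays for the [n] cells; dt and sqrt(dt) are left over. *)
  rewrite (_ : E = fun n => (D%:R - c - dt n) * (3 * C * dt n + C * st * Num.sqrt (dt n))).
    rewrite -[X in _ --> X](mulr0 (D%:R - c - 0)).
    apply: cvgM; first by apply: cvgB => //; exact: cvg_cst.
    rewrite -[X in _ --> X]addr0 -[X in _ --> X + _](mulr0 (3 * C)).
    rewrite -[X in _ --> _ + X](mulr0 (C * st)).
    apply: cvgD; first exact: cvgZr.
    apply: cvgZr; rewrite -[X in _ --> X]sqrtr0.
    by apply: continuous_cvg => //; exact: sqrt_continuous.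
  by apply/funext => n; rewrite -ndt /E; ring.
have c4 : 7 * C * tail2 P (W 0%N) A * sqsum n + E n @[n --> \oo] -->
    7 * C * tail2 P (W 0%N) A * u.
  by rewrite -[X in _ --> X]addr0; apply: cvgD => //; apply: cvgZr; exact: cvg_sqsum.
apply: (ler_cvg_to _ c4); first by apply: cvg_norm; exact: (cvgB c1 c2).
near=> n.
have dt1 : dt n <= 1.
  near: n; have /cvgrPdist_le/(_ _ ltr01) := cdt.
  apply: filterS => n; rewrite sub0r normrN; exact: le_trans (ler_norm _).
apply: (@lindeberg_bound _ _ _ P W iidW W2 (K n) _ _ (a n) A (dt n) n _ (a_ge0 n) (aA n) _ dt1
  _ C h h1 h2 Th mh1 mh2).
- exact: measurable_grid_count.
- by apply: (grid_count_independent hN) => // i; exact: grid_le.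
- by [].
- exact: cell_gt0.
- by move=> j k _; exact: KP.
- by move=> l s B mB; apply: (counts_lincomb_independent hGam hWGam) => // i; exact: grid_le.
Unshelve. all: by end_near. Qed.

End residual_bound.

(** * The centering constants *)

Section centering.
Context {R : realType} (alpha : R) (alpha02 : 0 < alpha < 2) (alpha1 : alpha != 1).

Lemma sum_centering D : 1 < alpha ->
  \sum_(1 <= j < D.+1) centering alpha j = power_primitive alpha^-1 D%:R.
Proof.
move=> a1; have a0 : 0 < alpha by lra.
have am1 : alpha - 1 != 0 by rewrite subr_eq0.
have e0 : (alpha - 1) / alpha != 0 by rewrite mulf_neq0 ?invr_neq0// gt_eqF.
have cE j : centering alpha j.+1 = alpha / (alpha - 1) *
    (j.+1%:R `^ ((alpha - 1) / alpha) - j%:R `^ ((alpha - 1) / alpha)).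
  by rewrite /centering a1 -{2}natr1 addrK.
rewrite big_add1/=; under eq_bigr do rewrite cE.
rewrite -mulr_sumr telescope_sumr// powR0// subr0 /power_primitive.
have -> : 1 - alpha^-1 = (alpha - 1) / alpha by field; rewrite gt_eqF.
by field; rewrite am1 gt_eqF.
Qed.

(** For alpha > 1 the centering telescopes to the primitive and the difference is 0. For alpha < 1
    the centering is 0 and the primitive vanishes at infinity. *)
Lemma cvg_centering :
  power_primitive alpha^-1 D%:R - \sum_(1 <= j < D.+1) centering alpha j @[D --> \oo] --> 0.
Proof.
have /andP[a0 _] := alpha02; have [a1|a1] := ltP 1 alpha.
  by under eq_fun do rewrite sum_centering// subrr; exact: cvg_cst.
have aV : 1 < alpha^-1 by rewrite invf_gt1// lt_neqAle alpha1.
rewrite (_ : (fun D => _) = (fun D : nat => power_primitive alpha^-1 D%:R)); last first.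
  apply/funext => D; rewrite big1 ?subr0// => j _.
  by rewrite /centering ltNge a1.
rewrite -[X in _ --> X](mul0r (1 - alpha^-1)^-1).
apply: cvgMl; have := @cvg_powRN R (alpha^-1 - 1).
by rewrite opprB subr_gt0; exact.
Qed.

End centering.

(** * Letting D, and then c, go to infinity *)

Section residual_normal.
Context {R : realType} d {T : measurableType d} (P : probability T R).
Context (alpha : R) (N : R -> {RV P >-> nat}) (Gam W : nat -> {RV P >-> R}).
Context (alpha02 : 0 < alpha < 2) (alpha1 : alpha != 1).
Context (hN : unit_rate_poisson_process N) (hGam : arrival_times N Gam).
Context (iidW : iid W) (hWGam : independent_sequences P W Gam).
Context (hW2 : (0 < 'E_P[fun w => (W 0%N w ^+ 2)%R] < +oo)%E).
Local Notation gauss := (normal_prob (0 : R) 1).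

Let mu := \int[P]_w W 0%N w.
Let kappa := \int[P]_w (W 0%N w ^+ 2).

Lemma square_integrable : P.-integrable setT (EFin \o (fun w => W 0%N w ^+ 2)).
Proof.
apply/integrableP; split; first exact/measurable_EFinP/measurable_funX.
case/andP: hW2 => _; rewrite unlock; apply: le_lt_trans.
apply: ge0_le_integral => //=.
- by apply/measurable_EFinP; apply: measurableT_comp => //; exact: measurable_funX.
- by apply/measurable_EFinP; exact: measurable_funX.
- by move=> w _; rewrite lee_fin ger0_norm// sqr_ge0.
Qed.

Let kappa_gt0 : 0 < kappa.
Proof. by rewrite /kappa /Rintegral fine_gt0//; move: hW2; rewrite unlock. Qed.

(** As 2 / alpha > 1, minus the primitive at [c] is the integral of x^(-2 / alpha) beyond [c]. *)
Lemma residual_varE (c : R) :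
  residual_var alpha W c = - (kappa * power_primitive (2 / alpha) c).
Proof.
case/andP: alpha02 => a0 a2; rewrite /residual_var [in LHS]unlock -/(Rintegral _ _ _) -/kappa.
have a2' : 2 - alpha != 0 by rewrite subr_eq0 gt_eqF.
rewrite /power_primitive; have -> : 1 - 2 / alpha = (alpha - 2) / alpha.
  by field; rewrite gt_eqF.
by field; rewrite a2' -opprB oppr_eq0 a2' gt_eqF.
Qed.

Lemma residual_meanE (c : R) :
  residual_mean alpha W c = - (mu * power_primitive alpha^-1 c).
Proof.
case/andP: alpha02 => a0 a2; rewrite /residual_mean [in LHS]unlock -/(Rintegral _ _ _) -/mu.
have a1' : 1 - alpha != 0 by rewrite subr_eq0 eq_sym.
rewrite /power_primitive; have -> : 1 - alpha^-1 = (alpha - 1) / alpha.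
  by field; rewrite gt_eqF.
by field; rewrite a1' -opprB oppr_eq0 a1' gt_eqF.
Qed.

Lemma residual_var_gt0 (c : R) : 0 < c -> 0 < residual_var alpha W c.
Proof.
move=> c0; case/andP: alpha02 => a0 a2; rewrite /residual_var unlock.
by rewrite mulr_gt0 ?powR_gt0// mulr_gt0//; rewrite divr_gt0 ?subr_gt0.
Qed.

(** The subtracted term is the drift of [residual_bound]; the last one is the centering error, which
    vanishes as [D] grows. *)
Lemma residualE (c S : R) D w : S != 0 ->
  (residual alpha W Gam c D w - residual_mean alpha W c) / S =
  jump_sum Gam W alpha c D w / S -
  mu / S * (power_primitive alpha^-1 D%:R - power_primitive alpha^-1 c) +
  mu / S * (power_primitive alpha^-1 D%:R - \sum_(1 <= j < D.+1) centering alpha j).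
Proof.
move=> S0; rewrite residual_meanE /residual -/(jump_sum _ _ _ _ _ _).
by rewrite unlock -/(Rintegral _ _ _) -/mu; ring.
Qed.

Lemma measurable_residual (c : R) D : measurable_fun setT (residual alpha W Gam c D).
Proof. by apply: measurable_funB => //; exact: measurable_jump_sum. Qed.

Section test_function.
Context (C : R) (h h1 h2 : R -> R) (Th : taylor3 C h h1 h2).
Context (mh1 : measurable_fun setT h1) (mh2 : measurable_fun setT h2).

Let mh := taylor3_measurable Th.
Let hC : forall x, `|h x| <= C. Proof. by case: Th. Qed.

Let S (c : R) := Num.sqrt (residual_var alpha W c).

Let S_gt0 (c : R) : 0 < c -> 0 < S c.
Proof. by move=> c0; rewrite sqrtr_gt0 residual_var_gt0. Qed.

(** The variance [kappa * u D] tends to 1 by the choice of [S c], and the centering error is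
    absorbed by the Lipschitz constant 6C. *)
Lemma residual_normal_bound (c : R) (l : R) : 0 < c ->
  \int[P]_w h ((residual alpha W Gam c D w - residual_mean alpha W c) / S c) @[D --> \oo] --> l ->
  `|l - \int[gauss]_z h z| <= 7 * C * tail2 P (W 0%N) (c `^ (- alpha^-1) / S c) / kappa.
Proof.
move=> c0 cl; have Sc := S_gt0 c0; have /andP[a0 a2] := alpha02.
pose u (D : nat) := (power_primitive (2 / alpha) D%:R - power_primitive (2 / alpha) c) / S c ^+ 2.
pose eps (D : nat) := mu / S c * (power_primitive alpha^-1 D%:R - \sum_(1 <= j < D.+1) centering alpha j).
have ceps : eps D @[D --> \oo] --> 0.
  by rewrite -[X in _ --> X](mulr0 (mu / S c)); apply: cvgZr; exact: cvg_centering.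
have cu : u D @[D --> \oo] --> kappa^-1.
  have -> : kappa^-1 = (0 - power_primitive (2 / alpha) c) / S c ^+ 2.
    rewrite sqr_sqrtr ?ltW ?residual_var_gt0// residual_varE.
    have nz : power_primitive (2 / alpha) c != 0.
      have := residual_var_gt0 c0; rewrite residual_varE => /lt0r_neq0.
      by rewrite oppr_eq0 mulf_eq0 negb_or => /andP[].
    by field; rewrite nz gt_eqF.
  apply: cvgM; last exact: cvg_cst.
  apply: cvgB; last exact: cvg_cst.
  rewrite -[X in _ --> X](mul0r (1 - 2 / alpha)^-1).
  apply: cvgMl; have := @cvg_powRN R (2 / alpha - 1).
  by rewrite opprB subr_gt0 ltr_pdivlMr// mul1r; exact.
have cg : \int[gauss]_z h (Num.sqrt (kappa * u D) * z) @[D --> \oo] --> \int[gauss]_z h z.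
  apply: (@bounded_cvg_Rintegral _ _ _ gauss _ _ C).
  - by move=> n; apply: measurableT_comp => //; exact: measurable_funM.
  - exact: mh.
  - by move=> n w; exact: hC.
  apply: aeW => z; apply: continuous_cvg; first exact: (taylor3_continuous Th).
  rewrite -[X in _ --> X]mul1r; apply: cvgM; last exact: cvg_cst.
  rewrite -sqrtr1 -(mulfV (lt0r_neq0 kappa_gt0)).
  by apply: continuous_cvg; [exact: sqrt_continuous|exact: cvgZr].
pose B := 7 * C * tail2 P (W 0%N) (c `^ (- alpha^-1) / S c).
have cB : B * u D + 6 * C * `|eps D| @[D --> \oo] --> B / kappa.
  rewrite -[X in _ --> X]addr0; apply: cvgD; first exact: cvgZr.
  rewrite -[X in _ --> X](mulr0 (6 * C)); apply: cvgZr.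
  by rewrite -[X in _ --> X](@normr0 _ R); exact: cvg_norm.
apply: (ler_cvg_to _ cB); first by apply: cvg_norm; exact: (cvgB cl cg).
near=> D.
have cD : c < D%:R by near: D; exact: nbhs_infty_gtr.
have bnd := residual_bound hN hGam iidW hWGam square_integrable alpha02 alpha1 c0 cD Sc Th mh1 mh2.
have mJ := measurable_jump_sum Gam W alpha c D.
have dif : `|\int[P]_w h ((residual alpha W Gam c D w - residual_mean alpha W c) / S c) -
    \int[P]_w h (jump_sum Gam W alpha c D w / S c -
      mu / S c * (power_primitive alpha^-1 D%:R - power_primitive alpha^-1 c))| <=
    6 * C * `|eps D|.
  apply: le_norm_RintegralB_cst.
  - apply: (bounded_integrable _ (M := C)) => [|w]; last exact: hC.
    apply: measurableT_comp => //; apply: measurable_funM => //; apply: measurable_funB => //.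
    exact: measurable_residual.
  - apply: (bounded_integrable _ (M := C)) => [|w]; last exact: hC.
    apply: measurableT_comp => //; apply: measurable_funB => //; exact: measurable_funM.
  - move=> w; apply: le_trans (taylor3_lip Th _ _) _.
    by rewrite residualE ?gt_eqF// addrC addKr.
rewrite [leRHS]addrC; exact: (le_trans (ler_distD _ _ _) (lerD dif bnd)).
Unshelve. all: by end_near. Qed.

Lemma residual_coef_sqr (c : R) : 0 < c ->
  (c `^ (- alpha^-1) / S c) ^+ 2 = (2 - alpha) / (kappa * alpha) / c.
Proof.
move=> c0; have /andP[a0 a2] := alpha02.
have a2' : 2 - alpha != 0 by rewrite subr_eq0 gt_eqF.
rewrite expr_div_n sqr_sqrtr ?ltW ?residual_var_gt0// /residual_var unlock -/(Rintegral _ _ _) -/kappa.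
have -> : c `^ ((alpha - 2) / alpha) = c * (c `^ (- alpha^-1)) ^+ 2.
  have -> : (alpha - 2) / alpha = 1 + - alpha^-1 * 2 by field; rewrite gt_eqF.
  rewrite powRD ?(gt_eqF c0) ?implybT// powRr1 ?(ltW c0)// powRrM.
  by rewrite powR_mulrn ?powR_ge0.
have := powR_gt0 (- alpha^-1) c0; move: (c `^ _) => x x0.
by field; rewrite a2' !gt_eqF.
Qed.

Lemma residual_normal_small (e : R) : 0 < e -> \forall c \near +oo,
  7 * C * tail2 P (W 0%N) (c `^ (- alpha^-1) / S c) / kappa <= e.
Proof.
move=> e0; have /andP[a0 a2] := alpha02.
have C0 : 0 <= C by exact: le_trans (normr_ge0 _) (hC 0).
(* The added 1 keeps the denominator positive when [C] is 0. *)
have e'0 : 0 < e * kappa / (7 * C + 1) by rewrite divr_gt0 ?mulr_gt0//; lra.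
have mW : measurable_fun setT (W 0%N) by [].
have [t t0 tB] := tail2_small mW square_integrable e'0.
(* By [residual_coef_sqr] this is the value of [c] at which the largest weight equals [t]. *)
pose X : R := (2 - alpha) / (kappa * alpha) / t ^+ 2.
near=> c.
have c0 : 0 < c by near: c; exact: nbhs_pinfty_gt.
have cX : X <= c by near: c; apply: nbhs_pinfty_ge; exact: num_real.
have ct : c `^ (- alpha^-1) / S c <= t.
  rewrite -(@ler_pXn2r _ 2)// ?nnegrE ?(ltW t0) ?divr_ge0 ?powR_ge0 ?sqrtr_ge0//.
  rewrite residual_coef_sqr// ler_pdivrMr// [leRHS]mulrC -ler_pdivrMr ?exprn_gt0//.
rewrite ler_pdivrMr//; have A0 : 0 <= c `^ (- alpha^-1) / S c.
  by rewrite divr_ge0 ?powR_ge0 ?sqrtr_ge0.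
have := le_trans (le_tail2 mW square_integrable A0 ct) tB.
rewrite ler_pdivlMr; last lra.
have := tail2_ge0 P (W 0%N) (c `^ (- alpha^-1) / S c).
set x := tail2 _ _ _ => x0; have := mulr_ge0 C0 x0; nra.
Unshelve. all: by end_near. Qed.

End test_function.

End residual_normal.

Theorem theorem1 (R : realType) (d d' d'' : measure_display)
    (T : measurableType d) (T' : measurableType d') (T'' : measurableType d'')
    (P : probability T R) (P' : probability T' R) (P'' : probability T'' R)
    (alpha : R) (N : R -> {RV P >-> nat}) (Gam W : nat -> {RV P >-> R})
    (Rinf : R -> {RV P' >-> R}) (Z : {RV P'' >-> R})
    (halpha : 0 < alpha < 2) (halpha1 : alpha != 1)
    (hN : unit_rate_poisson_process N) (hGam : arrival_times N Gam)
    (hW : iid W) (hWGam : independent_sequences P W Gam)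
    (hW2 : (0 < 'E_P[fun w => (W 0%N w ^+ 2)%R] < +oo)%E)
    (hRinf : forall c : R, 0 < c ->
       cvg_in_distribution P P'
         (fun D : nat => residual alpha W Gam c D) \oo (Rinf c))
    (hZ : forall A : set R, measurable A ->
       distribution P'' Z A = normal_prob 0 1 A) :
  cvg_in_distribution P' P''
    (fun (c : R) (w : T') =>
       (Rinf c w - residual_mean alpha W c) /
         Num.sqrt (residual_var alpha W c))
    +oo Z.
Proof.
apply: cvg_in_distribution_smooth3 => //.
  by move=> c; apply: measurable_funM => //; exact: measurable_funB.
move=> h sh; have [C [h1 [h2 [Th mh1 mh2]]]] := sh.
have mh := taylor3_measurable Th; have [hC _] := Th.
have -> : \int[P'']_w h (Z w) = \int[normal_prob (0 : R) 1]_z h z.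
  rewrite /Rintegral; congr fine.
  (* [normal_prob] lives on [measurableTypeR R], so [Z] is retyped before its law is compared. *)
  have mZ : measurable_fun setT (Z : T'' -> measurableTypeR R).
    by move=> _ Y mY; rewrite setTI; exact: (measurable_funPTI Z).
  transitivity (\int[pushforward P'' (Z : T'' -> measurableTypeR R)]_x (h x)%:E)%E; last first.
    by apply: eq_measure_integral => A mA _; exact: (hZ A mA).
  rewrite integral_pushforward//; first exact/measurable_EFinP.
  apply: (bounded_integrable _ (M := C)) => [|w]; last exact: hC.
  exact: measurableT_comp.
apply/cvgrPdist_le => e e0.
apply: filterS2 (residual_normal_small halpha hW2 Th e0) (nbhs_pinfty_gt (num_real (0 : R))) => c small c0.
rewrite distrC; apply: le_trans small.
apply: (residual_normal_bound halpha halpha1 hN hGam hW hWGam hW2 Th mh1 mh2 c0).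
set m := residual_mean _ _ _; set S := Num.sqrt _.
(* At fixed [c] the standardisation is affine, so it can be moved into the test function and [hRinf]
   applies. *)
pose f (x : R) := 1 * h (S^-1 * x + - m / S).
have fE x : f x = h ((x - m) / S) by rewrite /f mul1r mulrBl mulNr [S^-1 * x]mulrC.
have sf : smooth3 f by exact: smooth3_affine.
have mf := smooth3_measurable sf.
have fC x : `|f x| <= C by rewrite fE.
have := hRinf c c0 f (smooth3_continuous sf) (ex_intro _ C fC).
have intf dX (X : measurableType dX) (Q : probability X R) (Y : X -> R) :
    measurable_fun setT Y -> ('E_Q[f \o Y])%E = (\int[Q]_w h ((Y w - m) / S))%:E.
  move=> mY; rewrite expectation_Rintegral.
    by congr EFin; apply: eq_Rintegral => w _; rewrite -fE.
  apply: (bounded_integrable _ (M := C)) => [|w]; last exact: fC.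
  exact: measurableT_comp.
rewrite (intf _ _ P')//.
under eq_fun do rewrite (intf _ _ P _ (measurable_residual alpha Gam W c _)).
by move=> /fine_cvg.
Qed.
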